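(* Let $F$ be a potential satisfying the structural condition (F) and the growth condition (G) given in the context. Given any energy constant $\lambda>0$, any initial configuration $x\in\widetilde\Omega$ and any non-collision configuration $a\in\Omega$ with $\|a\|=1$, the following hold. (i) There exists a hyperbolic motion $\gamma:[0,+\infty)\to\widetilde\Omega$ to the Hamiltonian $\frac12\|p\|^2-F(x)$ with energy constant $\lambda$, along $\sqrt{2\lambda}\,a$ and starting from $x$; that is, $\gamma$ is an $m_\lambda$-geodesic ray with canonical parameter, $\gamma(0)=x$ and $\gamma(t)=\sqrt{2\lambda}\,a\,t+o(t)$ as $t\to+\infty$. Moreover, this $\gamma$ has the following properties. (ii) There exists $t_0=t_0(x,a,\lambda)\ge 0$ such that $\gamma|_{[t_0,\infty)}$ is collision-free, that is, $\gamma(t)\in\Omega$ for all $t\ge t_0$. (iii) If $F\in C^2(\Omega)$, then $\gamma|_{[t_0,\infty)}$ is a hyperbolic motion to the system $\ddot x=\nabla_xF(x)$ along $\sqrt{2\lambda}\,a$. (iv) If $F\in C^2(\Omega)$ and in addition $\gamma|_{(0,t_0)}$ is collision-free (i.e. $\gamma(t)\in\Omega$ for all $t\in(0,t_0)$), then $\gamma$ is a hyperbolic motion to the system $\ddot x=\nabla_xF(x)$ starting from $x$ and along $\sqrt{2\lambda}\,a$.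
   Context: Let $d\ge2$ and $N\ge2$ be integers and $m_1,\dots,m_N>0$ masses. Configurations are $x=(x_1,\dots,x_N)\in(\mathbb R^d)^N=\mathbb R^{dN}$; $\|p\|=(\sum_{i=1}^N m_i|p_i|^2)^{1/2}$ is the mass-weighted norm. Put $\Omega=\{x\in\mathbb R^{dN}: x_i\neq x_j\ \forall\,1\le i<j\le N\}$ (non-collision configurations), $\Sigma=\mathbb R^{dN}\setminus\Omega$, $\Delta=\{(z,z):z\in\mathbb R^d\}$, and $\Delta_\delta=\{(z,w)\in\mathbb R^d\times\mathbb R^d:|z-w|<\delta\}$. Let $\nabla_xF=(\nabla_{x_i}F)_{1\le i\le N}$ with $\nabla_{x_i}=\frac1{m_i}\frac{\partial}{\partial x_i}$. Condition (F): $F(x)=\sum_{1\le i<j\le N}F_{ij}(x_i,x_j)$, where each $F_{ij}:(\mathbb R^d\times\mathbb R^d)\setminus\Delta\to[0,\infty)$ is locally bounded and lower semicontinuous. Each $F_{ij}$ is extended to $\mathbb R^d\times\mathbb R^d$ with values in $[0,\infty]$ by $F_{ij}(z,z)=\liminf_{(x_i,x_j)\to(z,z)}F_{ij}(x_i,x_j)$, so $F$ becomes a lower semicontinuous function $\mathbb R^{dN}\to[0,\infty]$. ''$F\in C^2(\Omega)$'' means that every $F_{ij}$ is $C^2$ on $(\mathbb R^d\times\mathbb R^d)\setminus\Delta$. Condition (G): there is a continuous $f:(0,\infty)\to(0,\infty)$ with $\sum_{k=1}^\infty\big(2^{-k}\int_{2^k}^{2^{k+1}}f(s)\,ds\big)^{1/2}<\infty$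 such that $F_{ij}(x_i,x_j)\le f(|x_i-x_j|)$ for all $(x_i,x_j)\in(\mathbb R^d\times\mathbb R^d)\setminus\Delta_2$ and all $1\le i<j\le N$. For $W\subset\mathbb R^{dN}$, $\mathcal{AC}(x,y;[0,\sigma];W)$ is the set of absolutely continuous $\gamma:[0,\sigma]\to W$ with $\gamma(0)=x$, $\gamma(\sigma)=y$. For $\lambda>0$ and $\gamma$ defined on $[0,\sigma]$, set $A_\lambda(\gamma)=\int_0^\sigma[\frac12\|\dot\gamma(s)\|^2+F(\gamma(s))+\lambda]\,ds$, and let $m_\lambda(x,y)=\inf\{A_\lambda(\gamma):\gamma\in\mathcal{AC}(x,y;[0,\sigma];\mathbb R^{dN})\text{ for some }\sigma>0\}$ (Mañé's potential). Let $\widetilde\Omega=\{y\in\mathbb R^{dN}:\exists\lambda>0,\ x\in\Omega\text{ with }m_\lambda(x,y)<+\infty\}$ (this set is the same for any fixed choice of $\lambda>0$ and $x\in\Omega$). A curve $\gamma\in\mathcal{AC}(x,y;[0,\sigma];\widetilde\Omega)$ with $A_\lambda(\gamma)=m_\lambda(x,y)$ is called an $m_\lambda$-geodesic with canonical parameter. A continuous curve $\gamma:[0,\infty)\to\widetilde\Omega$ is an $m_\lambda$-geodesic ray with canonical parameter if $\gamma|_{[0,\sigma]}$ is an $m_\lambda$-geodesic with canonical parameter for every $\sigma>0$. A hyperbolic motion to the Hamiltonian $\frac12\|p\|^2-F(x)$ with energy constant $\lambda$ along $b\in\Omega$ is an $m_\lambda$-geodesic ray $\gamma$ with canonical parameter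 satisfying $\gamma(t)=bt+o(t)$ as $t\to+\infty$. A hyperbolic motion to the system $\ddot x=\nabla_xF(x)$ along $b\in\Omega$ is a solution of that system on a half-line $[t_0,\infty)$ satisfying $x(t)=bt+o(t)$ as $t\to+\infty$; here a solution is a continuous curve which takes values in $\Omega$ and satisfies the equation on the open half-line $(t_0,\infty)$ (its starting point may be a collision). *)

(* Defs.v *)
From HB Require Import structures.
From mathcomp Require Import all_boot all_order all_algebra.
From mathcomp Require Import all_classical all_reals all_analysis.

Set Implicit Arguments.
Unset Strict Implicit.
Unset Printing Implicit Defensive.

Import Order.TTheory GRing.Theory Num.Theory.
Import numFieldTopology.Exports numFieldNormedType.Exports.

Local Open Scope classical_set_scope.
Local Open Scope ring_scope.

(* Euclidean norm; the library norm on matrices is the max norm, which induces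
   the same topology. *)
Definition enorm {R : realType} {d : nat} (v : 'rV[R]_d) : R :=
  Num.sqrt (\sum_(k < d) v ord0 k ^+ 2).

(* A configuration x : 'M[R]_(N, d) has the position x_i of body i as row i. *)
Definition mnorm {R : realType} {N d : nat} (m : 'I_N -> R)
    (p : 'M[R]_(N, d)) : R :=
  Num.sqrt (\sum_(i < N) m i * enorm (row i p) ^+ 2).

Definition Omega (R : realType) (N d : nat) : set 'M[R]_(N, d) :=
  [set x | forall i j : 'I_N, (i < j)%N -> row i x <> row j x].
Arguments Omega {R N d}.

Definition offdiag (R : realType) (d : nat) : set ('rV[R]_d * 'rV[R]_d) :=
  [set p | p.1 <> p.2].
Arguments offdiag {R d}.

(* The pair potentials are total functions [Fp i j]; only the indices [i < j]
   and the values off the diagonal are ever used. *)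
Definition pair_potentials (R : realType) (N d : nat) : Type :=
  'I_N -> 'I_N -> 'rV[R]_d * 'rV[R]_d -> R.

(* Semicontinuity on the set [offdiag] is semicontinuity for the topology of
   [subspace offdiag], in which the points outside [offdiag] are isolated. *)
Definition condF {R : realType} {N d : nat} (Fp : pair_potentials R N d) : Prop :=
  forall i j : 'I_N, (i < j)%N ->
  [/\ forall p, offdiag p -> 0 <= Fp i j p,
      [locally [bounded Fp i j p | p in @offdiag R d]] &
      lower_semicontinuous
        ((fun p => (Fp i j p)%:E) : subspace (@offdiag R d) -> \bar R)].

Definition condG {R : realType} {N d : nat} (Fp : pair_potentials R N d) : Prop :=
  exists f : R -> R,
  [/\ {within `]0, +oo[, continuous f},
      forall s : R, 0 < s -> 0 < f s,
      (\sum_(1 <= k <oo)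
         (Num.sqrt (2 ^- k *
            \int[@lebesgue_measure R]_(s in `[2 ^+ k, 2 ^+ k.+1]) f s))%:E
       < +oo)%E &
      forall (i j : 'I_N) (p : 'rV[R]_d * 'rV[R]_d), (i < j)%N ->
        2 <= enorm (p.1 - p.2) -> Fp i j p <= f (enorm (p.1 - p.2))].

(* Class C^n on an open set, by recursion through the differential x |-> df_x:
   in finite dimension df is C^n iff x |-> df_x(v) is C^n for every v. *)
Fixpoint Cn_on {R : realType} {V : normedModType R} (n : nat) (D : set V)
    (f : V -> R) : Prop :=
  if n is n'.+1 then
    (forall x, D x -> differentiable f x) /\
    (forall v : V, Cn_on n' D ('D_v f))
  else {within D, continuous f}.

Definition C2_potential {R : realType} {N d : nat} (Fp : pair_potentials R N d) :
    Prop :=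
  forall i j : 'I_N, (i < j)%N -> Cn_on 2 offdiag (Fp i j).

(* The lower limit at a diagonal point is taken along off-diagonal points only,
   the given function being undefined on the diagonal. *)
Definition extend_pair {R : realType} {d : nat}
    (g : 'rV[R]_d * 'rV[R]_d -> R) (p : 'rV[R]_d * 'rV[R]_d) : \bar R :=
  if p.1 == p.2 then limf_einf (EFin \o g) (within offdiag (nbhs p))
  else (g p)%:E.

Definition potential {R : realType} {N d : nat} (Fp : pair_potentials R N d)
    (x : 'M[R]_(N, d)) : \bar R :=
  (\sum_(i < N) \sum_(j < N | (i < j)%N)
     extend_pair (Fp i j) (row i x, row j x))%E.

(* Only used at points of the open set [Omega], where the potential is finite. *)
Definition grad_potential {R : realType} {N d : nat} (m : 'I_N -> R)
    (Fp : pair_potentials R N d) (x : 'M[R]_(N, d)) : 'M[R]_(N, d) :=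
  \matrix_(i < N, k < d)
    ((m i)^-1 * 'D_(delta_mx i k) (fun y => fine (potential Fp y)) x).

(* A curve on [0, sigma] or [0, +oo[ is the restriction of a total function on
   R: none of the notions below depends on its values elsewhere. *)
Definition abs_continuous {R : realType} {N d : nat} (m : 'I_N -> R)
    (s t : R) (gamma : R -> 'M[R]_(N, d)) : Prop :=
  forall eps : R, 0 < eps -> exists2 delta : R, 0 < delta &
  forall (n : nat) (a b : 'I_n -> R),
    (forall k, [/\ s <= a k, a k <= b k & b k <= t]) ->
    trivIset setT (fun k => `]a k, b k[%classic) ->
    \sum_(k < n) (b k - a k) < delta ->
    \sum_(k < n) mnorm m (gamma (b k) - gamma (a k)) < eps.

Definition AC {R : realType} {N d : nat} (m : 'I_N -> R)
    (x y : 'M[R]_(N, d)) (sigma : R) (W : set 'M[R]_(N, d)) :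
    set (R -> 'M[R]_(N, d)) :=
  [set gamma | [/\ abs_continuous m 0 sigma gamma,
                   forall s : R, 0 <= s <= sigma -> W (gamma s),
                   gamma 0 = x & gamma sigma = y]].

(* The velocity of an absolutely continuous curve exists almost everywhere;
   the values of [derive1] on the remaining null set are irrelevant. *)
Definition action {R : realType} {N d : nat} (m : 'I_N -> R)
    (Fp : pair_potentials R N d) (lambda sigma : R)
    (gamma : R -> 'M[R]_(N, d)) : \bar R :=
  (\int[@lebesgue_measure R]_(s in `[0%R, sigma])
     ((2^-1 * mnorm m (derive1 gamma s) ^+ 2)%:E + potential Fp (gamma s)
      + lambda%:E))%E.

Definition mane {R : realType} {N d : nat} (m : 'I_N -> R)
    (Fp : pair_potentials R N d) (lambda : R) (x y : 'M[R]_(N, d)) : \bar R :=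
  ereal_inf [set A | exists (sigma : R) (gamma : R -> 'M[R]_(N, d)),
    [/\ 0 < sigma, AC m x y sigma setT gamma &
        A = action m Fp lambda sigma gamma]].

Definition tOmega {R : realType} {N d : nat} (m : 'I_N -> R)
    (Fp : pair_potentials R N d) : set 'M[R]_(N, d) :=
  [set y | exists (lambda : R) (x : 'M[R]_(N, d)),
    [/\ 0 < lambda, Omega x & (mane m Fp lambda x y < +oo)%E]].

Definition geodesic {R : realType} {N d : nat} (m : 'I_N -> R)
    (Fp : pair_potentials R N d) (lambda : R) (x y : 'M[R]_(N, d)) (sigma : R)
    (gamma : R -> 'M[R]_(N, d)) : Prop :=
  AC m x y sigma (tOmega m Fp) gamma /\
  action m Fp lambda sigma gamma = mane m Fp lambda x y.

Definition geodesic_ray {R : realType} {N d : nat} (m : 'I_N -> R)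
    (Fp : pair_potentials R N d) (lambda : R) (gamma : R -> 'M[R]_(N, d)) :
    Prop :=
  [/\ {within `[0, +oo[, continuous gamma},
      forall t : R, 0 <= t -> tOmega m Fp (gamma t) &
      forall sigma : R, 0 < sigma ->
        geodesic m Fp lambda (gamma 0) (gamma sigma) sigma gamma].

(* gamma(t) = b t + o(t) as t -> +oo. *)
Definition asymptotic_to {R : realType} {N d : nat} (b : 'M[R]_(N, d))
    (gamma : R -> 'M[R]_(N, d)) : Prop :=
  t^-1 *: (gamma t - t *: b) @[t --> +oo] --> (0 : 'M[R]_(N, d)).

Definition hyperbolic_hamiltonian {R : realType} {N d : nat} (m : 'I_N -> R)
    (Fp : pair_potentials R N d) (lambda : R) (b : 'M[R]_(N, d))
    (gamma : R -> 'M[R]_(N, d)) : Prop :=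
  [/\ Omega b, geodesic_ray m Fp lambda gamma & asymptotic_to b gamma].

Definition newton_solution {R : realType} {N d : nat} (m : 'I_N -> R)
    (Fp : pair_potentials R N d) (t0 : R) (gamma : R -> 'M[R]_(N, d)) : Prop :=
  {within `[t0, +oo[, continuous gamma} /\
  (forall t : R, t0 < t ->
    [/\ Omega (gamma t), derivable gamma t 1, derivable (derive1 gamma) t 1 &
        derive1n 2 gamma t = grad_potential m Fp (gamma t)]).

Definition hyperbolic_newton {R : realType} {N d : nat} (m : 'I_N -> R)
    (Fp : pair_potentials R N d) (t0 : R) (b : 'M[R]_(N, d))
    (gamma : R -> 'M[R]_(N, d)) : Prop :=
  [/\ Omega b, newton_solution m Fp t0 gamma & asymptotic_to b gamma].

(* Main.v *)
(* Let v = sqrt (2 lambda) and b = v a. Splitting a curve at time t and comparing the kinetic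
   energy with that of a uniform motion shows that a curve from x to T u, with |u| = v, has action
   at least 2 lambda T - v |x| + |gamma(t) - x - t u|^2 / (2 t). Going from x to the ray of u and
   then along this ray shows that Mane's potential at T u is at most 2 lambda T + E(T), where by
   condition (G) sqrt (E(2^k) / 2^k) is summable over k. Hence for an almost minimizing curve the
   directions of gamma(2^k) and gamma(2^(k+1)) differ by O(sqrt (E(2^k) / 2^k)); almost minimizers
   from x to 2^n b therefore stay within t eps(t) of t b, with eps independent of n. Their actions
   on [0, T] are bounded, they are equi-Hoelder, and by lower semicontinuity of the action a
   pointwise limit minimizes on every [0, T] with gamma(T) collision-free, where Mane's potential
   is continuous; this holds for all large T, so the limit is a geodesic ray.

   For the equation of motion, hat-function variations show that the second symmetric differences
   of the coordinates of gamma converge to the gradient of F, and a continuous function whose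
   second symmetric differences converge to a continuous limit is of class C^2 (Schwarz). *)

Require Import Defs.
From HB Require Import structures.
From mathcomp Require Import all_boot all_order all_algebra.
From mathcomp Require Import all_classical all_reals all_analysis.
From mathcomp Require Import measurable_realfun ring lra.

Set Implicit Arguments.
Unset Strict Implicit.
Unset Printing Implicit Defensive.

Import Order.TTheory GRing.Theory Num.Theory.
Import numFieldTopology.Exports numFieldNormedType.Exports.

Local Open Scope classical_set_scope.
Local Open Scope ring_scope.

(** * Absolutely continuous real functions *)

Section absolute_continuity.
Variable R : realType.
Implicit Types (f g : R -> R) (a b : R).

(** No exact minimizer ending at a far configuration is constructed: curves within [1 / n.+1] of the
    infimum suffice, since initial arcs inherit the error. The travel time is free, so a curve aimed
    at [2 ^+ n.+1 *: b] must also be shown not to arrive before time [2 ^+ n].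

    The lower bounds are calibrations: [|p|^2 / 2 + lambda >= <w, p>] as soon as [|w|^2 = 2 lambda].
    They need directions of norm exactly [v], so a point of a near-minimizer is projected radially
    before it serves as a new end point.

    Continuity of Mane's potential is available only at collision-free configurations. The limit is
    therefore shown to minimize up to late times, and earlier times, collisions included, follow by
    restriction.

    Velocities exist only almost everywhere, so energies are computed through integrable densities
    of the coordinates, obtained from the Radon-Nikodym theorem; hence the start with real
    functions. The limit is a priori only absolutely continuous, so its equation of motion is tested
    on piecewise affine variations, whose kinetic energy is explicit. *)

Definition nonoverlapping (I : Type) (p q : I -> R) :=
  forall i j, i <> j -> q i <= p j \/ q j <= p i.

(** Families are indexed by arbitrary finite types so that subdividing every interval of a family
    gives again a family, indexed by a sigma type. *)
Definition real_AC a b f := forall e : R, 0 < e -> exists2 d : R, 0 < d &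
  forall (I : finType) (p q : I -> R),
    (forall i, [/\ a <= p i, p i <= q i & q i <= b]) -> nonoverlapping p q ->
    \sum_i (q i - p i) < d -> \sum_i `|f (q i) - f (p i)| < e.

Lemma real_ACB a b f g : real_AC a b f -> real_AC a b g -> real_AC a b (fun x => f x - g x).
Proof.
move=> hf hg e e0.
have [d1 d10 h1] := hf _ (divr_gt0 e0 (ltr0Sn _ 1)).
have [d2 d20 h2] := hg _ (divr_gt0 e0 (ltr0Sn _ 1)).
exists (Num.min d1 d2); first by rewrite lt_min d10.
move=> I p q pq sep; rewrite lt_min => /andP[/(h1 _ _ _ pq sep) k1 /(h2 _ _ _ pq sep) k2].
rewrite (splitr e); apply: le_lt_trans (ltrD k1 k2).
rewrite -big_split /=; apply: ler_sum => i _.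
have -> : f (q i) - g (q i) - (f (p i) - g (p i)) =
  (f (q i) - f (p i)) - (g (q i) - g (p i)) by ring.
exact: ler_normB.
Qed.

Lemma partition_family a b s : itv_partition a b s ->
  let p (i : 'I_(size s)) := nth b (a :: s) i in
  let q (i : 'I_(size s)) := nth b s i in
  [/\ forall i, [/\ a <= p i, p i <= q i & q i <= b], nonoverlapping p q &
      \sum_i (q i - p i) = b - a].
Proof.
move=> abs p q.
have srt : sorted <=%O (a :: s).
  by case: (abs) => sa _ /=; apply: sub_path sa => x y /ltW.
have mono i j : (i <= j)%N -> (j <= size s)%N -> nth b (a :: s) i <= nth b (a :: s) j.
  move=> ij js.
  have := @sorted_leq_nth _ <=%O le_trans lexx b (a :: s) srt i j.
  rewrite !inE /= !ltnS; apply => //; exact: leq_trans js.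
split.
- move=> i; split; last 1 first.
  + exact: (@itv_partition_nth_le _ _ a b s i.+1 (ltn_ord i) abs).
  + by apply: itv_partition_nth_ge => //; apply: ltn_trans (ltn_ord i) _.
  + by apply: (mono i i.+1).
- move=> i j /eqP; rewrite -val_eqE /= neq_ltn => /orP[ij|ij].
  + by left; apply: (mono i.+1 j) => //; exact: ltnW.
  + by right; apply: (mono j.+1 i) => //; exact: ltnW.
- rewrite -(big_mkord xpredT (fun i => nth b s i - nth b (a :: s) i)).
  rewrite (@telescope_sumr_eq _ 0 (size s) (nth b (a :: s))) //=.
  by rewrite (itv_partition_nth_size b abs).
Qed.

Lemma real_AC_variation a b f e d c c' s :
  (forall (I : finType) (p q : I -> R),
    (forall i, [/\ a <= p i, p i <= q i & q i <= b]) -> nonoverlapping p q ->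
    \sum_i (q i - p i) < d -> \sum_i `|f (q i) - f (p i)| < e) ->
  a <= c -> c' <= b -> c' - c < d -> itv_partition c c' s -> variation c c' f s < e.
Proof.
move=> h ac c'b cd /partition_family[h1 h2 h3].
rewrite /variation big_mkord; apply: h => //.
- move=> i; have [k1 k2 k3] := h1 i; split => //; [exact: le_trans k1|exact: le_trans c'b].
- by rewrite h3.
Qed.

(** The modulus for [e = 1] bounds the variation over any interval shorter than [d] by 1, and
    finitely many steps of length [d / 2] cover [[a, b]]. *)
Lemma real_AC_BV a b f : a <= b -> real_AC a b f -> bounded_variation a b f.
Proof.
move=> ab hf; apply/bounded_variationP => //.
have [d d0 hd] := hf 1 ltr01.
suff H k t : a <= t <= b -> t <= a + (d / 2) *+ k -> total_variation a t f \is a fin_num.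
  have [n hn] : exists n, b <= a + (d / 2) *+ n.
    exists (Num.bound ((b - a) / (d / 2))).
    rewrite -lerBlDl -mulr_natl -ler_pdivrMr; last by rewrite divr_gt0.
    by rewrite ltW // archi_boundP // divr_ge0 // ?subr_ge0 // ltW // divr_gt0.
  by apply: (H n b); rewrite ?ab ?lexx.
elim: k t => [|k ih] t /andP[at1 tb].
  rewrite mulr0n addr0 => ta.
  by have -> : t = a; [apply/eqP; rewrite eq_le ta|rewrite total_variationxx].
move=> tk.
pose c := Num.max a (t - d / 2).
have ac : a <= c by rewrite le_max lexx.
have ct : c <= t by rewrite ge_max at1 gerBl ltW // divr_gt0.
rewrite (total_variationD f ac ct) fin_numD; apply/andP; split.
  apply: ih; first by rewrite ac (le_trans ct).
  rewrite ge_max lerDl mulrn_wge0 ?divr_ge0 ?(ltW d0) //=.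
  by rewrite lerBlDr -addrA -mulrSr.
rewrite ge0_fin_numE ?total_variation_ge0 //.
apply: (@le_lt_trans _ _ 1%E); last exact: ltry.
apply: ge_ereal_sup => _ [_ [s cts <-] <-]; rewrite lee_fin ltW //.
apply: (real_AC_variation hd ac tb _ cts).
rewrite ltrBlDr -ltrBlDl lt_max; apply/orP; right.
by rewrite ltrD2l ltrN2 gtr_pMr // invf_lt1 ?ltr1n.
Qed.

(** Each increment of the variation is nearly attained by a partition of its interval. All these
    partitions together form one family of the same total length, so the modulus of [f] for [e / 2]
    serves for the variation. *)
Lemma TV_real_AC a b f : a <= b -> real_AC a b f ->
  real_AC a b (fun t => fine (total_variation a t f)).
Proof.
move=> ab hf; have bv := real_AC_BV ab hf.
have fin s t : a <= s -> s <= t -> t <= b -> total_variation s t f \is a fin_num.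
  move=> as1 st tb; apply/bounded_variationP => //.
  apply: (bounded_variationr as1 st); apply: (bounded_variationl _ tb bv).
  exact: le_trans st.
move=> e e0; have [d d0 hd] := hf _ (divr_gt0 e0 (ltr0Sn _ 1)).
exists d => // I p q pq sep sd.
(* The errors [eta] add up to at most [e / 2] over [I]; the successor covers an empty [I]. *)
pose eta := e / 2 / (#|I|.+1)%:R.
have eta0 : 0 < eta by rewrite !divr_gt0.
have /choice[s hs] : forall i, exists s, itv_partition (p i) (q i) s /\
    fine (total_variation (p i) (q i) f) - eta <= variation (p i) (q i) f s.
  move=> i.
  have [k1 k2 k3] := pq i.
  have := fin _ _ k1 k2 k3.
  rewrite {1}/total_variation => hfin.
  have [x /= [_ [s ps <-] <-] hx] := ub_ereal_sup_adherent eta0 hfin.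
  exists s; split => //; rewrite ltW // -lte_fin; apply: le_lt_trans hx.
  by rewrite EFinB fineK // fin.
pose J := {i : I & 'I_(size (s i))}.
pose P (j : J) := nth (q (tag j)) (p (tag j) :: s (tag j)) (tagged j).
pose Q (j : J) := nth (q (tag j)) (s (tag j)) (tagged j).
have fam i := partition_family (hs i).1.
have H : \sum_j `|f (Q j) - f (P j)| < e / 2.
  apply: hd.
  - move=> j; have [+ _ _] := fam (tag j) => /(_ (tagged j))[k1 k2 k3].
    have [l1 l2 l3] := pq (tag j); split => //; [exact: le_trans k1|exact: le_trans l3].
  - move=> [i k] [i' k'] ne; have [eii|neii] := eqVneq i i'.
      subst i'; have [_ h _] := fam i; apply: h => ekk; apply: ne.
      by move: ekk => /= ->.
    have [+ _ _] := fam i => /(_ k)[k1 k2 k3].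
    have [+ _ _] := fam i' => /(_ k')[l1 l2 l3].
    case: (sep i i' (elimN eqP neii)) => o.
      by left; apply: (le_trans k3); apply: (le_trans o).
    by right; apply: (le_trans l3); apply: (le_trans o).
  - apply: le_lt_trans sd.
    rewrite -(sig_big_dep (op := +%R) (fun _ => true) (fun _ _ => true) (fun (i : I) (k : 'I_(size (s i))) =>
      nth (q i) (s i) k - nth (q i) (p i :: s i) k)) /=.
    by apply: ler_sum => i _; have [_ _ ->] := fam i.
rewrite -(sig_big_dep (op := +%R) (fun _ => true) (fun _ _ => true) (fun (i : I) (k : 'I_(size (s i))) =>
      `|f (nth (q i) (s i) k) - f (nth (q i) (p i :: s i) k)|)) /= in H.
have le_i i : `|fine (total_variation a (q i) f) - fine (total_variation a (p i) f)| <=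
    \sum_(k < size (s i)) `|f (nth (q i) (s i) k) - f (nth (q i) (p i :: s i) k)| + eta.
  have [k1 k2 k3] := pq i; have [_ h] := hs i.
  rewrite (total_variationD f k1 k2) fineD ?fin // ?(le_trans k2) //.
  rewrite addrC addKr ger0_norm; last by rewrite fine_ge0 // total_variation_ge0.
  by rewrite -lerBlDr; apply: le_trans h _; rewrite /variation big_mkord.
apply: le_lt_trans (ler_sum _ (fun i _ => le_i i)) _.
rewrite big_split /= (splitr e); apply: ltr_leD => //.
rewrite sumr_const -[eta *+ _]mulr_natr /eta -mulrA.
rewrite -[leRHS]mulr1 ler_pM2l ?divr_gt0 // mulrC ler_pdivrMr // mul1r ler_nat.
exact: leqW.
Qed.

End absolute_continuity.

(** * Densities and almost everywhere derivatives *)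

Section absolutely_continuous_density.
Variable R : realType.
Implicit Types (f g : R -> R) (a b : R).
Notation mu := (@lebesgue_measure R).

Lemma real_AC_unif a b f : real_AC a b f -> forall e : R, 0 < e -> exists2 d : R, 0 < d &
  forall s t, a <= s -> s <= t -> t <= b -> t - s < d -> `|f t - f s| < e.
Proof.
move=> hf e e0; have [d d0 h] := hf e e0; exists d => // s t as_ st tb tsd.
have := h 'I_1 (fun=> s) (fun=> t); rewrite !big_ord1; apply => //.
by move=> i j; rewrite (ord1 i) (ord1 j).
Qed.

Lemma lebesgue_le (A B : set R) : measurable A -> measurable B -> A `<=` B ->
  (mu A <= mu B)%E.
Proof. by move=> mA mB AB; apply: le_measure; rewrite ?inE. Qed.

Lemma lebesgue_ge_length (u v : R) (A : set R) : u <= v -> measurable A ->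
  `]u, v[ `<=` A -> ((v - u)%:E <= mu A)%E.
Proof.
move=> uv mA sub; apply: le_trans (lebesgue_le (measurable_itv _) mA sub).
rewrite lebesgue_measure_itv /= lte_fin; move: uv; rewrite le_eqVlt.
by move=> /orP[/eqP ->|->]; rewrite ?ltxx ?subrr.
Qed.

(** Finite measure makes the interval bounded, and openness excludes its infimum and supremum. This
    provides real end points for the components of an open set of small measure. *)
Lemma open_interval_ends (J : set R) (L : R) :
  open J -> is_interval J -> J !=set0 -> (mu J < L%:E)%E ->
  exists c e : R, [/\ c < e, `]c, e[ `<=` J & J `<=` `]c, e[].
Proof.
move=> oJ iJ [x0 Jx0] muJ.
have mJ : measurable J by exact: measurable_realfun.open_measurable.
have L0 : 0 < L by rewrite -lte_fin; apply: le_lt_trans muJ.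
have nosub u v : u <= v -> `[u, v] `<=` J -> v - u < L.
  move=> uv sub; rewrite -lte_fin; apply: le_lt_trans muJ.
  apply: lebesgue_ge_length => //; apply: subset_trans sub => x /=.
  by rewrite !in_itv /= => /andP[/ltW -> /ltW ->].
have sub_itv u v : J u -> J v -> `[u, v] `<=` J.
  by move=> Ju Jv z /=; rewrite in_itv /=; exact: iJ.
have ubJ : has_ubound J.
  exists (x0 + L) => y Jy; rewrite leNgt; apply/negP => hy.
  have xy : x0 <= y by rewrite ltW // (lt_trans _ hy) // ltrDl.
  by have := nosub _ _ xy (sub_itv _ _ Jx0 Jy); rewrite ltrBlDl ltNge (ltW hy).
have lbJ : has_lbound J.
  exists (x0 - L) => y Jy; rewrite leNgt; apply/negP => hy.
  have xy : y <= x0 by rewrite ltW // (lt_trans hy) // gtrBl.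
  by have := nosub _ _ xy (sub_itv _ _ Jy Jx0); rewrite ltrBlDl -ltrBlDr ltNge (ltW hy).
have J0 : J !=set0 by exists x0.
have near_in y : J y -> exists2 r, 0 < r & J (y - r) /\ J (y + r).
  move=> Jy; have : nbhs y J by apply: open_nbhs_nbhs.
  move=> /nbhs_ballP[r /= r0 h]; exists (r / 2); first by rewrite divr_gt0.
  by split; apply: h; rewrite /ball /= ?opprD ?opprB ?addrA ?subrr ?add0r ?addrK
    ?addrC ?addrK ?subKr ?opprK ?normrN ger0_norm ?ltr_pdivrMr ?ltr_pMr ?ltr1n //
    ?divr_ge0 // ?ltW.
have Jlt y : J y -> inf J < y < sup J.
  move=> Jy; have [r r0 [h1 h2]] := near_in _ Jy; apply/andP; split.
    by apply: (@le_lt_trans _ _ (y - r)); [exact: ge_inf|rewrite gtrBl].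
  by apply: (@lt_le_trans _ _ (y + r)); [rewrite ltrDl|exact: ub_le_sup].
exists (inf J), (sup J); split.
- by have /andP[] := Jlt _ Jx0 => h1 h2; exact: lt_trans h1 h2.
- move=> y /=; rewrite in_itv /= => /andP[h1 h2].
  have [u Ju uy] := inf_lt J0 h1; have [v Jv yv] := sup_gt J0 h2.
  by apply: (iJ u v) => //; rewrite !ltW.
- by move=> y Jy; rewrite /= in_itv /=; exact: Jlt.
Qed.

Lemma lebesgue_stieltjes_itvoc (F : cumulative R R) c e : c <= e ->
  lebesgue_stieltjes_measure F `]c, e] = (F e - F c)%:E.
Proof.
move=> ce; rewrite /lebesgue_stieltjes_measure /measure_extension /=.
by rewrite measurable_mu_extE /= ?wlength_itv_bnd //; exact: is_ocitv.
Qed.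

(** Retraction onto [[a, b]] when [a <= b]. Composing with it extends a function by constants and
    turns continuity within the interval into continuity on the line. *)
Definition clip a b x : R := Num.max a (Num.min x b).

Lemma clip_itv a b x : a <= b -> a <= clip a b x <= b.
Proof. by move=> ab; rewrite /clip le_max lexx /= ge_max ab ge_min lexx orbT. Qed.

Lemma clip_nd a b x y : x <= y -> clip a b x <= clip a b y.
Proof.
move=> xy; rewrite /clip ge_max le_max lexx /= le_max.
by apply/orP; right; rewrite le_min !ge_min xy lexx orbT.
Qed.

Lemma clip_id a b x : a <= x <= b -> clip a b x = x.
Proof. by move=> /andP[ax xb]; rewrite /clip (min_idPl xb) (max_idPr ax). Qed.

Lemma clip_lip a b x y : a <= b -> x <= y -> clip a b y - clip a b x <= y - x.
Proof.
move=> ab xy; rewrite /clip.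
have [h1|h1] := leP x b; have [h2|h2] := leP y b; have [h3|h3] := leP a x;
  have [h4|h4] := leP a y; have [h5|h5] := leP a b; lra.
Qed.

Lemma clip_dist a b x y : a <= b -> `|clip a b x - clip a b y| <= `|x - y|.
Proof.
move=> ab; wlog xy : x y / y <= x.
  move=> h; have [xy|/ltW yx] := leP y x; first exact: h.
  by rewrite distrC (distrC x); exact: h.
by rewrite !ger0_norm ?subr_ge0 ?clip_lip // clip_nd.
Qed.

Section nondecreasing_density.
Variables (a b : R) (g : R -> R).
Hypotheses (ab : a < b) (gAC : real_AC a b g)
  (gnd : {in `[a, b] &, nondecreasing_fun g}).

Let G x := g (clip a b x).

Let clamp_itv x : a <= clip a b x <= b.
Proof. exact/clip_itv/ltW. Qed.

Let Gnd : nondecreasing G.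
Proof.
move=> x y xy; apply: gnd; rewrite ?in_itv /= ?clamp_itv //.
exact: clip_nd.
Qed.

Let Gcont : continuous G.
Proof.
move=> x; apply/cvgrPdist_lt => e e0.
have [d d0 h] := real_AC_unif gAC e0.
near=> y.
have xyd : `|x - y| < d by near: y; exists d.
have /andP[h1 h2] := clamp_itv x; have /andP[h3 h4] := clamp_itv y.
have [xy|/ltW xy] := leP x y.
  rewrite distrC; apply: h => //; first exact: clip_nd.
  apply: le_lt_trans (clip_lip (ltW ab) xy) _.
  by rewrite -(ger0_norm (_ : 0 <= y - x)) ?subr_ge0 // distrC.
apply: h => //; first exact: clip_nd.
apply: le_lt_trans (clip_lip (ltW ab) xy) _.
by rewrite -(ger0_norm (_ : 0 <= x - y)) ?subr_ge0.
Unshelve. all: by end_near. Qed.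

Let Grc : right_continuous G.
Proof. exact: right_continuousW Gcont. Qed.

Let Gc : cumulative R R := HB.pack G (isCumulative.Build R _ R G Gnd Grc).

Let nu : {measure set (measurableTypeR R) -> \bar R} := lebesgue_stieltjes_measure Gc.

Let nu_itv c e : c <= e -> nu `]c, e]%classic = (G e - G c)%:E.
Proof.
exact: (lebesgue_stieltjes_itvoc Gc).
Qed.

(** Finitely many components of [U], clipped to [[a, b]], form a nonoverlapping family of total
    length below [d], and the Stieltjes measure of each is at most the increment of [G] over it. *)
Let nu_open (e d : R) (U : set R) :
  (forall (I : finType) (p q : I -> R),
    (forall i, [/\ a <= p i, p i <= q i & q i <= b]) -> nonoverlapping p q ->
    \sum_i (q i - p i) < d -> \sum_i `|g (q i) - g (p i)| < e) ->
  open U -> (mu U < d%:E)%E -> (nu U <= e%:E)%E.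
Proof.
move=> h oU mUd.
pose J := open_disjoint_itv oU.
have oJ k : open (J k) by exact: open_disjoint_itv_open.
have mJ k : measurable (J k) by exact: measurable_realfun.open_measurable.
have tJ : trivIset setT J by exact: open_disjoint_itv_trivIset.
have UJ : U = \bigcup_k J k by exact: open_disjoint_itv_bigcup.
have JU k : J k `<=` U by rewrite UJ; exact: bigcup_sup.
have mU : measurable U by exact: measurable_realfun.open_measurable.
have muJ k : (mu (J k) < d%:E)%E.
  by apply: le_lt_trans mUd; apply: lebesgue_le.
(* An empty component is represented by the degenerate interval at [a], which lies to the left of
   every clipped interval. *)
have /choice[ce hce] : forall k, exists ce : R * R, (J k = set0 /\ ce = (a, a)) \/
    [/\ ce.1 < ce.2, `]ce.1, ce.2[ `<=` J k & J k `<=` `]ce.1, ce.2[ ].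
  move=> k; have [->|/set0P J0] := eqVneq (J k) set0; first by exists (a, a); left.
  have [c [e' [h1 h2 h3]]] := open_interval_ends (oJ k) (@open_disjoint_itv_is_interval _ _ oU k) J0 (muJ k).
  by exists (c, e'); right.
have ce_le k : (ce k).1 <= (ce k).2.
  by case: (hce k) => [[_ ->]//|[/ltW]].
have nuJ k : (nu (J k) <= (G (ce k).2 - G (ce k).1)%:E)%E.
  rewrite -nu_itv //; apply: le_measure; rewrite ?inE //; first exact: mJ.
  case: (hce k) => [[-> _]|[_ _ sub]]; first exact: sub0set.
  by apply: subset_trans sub _ => x /=; rewrite !in_itv /= => /andP[-> /ltW].
have muJce k : (((ce k).2 - (ce k).1)%:E <= mu (J k))%E.
  case: (hce k) => [[_ ->]|[lt sub _]].
    by rewrite /= subrr; exact: measure_ge0.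
  by apply: lebesgue_ge_length => //; exact: ltW.
rewrite UJ measure_bigcup //.
apply: lime_le; first by apply: is_cvg_nneseries => k _ _; exact: measure_ge0.
near=> n.
apply: (@le_trans _ _ (\sum_(k < n) (G (ce k).2 - G (ce k).1)%:E)%E).
  rewrite big_mkord; under eq_bigl do rewrite in_setT.
  by apply: lee_sum => k _; exact: nuJ.
rewrite sumEFin lee_fin.
have -> : \sum_(k < n) (G (ce k).2 - G (ce k).1) =
          \sum_(k < n) `|g (clip a b (ce k).2) - g (clip a b (ce k).1)|.
  by apply: eq_bigr => k _; rewrite ger0_norm // subr_ge0; exact: Gnd.
apply/ltW; apply: h.
- move=> i; have /andP[h1 _] := clamp_itv (ce i).1.
  by have /andP[_ h2] := clamp_itv (ce i).2; split => //; exact: clip_nd.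
- move=> i j ij.
  have nij : (i : nat) <> j by move=> /val_inj.
  case: (hce i) => [[_ ->]|[ci si1 si2]].
    left => /=; rewrite {1}(clip_id (x := a)) ?lexx ?(ltW ab) //.
    by have /andP[] := clamp_itv (ce j).1.
  case: (hce j) => [[_ ->]|[cj sj1 sj2]].
    right => /=; rewrite {1}(clip_id (x := a)) ?lexx ?(ltW ab) //.
    by have /andP[] := clamp_itv (ce i).1.
  have [oo|oo] := leP (ce i).2 (ce j).1; first by left; exact: clip_nd.
  have [oo'|oo'] := leP (ce j).2 (ce i).1; first by right; exact: clip_nd.
  (* Two overlapping components would share the midpoint of their common part, against
     disjointness. *)
  exfalso; apply: nij; apply: (tJ i j) => //.
  pose l := Num.max (ce i).1 (ce j).1; pose r := Num.min (ce i).2 (ce j).2.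
  have lr : l < r by rewrite gt_max !lt_min ci oo oo' cj.
  have [m1 m2] := midf_lt lr.
  exists ((l + r) / 2); split; [apply: si1|apply: sj1]; rewrite /= in_itv /=.
    rewrite (le_lt_trans _ m1) ?le_max ?lexx //=.
    by rewrite (lt_le_trans m2) // ge_min lexx.
  rewrite (le_lt_trans _ m1) ?le_max ?lexx ?orbT //=.
  by rewrite (lt_le_trans m2) // ge_min lexx orbT.
- apply: (@le_lt_trans _ _ (\sum_(k < n) ((ce k).2 - (ce k).1))).
    by apply: ler_sum => k _; exact: clip_lip (ltW ab) _.
  rewrite -lte_fin -sumEFin; apply: le_lt_trans mUd.
  apply: (@le_trans _ _ (\sum_(k < n) mu (J k))%E).
    by apply: lee_sum => k _; exact: muJce.
  rewrite -measure_bigsetU //; apply: lebesgue_le => //.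
    exact: bigsetU_measurable.
  by rewrite -bigcup_mkord => x [k _ Jk]; exact: JU Jk.
- by move=> k _; exact: mJ.
Unshelve. all: by end_near. Qed.

(** Radon-Nikodym for the Stieltjes measure of the extension [G]. A null set lies in an open set of
    small Lebesgue measure, whose Stieltjes measure is small by [nu_open]; this is the required
    domination. *)
Lemma nd_real_AC_density : exists rho : R -> R,
  mu.-integrable setT (EFin \o rho) /\ forall s t, a <= s -> s <= t -> t <= b ->
    (\int[mu]_(x in `[s, t]) (rho x)%:E = (g t - g s)%:E)%E.
Proof.
have nufin : (nu `]a, b]%classic < +oo)%E by rewrite nu_itv ?ltry // ltW.
pose nuD : {finite_measure set _ -> \bar R} :=
  @mfrestr _ (measurableTypeR R) R `]a, b]%classic nu (measurable_itv _) nufin.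
have dom : nuD `<< mu.
  apply/null_content_dominatesP => E mE muE.
  apply/eqP; rewrite eq_le measure_ge0 andbT.
  apply/lee_addgt0Pr => e e0; rewrite add0e.
  have [d d0 h] := gAC e0.
  have [|U [oU EU UE]] := @lebesgue_regularity_outer R E d mE _ d0.
    by rewrite muE ltry.
  apply: (@le_trans _ _ (nu U)).
    apply: le_measure; rewrite ?inE //; [exact: measurableI|exact: measurable_realfun.open_measurable|].
    by move=> x [/EU].
  apply: (nu_open h oU).
  have mU : measurable U by exact: measurable_realfun.open_measurable.
  have -> : mu U = mu (U `\` E); last exact: UE.
  rewrite -{1}(setDUK EU) measureU //; [|exact: measurableD|exact: setDIK].
  by rewrite muE add0e.
have [rho [rho0 rhofin rhoint rhoE]] := radon_nikodym_sigma_finite dom.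
exists (fine \o rho); split.
  by apply: eq_integrable rhoint => // x _; rewrite /= fineK.
move=> s t as1 st tb.
have /integrableP[mrho _] := rhoint.
transitivity (\int[mu]_(x in `]s, t]) rho x)%E.
  rewrite -integral_itv_obnd_cbnd; last first.
    apply: (measurable_funS measurableT) => //.
    by apply: eq_measurable_fun mrho => x _ /=; rewrite fineK.
  by apply: eq_integral => x _; rewrite /= fineK.
rewrite -rhoE // /nuD /= /mfrestr /mrestr setIidl; last first.
  move=> x /=; rewrite !in_itv /= => /andP[h1 h2].
  by rewrite (le_lt_trans as1 h1) (le_trans h2 tb).
rewrite -[LHS]/(nu `]s, t]%classic) nu_itv // /G !clip_id //.
  by rewrite as1 (le_trans st).
by rewrite tb (le_trans as1).
Qed.

End nondecreasing_density.

(** Jordan decomposition: [f] is the difference of its variation [V] and of [V - f], both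
    nondecreasing and absolutely continuous. *)
Lemma real_AC_density a b f : a < b -> real_AC a b f -> exists rho : R -> R,
  mu.-integrable setT (EFin \o rho) /\ forall s t, a <= s -> s <= t -> t <= b ->
    (\int[mu]_(x in `[s, t]) (rho x)%:E = (f t - f s)%:E)%E.
Proof.
move=> ab hf; have bv := real_AC_BV (ltW ab) hf.
pose V t := fine (total_variation a t f).
have VAC : real_AC a b V := TV_real_AC (ltW ab) hf.
have fin s t : a <= s -> s <= t -> t <= b -> total_variation s t f \is a fin_num.
  move=> as1 st tb; apply/bounded_variationP => //.
  apply: (bounded_variationr as1 st); apply: (bounded_variationl _ tb bv).
  exact: le_trans st.
have VD s t : a <= s -> s <= t -> t <= b ->
    V t - V s = fine (total_variation s t f).
  move=> as1 st tb; rewrite /V (total_variationD f as1 st) fineD ?fin //.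
    by rewrite addrC addKr.
  exact: le_trans st tb.
have Vnd : {in `[a, b] &, nondecreasing_fun V}.
  move=> s t; rewrite !in_itv /= => /andP[as1 sb] /andP[at1 tb] st.
  by rewrite -subr_ge0 VD // fine_ge0 // total_variation_ge0.
have Wnd : {in `[a, b] &, nondecreasing_fun (fun x => V x - f x)}.
  move=> s t; rewrite !in_itv /= => /andP[as1 sb] /andP[at1 tb] st.
  rewrite -subr_ge0.
  have -> : V t - f t - (V s - f s) = (V t - V s) - (f t - f s) by ring.
  rewrite VD // subr_ge0 (le_trans (ler_norm _)) //.
  by rewrite -lee_fin fineK ?fin // total_variation_ge.
have [r1 [i1 h1]] := nd_real_AC_density ab VAC Vnd.
have [r2 [i2 h2]] := nd_real_AC_density ab (real_ACB VAC hf) Wnd.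
exists (fun x => r1 x - r2 x); split.
  by apply: eq_integrable (integrableB _ i1 i2).
move=> s t as1 st tb.
transitivity (\int[mu]_(x in `[s, t]) ((r1 x)%:E - (r2 x)%:E))%E.
  by apply: eq_integral => x _; rewrite EFinB.
rewrite integralB //; [|exact: integrableS i1|exact: integrableS i2].
by rewrite h1 // h2 // -EFinB; congr EFin; ring.
Qed.

(** Lebesgue differentiation of the primitive of [rho], which coincides with [f] near every interior
    point once [f a] is added. *)
Lemma density_ae_derive a b f rho : mu.-integrable setT (EFin \o rho) ->
  (forall s t, a <= s -> s <= t -> t <= b ->
    (\int[mu]_(x in `[s, t]) (rho x)%:E = (f t - f s)%:E)%E) ->
  {ae mu, forall x, a < x < b -> is_derive x 1 f (rho x)}.
Proof.
move=> irho h.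
have locf : locally_integrable setT rho.
  by have := integrable_locally measurableT irho; rewrite patch_setT.
have := lebesgue_differentiation locf.
apply: filterS; first exact: (ae_filter_ringOfSetsType mu).
move=> x lx /andP[ax xb].
have ix : mu.-integrable [set` Interval (BLeft a) (BRight b)] (EFin \o rho).
  exact: integrableS irho.
have lax : (a%:E < x%:E)%E by rewrite lte_fin.
have [d1 d2] := FTC1_lebesgue_pt xb ix lax lx.
have isd : is_derive x 1 (fun y => f a + (\int[mu]_(t in [set` Interval (BLeft a) (BRight y)]) rho t)%R) (rho x).
  rewrite -[rho x]add0r; apply: is_deriveD.
  by apply: DeriveDef => //; rewrite -derive1E.
apply: near_eq_is_derive isd; near=> y.
have /andP[/ltW ay /ltW yb] : a < y < b.
  have : y \in `]a, b[ by near: y; apply: near_in_itvoo; rewrite in_itv /= ax.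
  by rewrite in_itv.
by rewrite /Rintegral h // ?lexx //= subrKC.
Unshelve. all: by end_near. Qed.

End absolutely_continuous_density.

(** * The weighted norm and absolutely continuous curves *)

Section matrix_entries.
Variable R : realType.

Lemma entry_le_norm N d (p : 'M[R]_(N, d)) i k : `|p i k| <= `|p|.
Proof. by rewrite [leRHS]mx_normrE; exact: (le_bigmax _ (fun ij : 'I_N * 'I_d => `|p ij.1 ij.2|) (i, k)). Qed.

Lemma norm_le_entries N d (p : 'M[R]_(N, d)) e : 0 <= e ->
  (forall i k, `|p i k| <= e) -> `|p| <= e.
Proof.
by move=> e0 h; rewrite [leLHS]mx_normrE (bigmax_le _ e0) // => -[i k] _; exact: h.
Qed.

End matrix_entries.

Section weighted_norm.
Variables (R : realType) (N d : nat) (m : 'I_N -> R).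
Hypothesis m0 : forall i, 0 < m i.
Implicit Types (p q r : 'M[R]_(N, d)).

Definition wdot p q := \sum_i \sum_k m i * (p i k * q i k).

Lemma wdotC p q : wdot p q = wdot q p.
Proof. by apply: eq_bigr => i _; apply: eq_bigr => k _; rewrite (mulrC (p i k)). Qed.

Lemma wdotDl p q r : wdot (p + q) r = wdot p r + wdot q r.
Proof.
rewrite /wdot -big_split; apply: eq_bigr => i _; rewrite -big_split.
by apply: eq_bigr => k _; rewrite !mxE mulrDl mulrDr.
Qed.

Lemma wdotZl c p q : wdot (c *: p) q = c * wdot p q.
Proof.
rewrite /wdot mulr_sumr; apply: eq_bigr => i _; rewrite mulr_sumr.
by apply: eq_bigr => k _; rewrite !mxE; ring.
Qed.

Lemma wdotDr p q r : wdot r (p + q) = wdot r p + wdot r q.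
Proof. by rewrite wdotC wdotDl !(wdotC r). Qed.

Lemma wdotZr c p q : wdot p (c *: q) = c * wdot p q.
Proof. by rewrite wdotC wdotZl wdotC. Qed.

Lemma wdotNl p q : wdot (- p) q = - wdot p q.
Proof. by rewrite -scaleN1r wdotZl mulN1r. Qed.

Lemma wdotNr p q : wdot p (- q) = - wdot p q.
Proof. by rewrite wdotC wdotNl wdotC. Qed.

Lemma wdot_ge0 p : 0 <= wdot p p.
Proof.
apply: sumr_ge0 => i _; apply: sumr_ge0 => k _.
by rewrite mulr_ge0 ?(ltW (m0 i)) // -expr2 sqr_ge0.
Qed.

Lemma mnormE p : mnorm m p = Num.sqrt (wdot p p).
Proof.
rewrite /mnorm; congr Num.sqrt; apply: eq_bigr => i _.
rewrite sqr_sqrtr; last by apply: sumr_ge0 => k _; exact: sqr_ge0.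
by rewrite mulr_sumr; apply: eq_bigr => k _; rewrite !mxE expr2.
Qed.

Lemma mnorm_sqr p : mnorm m p ^+ 2 = wdot p p.
Proof. by rewrite mnormE sqr_sqrtr // wdot_ge0. Qed.

Lemma mnorm_ge0 p : 0 <= mnorm m p.
Proof. by rewrite mnormE sqrtr_ge0. Qed.

Lemma mnormZ c p : mnorm m (c *: p) = `|c| * mnorm m p.
Proof. by rewrite !mnormE wdotZl wdotZr mulrA -expr2 sqrtrM ?sqr_ge0 // sqrtr_sqr. Qed.

Lemma mnormN p : mnorm m (- p) = mnorm m p.
Proof. by rewrite -scaleN1r mnormZ normrN1 mul1r. Qed.

Lemma mnorm0 : mnorm m (0 : 'M[R]_(N, d)) = 0.
Proof. by rewrite -(scale0r 0) mnormZ normr0 mul0r. Qed.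

(** Cauchy-Schwarz from [2 <p, q> <= c |p|^2 + |q|^2 / c] with [c = |q| / |p|]. If one of the norms
    vanishes, a suitable large or small [c] contradicts [<p, q> > 0]. *)
Lemma wdot_le p q : wdot p q <= mnorm m p * mnorm m q.
Proof.
have key c : 0 < c -> 2 * wdot p q <= c * mnorm m p ^+ 2 + c^-1 * mnorm m q ^+ 2.
  move=> c0; have := wdot_ge0 (c *: p - q).
  rewrite !(wdotDl, wdotDr, wdotNl, wdotNr, wdotZl, wdotZr) (wdotC q p) -!mnorm_sqr => h.
  rewrite -(ler_pM2l c0) -subr_ge0; apply: le_trans h _.
  rewrite le_eqVlt; apply/orP; left; apply/eqP; field.
  by rewrite gt_eqF.
have [p0|pn0] := eqVneq (mnorm m p) 0.
  rewrite p0 mul0r leNgt; apply/negP => w0.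
  have c0 : 0 < (mnorm m q ^+ 2 + 1) / wdot p q.
    by rewrite divr_gt0 // ltr_wpDl ?sqr_ge0.
  have := key _ c0; rewrite p0 expr0n mulr0 add0r invf_div leNgt => /negP; apply.
  rewrite mulrAC ltr_pdivrMr ?ltr_wpDl ?sqr_ge0 //.
  by have := sqr_ge0 (mnorm m q); nra.
have [q0|qn0] := eqVneq (mnorm m q) 0.
  rewrite q0 mulr0 leNgt; apply/negP => w0.
  have c0 : 0 < wdot p q / (mnorm m p ^+ 2 + 1).
    by rewrite divr_gt0 // ltr_wpDl ?sqr_ge0.
  have := key _ c0; rewrite q0 expr0n mulr0 addr0 leNgt => /negP; apply.
  rewrite mulrAC ltr_pdivrMr ?ltr_wpDl ?sqr_ge0 //.
  by have := sqr_ge0 (mnorm m p); nra.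
have ps : 0 < mnorm m p by rewrite lt_neqAle eq_sym pn0 mnorm_ge0.
have qs : 0 < mnorm m q by rewrite lt_neqAle eq_sym qn0 mnorm_ge0.
have := key _ (divr_gt0 qs ps); rewrite invf_div.
have -> : mnorm m q / mnorm m p * mnorm m p ^+ 2 = mnorm m p * mnorm m q by field.
have -> : mnorm m p / mnorm m q * mnorm m q ^+ 2 = mnorm m p * mnorm m q by field.
by lra.
Qed.

Lemma mnormD p q : mnorm m (p + q) <= mnorm m p + mnorm m q.
Proof.
rewrite -(@ler_pXn2r _ 2) ?nnegrE ?addr_ge0 ?mnorm_ge0 //.
rewrite mnorm_sqr !(wdotDl, wdotDr) (wdotC q p) -!mnorm_sqr.
by have := wdot_le p q; nra.
Qed.

Lemma mnorm_distC p q : mnorm m (p - q) = mnorm m (q - p).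
Proof. by rewrite -mnormN opprB. Qed.

Lemma mnorm_dist_le p q r : mnorm m (p - r) <= mnorm m (p - q) + mnorm m (q - r).
Proof. by have := mnormD (p - q) (q - r); rewrite subrKA. Qed.

(** With its companion below, this links the mass-weighted norm of the estimates to the max norm,
    which carries the topology. *)
Lemma norm_le_mnorm : exists2 c, 0 < c & forall p, `|p| <= c * mnorm m p.
Proof.
pose c := \big[Num.max/1]_i (Num.sqrt (m i))^-1.
have c1 : 1 <= c by exact: bigmax_ge_id.
exists c; first exact: lt_le_trans c1.
move=> p; apply: norm_le_entries.
  by rewrite mulr_ge0 ?mnorm_ge0 // (le_trans ler01).
move=> i k; apply: (@le_trans _ _ ((Num.sqrt (m i))^-1 * mnorm m p)); last first.
  by rewrite ler_wpM2r ?mnorm_ge0 // /c; exact: le_bigmax.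
rewrite mulrC ler_pdivlMr ?sqrtr_gt0 //.
rewrite -(@ler_pXn2r _ 2) ?nnegrE ?mulr_ge0 ?sqrtr_ge0 ?mnorm_ge0 //.
rewrite mnorm_sqr exprMn sqr_sqrtr ?(ltW (m0 i)) // real_normK ?num_real //.
rewrite /wdot (bigD1 i) //= (bigD1 k) //= -expr2 mulrC -addrA lerDl.
apply: addr_ge0; first by apply: sumr_ge0 => l _; rewrite mulr_ge0 ?(ltW (m0 i)) // -expr2 sqr_ge0.
apply: sumr_ge0 => j _; apply: sumr_ge0 => l _.
by rewrite mulr_ge0 ?(ltW (m0 j)) // -expr2 sqr_ge0.
Qed.

Lemma mnorm_le_norm : exists2 c, 0 < c & forall p, mnorm m p <= c * `|p|.
Proof.
pose c := Num.sqrt (\sum_(i < N) \sum_(k < d) m i) + 1.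
have s0 : 0 <= \sum_(i < N) \sum_(k < d) m i.
  by apply: sumr_ge0 => i _; apply: sumr_ge0 => k _; exact: ltW.
exists c; first by rewrite ltr_wpDl ?sqrtr_ge0.
move=> p; apply: (@le_trans _ _ (Num.sqrt (\sum_(i < N) \sum_(k < d) m i) * `|p|)); last first.
  by rewrite ler_wpM2r // lerDl.
rewrite -(@ler_pXn2r _ 2) ?nnegrE ?mulr_ge0 ?sqrtr_ge0 ?mnorm_ge0 //.
rewrite mnorm_sqr exprMn sqr_sqrtr // mulr_suml; apply: ler_sum => i _.
rewrite mulr_suml; apply: ler_sum => k _; rewrite ler_wpM2l ?(ltW (m0 i)) //.
rewrite -expr2 -[leLHS]real_normK ?num_real // ler_pXn2r ?nnegrE //.
exact: entry_le_norm.
Qed.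

End weighted_norm.

(** * Integrals of nonnegative functions *)

Section integral_ae.
Local Open Scope ereal_scope.
Context d (T : measurableType d) (R : realType) (mu : {measure set T -> \bar R}).

Import HBNNSimple.

(** Holds for arbitrary nonnegative integrands because their integral is a supremum over the simple
    functions below them. *)
Lemma ge0_integral_mono (D : set T) (f g : T -> \bar R) :
  (forall x, D x -> 0 <= f x) -> (forall x, D x -> f x <= g x) ->
  \int[mu]_(x in D) f x <= \int[mu]_(x in D) g x.
Proof.
move=> f0 fg.
have g0 x : D x -> 0 <= g x by move=> Dx; exact: le_trans (f0 x Dx) (fg x Dx).
rewrite !ge0_integralE //; apply: ereal_sup_le => _ [h hf <-].
exists h => // x; apply: le_trans (hf x) _; rewrite !patchE.
by case: ifPn => // /set_mem Dx; exact: fg.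
Qed.

(* [f] need not be measurable: the Lebesgue measure of the library lives on the
   Borel sets, and the derivative of a curve is only Borel almost everywhere. *)
Lemma ge0_ae_eq_integral_left (D : set T) (f g : T -> \bar R) :
  measurable D -> measurable_fun D g ->
  (forall x, D x -> 0 <= f x) -> (forall x, D x -> 0 <= g x) ->
  {ae mu, forall x, D x -> f x = g x} ->
  \int[mu]_(x in D) f x = \int[mu]_(x in D) g x.
Proof.
move=> mD mg f0 g0 [N [mN N0 subN]].
have fgN x : D x -> ~ N x -> f x = g x.
  move=> Dx Nx; apply: contrapT => ne; apply: Nx; apply: subN => /= h.
  by apply: ne; exact: h.
apply/eqP; rewrite eq_le; apply/andP; split.
  rewrite (ge0_integralE _ f0); apply: ge_ereal_sup => _ [h /= hf <-].
  rewrite -integralT_nnsfun (ge0_negligible_integral mN) //; last first.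
    by move=> x _; rewrite lee_fin.
    exact/measurable_EFinP.
  rewrite (integral_mkcond D) (integral_mkcond (setT `\` N)).
  apply: ge0_integral_mono => x _; rewrite !patchE.
    by case: ifPn => // _; rewrite lee_fin.
  case: ifPn => [/set_mem [_ Nx]|_]; last first.
    by case: ifPn => // /set_mem; exact: g0.
  have := hf x; rewrite patchE; case: ifPn => // /set_mem Dx.
  by rewrite fgN.
rewrite (ge0_negligible_integral mN) // (integral_mkcond D) (integral_mkcond (D `\` N)).
apply: ge0_integral_mono => x _; rewrite !patchE.
  by case: ifPn => // /set_mem [/g0].
case: ifPn => [/set_mem [Dx Nx]|_]; first by rewrite mem_set // fgN.
by case: ifPn => // /set_mem; exact: f0.
Qed.

End integral_ae.

(** * Absolutely continuous curves of configurations *)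

Section curves.
Variables (R : realType) (N d : nat) (m : 'I_N -> R).
Hypothesis m0 : forall i, 0 < m i.
Notation mu := (@lebesgue_measure R).
Implicit Types (gamma : R -> 'M[R]_(N, d)).

Lemma eq_abs_continuous s t gamma gamma' :
  (forall r, s <= r <= t -> gamma r = gamma' r) ->
  abs_continuous m s t gamma -> abs_continuous m s t gamma'.
Proof.
move=> e h eps /h[r r0 k]; exists r => // n a b ab tr sm.
have <- : \sum_(i < n) mnorm m (gamma (b i) - gamma (a i)) =
    \sum_(i < n) mnorm m (gamma' (b i) - gamma' (a i)); last exact: k.
apply: eq_bigr => i _; have [h1 h2 h3] := ab i.
by rewrite !e // ?h1 ?h3 ?(le_trans h1) // ?(le_trans h2).
Qed.

Lemma abs_continuous_sub s t s' t' gamma : s <= s' -> t' <= t ->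
  abs_continuous m s t gamma -> abs_continuous m s' t' gamma.
Proof.
move=> ss tt h eps /h[r r0 k]; exists r => // n a b ab; apply: k => i.
by have [h1 h2 h3] := ab i; split => //; [exact: le_trans h1|exact: le_trans tt].
Qed.

(** Every interval is cut at [p]: its parts have the end points [min _ p] and [max _ p], and an
    interval on one side of [p] leaves a degenerate part on the other. *)
Lemma abs_continuous_cat s p t gamma : s <= p -> p <= t ->
  abs_continuous m s p gamma -> abs_continuous m p t gamma ->
  abs_continuous m s t gamma.
Proof.
move=> sp pt h1 h2 eps eps0.
have [d1 d10 k1] := h1 _ (divr_gt0 eps0 (ltr0Sn _ 1)).
have [d2 d20 k2] := h2 _ (divr_gt0 eps0 (ltr0Sn _ 1)).
exists (Num.min d1 d2); first by rewrite lt_min d10.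
move=> n a b ab tr; rewrite lt_min => /andP[l1 l2].
have split_sum : \sum_(k < n) mnorm m (gamma (b k) - gamma (a k)) <=
   \sum_(k < n) mnorm m (gamma (Num.min (b k) p) - gamma (Num.min (a k) p)) +
   \sum_(k < n) mnorm m (gamma (Num.max (b k) p) - gamma (Num.max (a k) p)).
  rewrite -big_split; apply: ler_sum => k _ /=; have [ak abk bk] := ab k.
  have [bp|pb] := leP (b k) p.
    by rewrite !(min_l (le_trans abk bp)) ?(max_r (le_trans abk bp)) subrr mnorm0 addr0.
  have [ap|pa] := leP (a k) p; last by rewrite subrr mnorm0 add0r.
  by rewrite addrC; exact: mnorm_dist_le.
have minmax u v : u <= v -> 0 <= Num.min v p - Num.min u p <= v - u /\
    0 <= Num.max v p - Num.max u p <= v - u.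
  move=> uv; have [h|h] := leP v p; have [h'|h'] := leP u p; split; lra.
apply: le_lt_trans split_sum _; rewrite (splitr eps); apply: ltrD.
- apply: k1.
  + move=> k; have [ak abk bk] := ab k; split; last by rewrite ge_min lexx orbT.
      by rewrite le_min ak sp.
    by have [/andP[+ _] _] := minmax _ _ abk; rewrite subr_ge0.
  + apply/trivIsetP => i j _ _ ij; move/trivIsetP : tr => /(_ i j I I ij).
    rewrite -!subset0 => h x [/= hi hj]; apply: (h x).
    by move: hi hj; rewrite /= !in_itv /= !gt_min !lt_min => /andP[h3 /andP[h4 h5]] /andP[h6 /andP[h7 h8]];
      move: h3 h6; rewrite !(ltNge p) (ltW h5) /= !orbF => -> ->; rewrite h4 h7.
  + apply: le_lt_trans l1; apply: ler_sum => k _; have [_ abk _] := ab k.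
    by have [/andP[_ +] _] := minmax _ _ abk.
- apply: k2.
  + move=> k; have [ak abk bk] := ab k; split; first by rewrite le_max lexx orbT.
      by have [_ /andP[+ _]] := minmax _ _ abk; rewrite subr_ge0.
    by rewrite ge_max bk pt.
  + apply/trivIsetP => i j _ _ ij; move/trivIsetP : tr => /(_ i j I I ij).
    rewrite -!subset0 => h x [/= hi hj]; apply: (h x).
    by move: hi hj; rewrite /= !in_itv /= !gt_max !lt_max => /andP[/andP[h3 h4] h5] /andP[/andP[h6 h7] h8];
      move: h5 h8; rewrite !(ltNge x p) (ltW h4) /= !orbF => -> ->; rewrite h3 h6.
  + apply: le_lt_trans l2; apply: ler_sum => k _; have [_ abk _] := ab k.
    by have [_ /andP[_ +]] := minmax _ _ abk.
Qed.

Lemma abs_continuous_lipschitz s t gamma L :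
  (forall p q, s <= p -> p <= q -> q <= t ->
     mnorm m (gamma q - gamma p) <= L * (q - p)) ->
  abs_continuous m s t gamma.
Proof.
move=> h eps eps0; have L1 : 0 < `|L| + 1 by rewrite ltr_wpDl.
exists (eps / (`|L| + 1)); first by rewrite divr_gt0.
move=> n a b ab _; rewrite ltr_pdivlMr // mulrC => l.
apply: le_lt_trans l; rewrite mulr_sumr; apply: ler_sum => k _.
have [ak abk bk] := ab k; apply: le_trans (h _ _ ak abk bk) _.
by rewrite ler_wpM2r ?subr_ge0 // (le_trans (ler_norm L)) // lerDl.
Qed.

(** Weighted arithmetic-geometric mean: [D <= eta / 2 * (D^2 / T) + T / (2 eta)]. The weight [eta]
    makes the energy term at most [eps / 2], and the length bound [eps * eta] controls the other.
    The criterion involves only values of the curve, so it survives pointwise limits. *)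
Lemma abs_continuous_energy s t gamma E :
  (forall n (a b : 'I_n -> R), (forall k, [/\ s <= a k, a k <= b k & b k <= t]) ->
    trivIset setT (fun k => `]a k, b k[%classic) ->
    \sum_(k < n) mnorm m (gamma (b k) - gamma (a k)) ^+ 2 / (b k - a k) <= E) ->
  abs_continuous m s t gamma.
Proof.
move=> h eps eps0; have E1 : 0 < `|E| + 1 by rewrite ltr_wpDl.
pose eta := eps / (`|E| + 1); have eta0 : 0 < eta by rewrite divr_gt0.
exists (eps * eta); first by rewrite mulr_gt0.
move=> n a b ab tr l.
have amgm k : mnorm m (gamma (b k) - gamma (a k)) <=
    eta / 2 * (mnorm m (gamma (b k) - gamma (a k)) ^+ 2 / (b k - a k)) +
    (b k - a k) / (2 * eta).
  have [_ + _] := ab k; rewrite le_eqVlt => /orP[/eqP ->|lt].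
    by rewrite !subrr mnorm0 // mul0r invr0 !mulr0 addr0.
  set D := mnorm m _; set T := b k - a k; have T0 : 0 < T by rewrite subr_gt0.
  have -> : eta / 2 * (D ^+ 2 / T) + T / (2 * eta) = D + (eta * D - T) ^+ 2 / (2 * eta * T).
    by field; rewrite !gt_eqF.
  by rewrite lerDl divr_ge0 ?sqr_ge0 // !mulr_ge0 // ltW.
apply: le_lt_trans (ler_sum _ (fun k _ => amgm k)) _.
rewrite big_split /= -mulr_sumr -mulr_suml (splitr eps); apply: ler_ltD.
  rewrite mulrAC ler_pdivrMr // mulfVK //.
  apply: (@le_trans _ _ (eta * (`|E| + 1))); last by rewrite /eta mulfVK // gt_eqF.
  rewrite ler_pM2l // (le_trans (h n a b ab tr)) // (le_trans (ler_norm E)) //.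
  by rewrite lerDl.
rewrite ltr_pdivrMr ?mulr_gt0 //; apply: lt_le_trans l _.
by have -> : eps / 2 * (2 * eta) = eps * eta by field.
Qed.

Lemma abs_continuous_real_AC s t gamma i k : abs_continuous m s t gamma ->
  real_AC s t (fun r => gamma r i k).
Proof.
move=> h e e0; have [c c0 hc] := @norm_le_mnorm _ N d m m0.
have [r r0 H] := h _ (divr_gt0 e0 c0); exists r => // I p q pq sep l.
pose a (j : 'I_#|I|) := p (enum_val j); pose b (j : 'I_#|I|) := q (enum_val j).
have rei (F : I -> R) : \sum_i F i = \sum_(j < #|I|) F (enum_val j).
  by rewrite (reindex (@enum_val I predT)) //; exact: onW_bij (@enum_val_bij I).
have H1 : \sum_(j < #|I|) mnorm m (gamma (b j) - gamma (a j)) < e / c.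
  apply: H => [j||]; [exact: pq| |by rewrite /a /b -(rei (fun i => q i - p i))].
  apply/trivIsetP => j1 j2 _ _ j12; rewrite -subset0 => x /= [].
  rewrite !in_itv /= => /andP[x1 x2] /andP[x3 x4].
  have ne : enum_val j1 <> enum_val j2 by move=> /enum_val_inj e12; rewrite e12 eqxx in j12.
  case: (sep _ _ ne) => hle.
    by have := lt_trans x3 (lt_le_trans x2 hle); rewrite ltxx.
  by have := lt_trans x1 (lt_le_trans x4 hle); rewrite ltxx.
rewrite rei; move: H1; rewrite ltr_pdivlMr // mulr_suml; apply: le_lt_trans.
apply: ler_sum => j _; rewrite mulrC; apply: le_trans (hc _).
by have := entry_le_norm (gamma (b j) - gamma (a j)) i k; rewrite !mxE.
Qed.

Lemma derive1_entries gamma (x : R) (v : 'M[R]_(N, d)) :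
  (forall i k, is_derive x 1 (fun y => gamma y i k) (v i k)) -> derive1 gamma x = v.
Proof.
move=> h; rewrite derive1E derive_mx; last by apply/derivable_mxP => i k; have [] := h i k.
by apply/matrixP => i k; rewrite !mxE; have hd := h i k; rewrite (@derive_val _ _ _ _ _ _ _ hd).
Qed.

Lemma abs_continuous_density s t gamma : s < t -> abs_continuous m s t gamma ->
  exists rho : R -> 'M[R]_(N, d),
  [/\ forall i k, mu.-integrable setT (fun x => (rho x i k)%:E),
      forall p q i k, s <= p -> p <= q -> q <= t ->
        (\int[mu]_(x in `[p, q]) (rho x i k)%:E = (gamma q i k - gamma p i k)%:E)%E &
      {ae mu, forall x, s < x < t -> forall i k,
         is_derive x 1 (fun y => gamma y i k) (rho x i k)}].
Proof.
move=> st h.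
have /choice[r hr] : forall ik : 'I_N * 'I_d, exists rho : R -> R,
    mu.-integrable setT (EFin \o rho) /\ forall p q, s <= p -> p <= q -> q <= t ->
    (\int[mu]_(x in `[p, q]) (rho x)%:E = (gamma q ik.1 ik.2 - gamma p ik.1 ik.2)%:E)%E.
  by move=> [i k]; apply: (real_AC_density st); exact: abs_continuous_real_AC.
exists (fun x => \matrix_(i, k) r (i, k) x); split.
- move=> i k; have [+ _] := hr (i, k); apply: eq_integrable => // x _.
  by rewrite mxE.
- move=> p q i k sp pq qt; have [_ <-] := hr (i, k) => //.
  by apply: eq_integral => x _; rewrite mxE.
- have ae ik : {ae mu, forall x, s < x < t ->
      is_derive x 1 (fun y => gamma y ik.1 ik.2) (r ik x)}.
    by have [h1 h2] := hr ik; exact: density_ae_derive h1 h2.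
  have : {ae mu, forall x, forall ik, s < x < t ->
      is_derive x 1 (fun y => gamma y ik.1 ik.2) (r ik x)}.
    by apply: filter_forall.
  apply: filterS; first exact: (ae_filter_ringOfSetsType mu).
  by move=> x hx sxt i k; rewrite mxE; exact: (hx (i, k) sxt).
Qed.

End curves.

(** * The potential on configurations *)

Section lower_semicontinuity.
Local Open Scope ereal_scope.
Context {R : realType}.

Lemma between_ereal (x y : \bar R) : -oo < y -> x < y -> exists2 a : R, x <= a%:E & a%:E < y.
Proof.
case: x y => [x| |] [y| |] // _ xy.
- by exists x.
- by exists x; rewrite ?ltry.
- by exists (y - 1)%R; rewrite ?leNye // lte_fin ltrBlDr ltrDl.
- by exists 0%R; rewrite ?leNye ?ltry.
Qed.

Lemma lower_semicontinuous_comp (X Y : topologicalType) (f : Y -> \bar R) (g : X -> Y) :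
  continuous g -> lower_semicontinuous f -> lower_semicontinuous (f \o g).
Proof.
move=> cg lf x a afx; have [V nV hV] := lf _ _ afx.
by exists (g @^-1` V); [exact: cg|move=> y /hV].
Qed.

(** A level [a] below [f x + g x] is split as [(a - c) + c] with [c] below [g x] and [a - c] below
    [f x]. The splitting subtracts [f x], so an infinite value is treated apart. *)
Lemma lower_semicontinuousD (X : topologicalType) (f g : X -> \bar R) :
  (forall x, 0 <= f x) -> (forall x, 0 <= g x) ->
  lower_semicontinuous f -> lower_semicontinuous g ->
  lower_semicontinuous (fun x => f x + g x).
Proof.
move=> f0 g0 lf lg x a.
have [fg|] := eqVneq (f x) +oo; last rewrite -ltey => ffin.
  move=> _; have [|V nV hV] := lf x a; first by rewrite fg ltry.
  by exists V => // y /hV h; rewrite (lt_le_trans h) // leeDl.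
have ff : f x \is a fin_num by rewrite ge0_fin_numE.
rewrite -lteBlDl // => h.
have ngx : -oo < g x by apply: lt_le_trans (g0 x).
have [b ab bg] := between_ereal ngx h.
have lt1 : (a - b)%:E <= f x by rewrite EFinB leeBlDr // -leeBlDl.
have [c bc cg] : exists2 c : R, b%:E < c%:E & c%:E < g x.
  move: bg; case: (g x) => [r| |] // bg; last by exists (b + 1)%R; rewrite ?ltry // lte_fin ltrDl.
  by have [h1 h2] := midf_lt bg; exists ((b + r) / 2)%R; rewrite lte_fin.
have [|V1 n1 h1] := lf x (a - c)%R.
  by apply: lt_le_trans lt1; rewrite lte_fin ltrD2l ltrN2 -lte_fin.
have [V2 n2 h2] := lg x c cg.
exists (V1 `&` V2); first exact: filterI.
move=> y [/h1 k1 /h2 k2].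
by have := lteD k1 k2; rewrite -EFinD subrK.
Qed.

Lemma lower_semicontinuous_sum (X : topologicalType) (I : Type) (r : seq I)
    (P : pred I) (F : I -> X -> \bar R) :
  (forall i x, P i -> 0 <= F i x) -> (forall i, P i -> lower_semicontinuous (F i)) ->
  lower_semicontinuous (fun x => \sum_(i <- r | P i) F i x).
Proof.
move=> F0 lF; elim: r => [|i r ih].
  move=> x a; rewrite big_nil => h; exists setT; first exact: filterT.
  by move=> y _; rewrite big_nil.
move=> x a; rewrite big_cons; case: ifPn => Pi h.
  have s0 y : 0 <= \sum_(j <- r | P j) F j y by apply: sume_ge0 => j; exact: F0.
  have [V nV hV] := lower_semicontinuousD (fun y => F0 i y Pi) s0 (lF i Pi) ih h.
  by exists V => // y Vy; rewrite big_cons Pi; exact: hV.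
have [V nV hV] := ih _ _ h.
by exists V => // y Vy; rewrite big_cons (negbTE Pi); exact: hV.
Qed.

Lemma lower_semicontinuous_liminf (X : topologicalType) (f : X -> \bar R)
    (u : nat -> X) (l : X) : lower_semicontinuous f -> 0 <= f l ->
  u @ \oo --> l -> f l <= limn_einf (f \o u).
Proof.
move=> lf fl0 ul; rewrite leNgt; apply/negP => h.
have [a ha afl] := between_ereal (lt_le_trans (ltNyr 0) fl0) h.
have [c ac cfl] : exists2 c : R, a%:E < c%:E & c%:E < f l.
  move: afl; case: (f l) => [r| |] // bg; last by exists (a + 1)%R; rewrite ?ltry // lte_fin ltrDl.
  by have [h1 h2] := midf_lt bg; exists ((a + r) / 2)%R; rewrite lte_fin.
have [V nV hV] := lf _ _ cfl.
suff : c%:E <= limn_einf (f \o u).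
  by move=> /(lt_le_trans ac) /lt_le_trans /(_ ha); rewrite ltxx.
rewrite limn_einf_lim; apply: lime_ge; first exact: is_cvg_einfs.
have /ul [n _ hn] := nV.
exists n => // k /= nk; apply: le_ereal_inf_tmp => _ [j /= kj <-].
by apply/ltW/hV/hn => /=; exact: leq_trans kj.
Qed.

End lower_semicontinuity.

Section pair_potential.
Variables (R : realType) (d : nat).
Implicit Types (g : 'rV[R]_d * 'rV[R]_d -> R) (p : 'rV[R]_d * 'rV[R]_d).

Lemma offdiag_open : open (@offdiag R d).
Proof.
rewrite openE => p /= hp; rewrite /interior; apply/nbhs_ballP.
have r0 : 0 < `|p.1 - p.2| by rewrite normr_gt0 subr_eq0; apply/eqP.
exists (`|p.1 - p.2| / 2); first by rewrite /= divr_gt0.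
move=> q [/= h1 h2] q12; move: h1 h2; rewrite -!ball_normE /= q12 => h1 h2.
have := ltrD h1 h2; rewrite -splitr distrC -[_ + `|_ - q.2|]addrC distrC.
apply/negP; rewrite -leNgt.
have -> : p.1 - p.2 = (p.1 - q.2) + (q.2 - p.2) by rewrite subrKA.
rewrite addrC; apply: le_trans (ler_normD _ _) _.
by rewrite (distrC q.2) // lexx.
Qed.

Lemma extend_pair_off g p : offdiag p -> extend_pair g p = (g p)%:E.
Proof. by rewrite /extend_pair; case: eqP. Qed.

Lemma extend_pair_ge0 g p : (forall q, offdiag q -> 0 <= g q) -> (0 <= extend_pair g p)%E.
Proof.
move=> g0; rewrite /extend_pair; case: eqP => [e|ne]; last by rewrite lee_fin; exact: g0.
rewrite limf_einfE; apply: le_ereal_sup_tmp.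
exists (ereal_inf [set ((EFin \o g) x) | x in offdiag]).
  by exists offdiag => //; exact: withinT.
by apply: le_ereal_inf_tmp => _ [q hq <-] /=; rewrite lee_fin; exact: g0.
Qed.

(** At a diagonal point a level below the lower limit is witnessed by a punctured neighbourhood [V]
    on which the infimum of [g] exceeds it. The points of which [V] is still a neighbourhood off the
    diagonal form a neighbourhood, and there the same infimum bounds both the values of [g] and the
    lower limits. *)
Lemma extend_pair_lsc g :
  lower_semicontinuous ((fun p => (g p)%:E) : subspace (@offdiag R d) -> \bar R) ->
  lower_semicontinuous (extend_pair g).
Proof.
move=> lg p a; have [off|diag] := pselect (offdiag p).
  rewrite extend_pair_off // => h; have [V nV hV] := lg p a h.
  have {}nV : within offdiag (nbhs p) V by rewrite nbhs_subspace_in.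
  have no : nbhs p offdiag by apply: open_nbhs_nbhs; split => //; exact: offdiag_open.
  exists (fun q => offdiag q /\ V q).
    by move: no nV; apply: filterS2 => q h1 h2; split; [exact: h1|exact: h2].
  by move=> q [hq /hV]; rewrite extend_pair_off.
have pp : p.1 == p.2 by apply/eqP; exact: contrapT.
rewrite {1}/extend_pair pp limf_einfE => /ereal_sup_gt [_ [V nV <-] aV].
exists [set q | nbhs q (fun r => offdiag r -> V r)]; first exact: nbhs_interior.
move=> q nq; rewrite /extend_pair; case: eqP => [e|ne].
  apply: lt_le_trans aV _; rewrite limf_einfE; apply: ereal_sup_ubound.
  by exists V.
apply: lt_le_trans aV _; apply: ereal_inf_lbound; exists q => //.
exact: (nbhs_singleton nq).
Qed.

End pair_potential.

Section potential.
Variables (R : realType) (N d : nat) (Fp : pair_potentials R N d).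
Hypothesis hF : condF Fp.
Implicit Types (x y : 'M[R]_(N, d)).

Definition pair_rows (i j : 'I_N) x := (row i x, row j x).

Let pair_rows_dist i j x y : `|pair_rows i j x - pair_rows i j y| <= `|x - y|.
Proof.
rewrite prod_normE /= ge_max; apply/andP; split; apply: norm_le_entries => // k l;
  rewrite !mxE; have := entry_le_norm (x - y); by move=> /(_ _ l); rewrite ?mxE => h;
  (apply: le_trans (h _); rewrite !mxE).
Qed.

Lemma pair_rows_continuous i j : continuous (pair_rows i j).
Proof.
move=> x A /nbhs_ballP[e e0 eA]; apply/nbhs_ballP; exists e => // y.
rewrite -ball_normE => h; apply: eA; rewrite -ball_normE.
exact: le_lt_trans (pair_rows_dist i j x y) h.
Qed.

Lemma potential_ge0 x : (0 <= potential Fp x)%E.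
Proof.
apply: sume_ge0 => i _; apply: sume_ge0 => j ij.
by apply: extend_pair_ge0; have [] := hF ij.
Qed.

Lemma potential_lsc : lower_semicontinuous (potential Fp).
Proof.
apply: lower_semicontinuous_sum => i.
  move=> x _; apply: sume_ge0 => j ij.
  by apply: extend_pair_ge0; have [] := hF ij.
move=> _; apply: lower_semicontinuous_sum => j.
  by move=> x ij; apply: extend_pair_ge0; have [] := hF ij.
move=> ij; apply: (@lower_semicontinuous_comp _ _ _ (extend_pair (Fp i j)) (pair_rows i j)).
  exact: pair_rows_continuous.
by apply: extend_pair_lsc; have [] := hF ij.
Qed.

Lemma Omega_offdiag x (i j : 'I_N) : Omega x -> (i < j)%N -> offdiag (row i x, row j x).
Proof. by move=> h ij; exact: h. Qed.

Lemma potentialE x : Omega x ->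
  potential Fp x = (\sum_(i < N) \sum_(j < N | (i < j)%N) Fp i j (row i x, row j x))%:E.
Proof.
move=> ox; rewrite /potential -sumEFin; apply: eq_bigr => i _.
rewrite -sumEFin; apply: eq_bigr => j ij.
by rewrite extend_pair_off //; exact: Omega_offdiag.
Qed.

Lemma potential_near x : Omega x ->
  exists M : R, nbhs x [set y | Omega y /\ (potential Fp y <= M%:E)%E].
Proof.
move=> ox; have FF : Filter (nbhs x) by exact: nbhs_filter.
have /choice[M hM] : forall ij : 'I_N * 'I_N, exists M : R, (ij.1 < ij.2)%N ->
    nbhs x [set y | offdiag (pair_rows ij.1 ij.2 y) /\ Fp ij.1 ij.2 (pair_rows ij.1 ij.2 y) <= M].
  move=> [i j] /=; have [ij|] := boolP (i < j)%N; last by exists 0.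
  have [_ lb _] := hF ij; have := lb _ (Omega_offdiag ox ij).
  rewrite /bounded_near => /pinfty_ex_gt0[M M0 hM]; exists M => _.
  have no : nbhs (pair_rows i j x) offdiag.
    by apply: open_nbhs_nbhs; split; [exact: offdiag_open|exact: Omega_offdiag].
  have nO : nbhs (pair_rows i j x) [set q | offdiag q /\ Fp i j q <= M].
    move: no hM; apply: filterS2 => q hq /(_ hq) h; split => //.
    exact: le_trans (ler_norm _) h.
  exact: (@pair_rows_continuous i j x _ nO).
exists (\sum_(i < N) \sum_(j < N | (i < j)%N) M (i, j)).
pose P (ij : 'I_N * 'I_N) y := (ij.1 < ij.2)%N ->
  offdiag (pair_rows ij.1 ij.2 y) /\ Fp ij.1 ij.2 (pair_rows ij.1 ij.2 y) <= M ij.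
have H : nbhs x [set y | forall ij, P ij y].
  apply: (@filter_forall _ _ P (nbhs x) FF) => ij.
  have [h|h] := boolP (ij.1 < ij.2)%N; first by apply: filterS (hM ij h) => y hy _.
  by apply: filterS (@filterT _ _ FF) => y _; rewrite /P (negbTE h).
apply: filterS H => y H.
have oy : Omega y by move=> i j ij; have [h _] := H (i, j) ij; exact: h.
split => //; rewrite potentialE // lee_fin; apply: ler_sum => i _.
by apply: ler_sum => j ij; have [_] := H (i, j) ij.
Qed.

Lemma potential_compact (K : set 'M[R]_(N, d)) : compact K -> K `<=` Omega ->
  exists2 M : R, 0 <= M & forall y, K y -> (potential Fp y <= M%:E)%E.
Proof.
move=> /compact_near_coveringP cK KO.
(* The bound itself is the parameter of the covering property, along the filter at infinity: bounds
   near each point yield a common one. *)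
have := cK R +oo (fun M y => (potential Fp y <= M%:E)%E).
case.
  move=> x Kx; have [M hM] := potential_near (KO x Kx).
  near=> y M'.
  apply: (@le_trans _ _ M%:E).
    by have [] : Omega y /\ (potential Fp y <= M%:E)%E by near: y; exact: hM.
  by rewrite lee_fin /=; near: M'; apply: nbhs_pinfty_ge; exact: num_real.
move=> M [_ hM]; exists (Num.max 0 (M + 1)); first by rewrite le_max lexx.
move=> y Ky; apply: (@le_trans _ _ (M + 1)%:E); last by rewrite lee_fin le_max lexx orbT.
by apply: hM => //; rewrite ltrDl.
Unshelve. all: by end_near. Qed.

Lemma potential_curve_measurable (s t : R) (gamma : R -> 'M[R]_(N, d)) : s <= t ->
  continuous (gamma \o clip s t) ->
  measurable_fun `[s, t] (fun r => potential Fp (gamma r)).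
Proof.
move=> st cg.
have : measurable_fun setT (potential Fp \o (gamma \o clip s t)).
  apply: lower_semicontinuous_measurable.
  by apply: lower_semicontinuous_comp => //; exact: potential_lsc.
move=> /(measurable_funS measurableT (@subsetT _ `[s, t]%classic)).
apply: eq_measurable_fun => r; rewrite inE /= in_itv /= => rst.
by rewrite clip_id.
Qed.

End potential.

Lemma is_derive_affine (R : realType) (a b r : R) :
  is_derive r 1 (fun y : R => a + y * b) b.
Proof.
have -> : (fun y : R => a + y * b) = cst a + b \*: id.
  by apply/funext => y; rewrite /= mulrC.
by apply: is_derive_eq; rewrite add0r /GRing.scale /= mulr1.
Qed.


(** * Action and Mane's potential *)

Section interval_integrals.
Local Open Scope ereal_scope.
Context {R : realType}.
Notation mu := (@lebesgue_measure R).
Implicit Types (f : R -> \bar R) (s t p q : R).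

Lemma lebesgue_itvcc s t : (s <= t)%R -> mu `[s, t]%classic = (t - s)%:E.
Proof.
move=> st; rewrite lebesgue_measure_itv /= lte_fin; move: st.
by rewrite le_eqVlt => /orP[/eqP ->|->]; rewrite ?ltxx ?subrr.
Qed.

Lemma lebesgue_ae_sub (P Q : R -> Prop) : (forall x, P x -> Q x) ->
  {ae mu, forall x, P x} -> {ae mu, forall x, Q x}.
Proof.
move=> PQ [M [mM M0 sub]]; exists M; split => // x /= nQ.
by apply: sub => /= /PQ.
Qed.

Lemma lebesgue_ae_and (P Q : R -> Prop) :
  {ae mu, forall x, P x} -> {ae mu, forall x, Q x} -> {ae mu, forall x, P x /\ Q x}.
Proof. by have F := ae_filter_ringOfSetsType mu; move=> hP hQ; exact: filterI hP hQ. Qed.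

Lemma ae_neq s : {ae mu, forall x, x != s}.
Proof.
exists [set s]; split => //; first exact: lebesgue_measure_set1.
by move=> x /= /negP; rewrite negbK => /eqP.
Qed.

Lemma ae_itvcc s t p q (P : R -> Prop) : (s <= p)%R -> (q <= t)%R ->
  {ae mu, forall x, (s < x < t)%R -> P x} ->
  {ae mu, forall x, `[p, q]%classic x -> P x}.
Proof.
move=> sp qt h; apply: lebesgue_ae_sub (lebesgue_ae_and h (lebesgue_ae_and (ae_neq s) (ae_neq t))).
move=> x [hx [xs xt]] /=; rewrite in_itv /= => /andP[px xq].
apply: hx; rewrite !lt_neqAle eq_sym xs xt /=.
by rewrite (le_trans sp px) (le_trans xq qt).
Qed.

Lemma ge0_integral_point s f : (forall x, 0 <= f x) -> \int[mu]_(x in `[s, s]) f x = 0.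
Proof.
move=> f0; rewrite (@ge0_ae_eq_integral_left _ _ _ mu _ _ (cst 0)) ?integral0 //.
apply: lebesgue_ae_sub (ae_neq s) => x xs /=; rewrite in_itv /= -eq_le eq_sym.
by rewrite (negbTE xs).
Qed.

Lemma ge0_integral_itv_cat s p t f : (s <= p)%R -> (p <= t)%R ->
  measurable_fun `[s, t] f -> (forall x, 0 <= f x) ->
  \int[mu]_(x in `[s, t]) f x = \int[mu]_(x in `[s, p]) f x + \int[mu]_(x in `[p, t]) f x.
Proof.
move=> sp pt mf f0.
have E : (`[s, t] = `[s, p] `|` `]p, t])%classic.
  by rewrite -itv_bndbnd_setU // bnd_simp.
rewrite {1}E ge0_integral_setU //; last 2 first.
- by rewrite -E.
- apply/disj_setPS => x [/=]; rewrite !in_itv /= => /andP[_ xp] /andP[px _].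
  by move: px; rewrite ltNge xp.
congr (_ + _); apply: integral_itv_obnd_cbnd.
apply: measurable_funS mf => // x /=; rewrite !in_itv /= => /andP[px ->].
by rewrite (le_trans sp (ltW px)).
Qed.

Lemma integral_itv_cst s t (c : R) : (s <= t)%R ->
  \int[mu]_(x in `[s, t]) c%:E = (c * (t - s))%:E.
Proof.
move=> st; rewrite EFinM -(lebesgue_itvcc st).
exact: (integral_cst mu (measurable_itv _) c%:E).
Qed.

End interval_integrals.

(** * Lebesgue measure under translations and reflections *)

Section isometries_of_the_line.
Context {R : realType}.
Notation mu := (@lebesgue_measure R).

(** Time shifts ([b = false]) and time reversals ([b = true]) are treated together: concatenating
    curves uses the former, exchanging their end points the latter. *)
Definition line_isometry (b : bool) (c x : R) : R := (-1) ^+ b * x + c.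

Lemma line_isometry_measurable b c : measurable_fun setT (line_isometry b c).
Proof.
apply: measurable_funD => //; apply: measurable_funM => //.
Qed.

(** Uniqueness of Lebesgue measure reduces the claim to intervals; a reflection exchanges their open
    and closed ends. *)
Lemma lebesgue_line_isometry b c (X : set R) : measurable X ->
  pushforward mu (line_isometry b c : _ -> measurableTypeR R) X = mu X.
Proof.
move=> mX; apply/esym/lebesgue_measure_unique => //=; try exact: line_isometry_measurable.
move=> + _ [[u v] _ <-] => _.
rewrite /pushforward /=.
have -> : line_isometry b c @^-1` `]u, v]%classic =
    if b then `[c - v, c - u[%classic else `]u - c, v - c]%classic.
  rewrite /line_isometry; case: b; apply/seteqP; split => x /=;
   rewrite !in_itv /= ?expr1 ?expr0 ?mul1r ?mulN1r => /andP[h1 h2]; apply/andP; split; lra.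
case: b; rewrite !lebesgue_measure_itv /= !lte_fin.
  by rewrite ltrD2l ltrN2; case: ifPn => // _; rewrite -!EFinB; congr EFin; ring.
by rewrite ltrD2r; case: ifPn => // _; rewrite -!EFinB; congr EFin; ring.
Qed.

Lemma ae_line_isometry b c (P : R -> Prop) : {ae mu, forall x, P x} ->
  {ae mu, forall x, P (line_isometry b c x)}.
Proof.
move=> [M [mM M0 sub]]; exists (line_isometry b c @^-1` M); split.
- rewrite -[_ @^-1` _]setTI; exact: (@line_isometry_measurable b c).
- by rewrite -M0; exact: lebesgue_line_isometry.
- by move=> x /= h; apply: sub.
Qed.

Lemma ge0_integral_line_isometry b c (D : set R) (f : R -> \bar R) :
  measurable D -> measurable_fun D f -> (forall x, (0 <= f x)%E) ->
  (\int[mu]_(x in line_isometry b c @^-1` D) f (line_isometry b c x) =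
   \int[mu]_(x in D) f x)%E.
Proof.
move=> mD mf f0.
transitivity (\int[pushforward mu (line_isometry b c : _ -> measurableTypeR R)]_(y in D) f y)%E.
  apply/esym/ge0_integral_pushforward => //; exact: line_isometry_measurable.
by apply: eq_measure_integral => //; [exact: line_isometry_measurable|
  move=> mphi X mX _; exact: lebesgue_line_isometry].
Qed.

End isometries_of_the_line.

(** * Kinetic energy *)

Section action_of_curves.
Variables (R : realType) (N d : nat) (m : 'I_N -> R).
Hypothesis m0 : forall i, 0 < m i.
Notation mu := (@lebesgue_measure R).
Implicit Types (gamma : R -> 'M[R]_(N, d)).

Lemma abs_continuous_unif s t gamma : abs_continuous m s t gamma ->
  forall e : R, 0 < e -> exists2 r : R, 0 < r & forall p q,
    s <= p -> p <= q -> q <= t -> q - p < r -> mnorm m (gamma q - gamma p) < e.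
Proof.
move=> h e /h[r r0 k]; exists r => // p q sp pq qt qpr.
have := k 1%N (fun=> p) (fun=> q); rewrite !big_ord1; apply => //.
by move=> i j _ _ _; rewrite (ord1 i) (ord1 j).
Qed.

Lemma abs_continuous_clip s t gamma : s <= t -> abs_continuous m s t gamma ->
  continuous (gamma \o clip s t).
Proof.
move=> st h x A /nbhs_ballP[e e0 eA].
have [c c0 hc] := @norm_le_mnorm R N d m m0.
have [r r0 hr] := abs_continuous_unif h (divr_gt0 e0 c0).
apply/nbhs_ballP; exists r => // y; rewrite /ball /= => xy.
apply: eA; rewrite -ball_normE /=; apply: le_lt_trans (hc _) _.
rewrite mulrC -ltr_pdivlMr //.
have xyr : `|clip s t x - clip s t y| < r by apply: le_lt_trans (clip_dist _ _ st) xy.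
have /andP[x1 x2] := clip_itv x st; have /andP[y1 y2] := clip_itv y st.
have [le|/ltW le] := leP (clip s t y) (clip s t x).
  by apply: hr => //; move: xyr; rewrite ger0_norm ?subr_ge0.
rewrite mnorm_distC //; apply: hr => //.
by move: xyr; rewrite distrC ger0_norm ?subr_ge0.
Qed.

Definition kin gamma s t : \bar R :=
  (\int[mu]_(r in `[s, t]) (2^-1 * mnorm m (derive1 gamma r) ^+ 2)%:E)%E.

Lemma kin_ge0 gamma s t : (0 <= kin gamma s t)%E.
Proof. by apply: integral_ge0 => x _; rewrite lee_fin mulr_ge0 ?sqr_ge0. Qed.

Lemma measurable_mnorm_sqr (D : set R) (rho : R -> 'M[R]_(N, d)) :
  (forall i k, measurable_fun D (fun x => rho x i k)) ->
  measurable_fun D (fun x => 2^-1 * mnorm m (rho x) ^+ 2).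
Proof.
move=> h; apply: measurable_funM => //.
have -> : (fun x => mnorm m (rho x) ^+ 2) = (fun x => wdot m (rho x) (rho x)).
  by apply/funext => x; rewrite mnorm_sqr.
rewrite /wdot; apply: measurable_sum => i; apply: measurable_sum => k.
by apply: measurable_funM => //; apply: measurable_funM.
Qed.

(** [derive1 gamma] is controlled only almost everywhere. Computations with the kinetic energy go
    through the Borel density [rho], one density serving for all subintervals. *)
Lemma kin_density s t gamma : s < t -> abs_continuous m s t gamma ->
  exists rho : R -> 'M[R]_(N, d),
  [/\ forall i k, mu.-integrable setT (fun x => (rho x i k)%:E),
      forall p q i k, s <= p -> p <= q -> q <= t ->
        (\int[mu]_(x in `[p, q]) (rho x i k)%:E = (gamma q i k - gamma p i k)%:E)%E,
      {ae mu, forall x, s < x < t -> forall i k,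
         is_derive x 1 (fun y => gamma y i k) (rho x i k)},
      measurable_fun setT (fun x => (2^-1 * mnorm m (rho x) ^+ 2)%:E) &
      forall p q, s <= p -> q <= t ->
        kin gamma p q = (\int[mu]_(r in `[p, q]) (2^-1 * mnorm m (rho r) ^+ 2)%:E)%E].
Proof.
move=> st h; have [rho [h1 h2 h3]] := abs_continuous_density m0 st h.
have mrho : measurable_fun setT (fun x => (2^-1 * mnorm m (rho x) ^+ 2)%:E).
  apply/measurable_EFinP; apply: measurable_mnorm_sqr => i k.
  by have /integrableP[/measurable_EFinP] := h1 i k.
exists rho; split; [exact: h1|exact: h2|exact: h3|exact: mrho|] => p q sp qt.
apply: ge0_ae_eq_integral_left => //.
- exact: (measurable_funS measurableT).
- by move=> x _; rewrite lee_fin mulr_ge0 ?sqr_ge0.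
- by move=> x _; rewrite lee_fin mulr_ge0 ?sqr_ge0.
- by apply: lebesgue_ae_sub (ae_itvcc sp qt h3) => x hx xpq;
    rewrite (derive1_entries (hx xpq)).
Qed.

Lemma kin_point gamma s : kin gamma s s = 0%E.
Proof. by apply: ge0_integral_point => x; rewrite lee_fin mulr_ge0 ?sqr_ge0. Qed.

Lemma kin_cat gamma s p t : s <= p -> p <= t -> abs_continuous m s t gamma ->
  kin gamma s t = (kin gamma s p + kin gamma p t)%E.
Proof.
move=> sp pt h; have [e|st] := eqVneq s t.
  have ps : p = s by apply/eqP; rewrite eq_le sp e pt.
  by rewrite -e ps kin_point adde0.
have {}st : s < t by rewrite lt_neqAle st (le_trans sp).
have [rho [_ _ _ mrho k]] := kin_density st h.
rewrite !k // (ge0_integral_itv_cat sp pt) //.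
- exact: (measurable_funS measurableT).
- by move=> x; rewrite lee_fin mulr_ge0 ?sqr_ge0.
Qed.

Lemma abs_continuousD s t gamma gamma' : abs_continuous m s t gamma ->
  abs_continuous m s t gamma' -> abs_continuous m s t (fun r => gamma r + gamma' r).
Proof.
move=> h h' e e0; have e20 : 0 < e / 2 by rewrite divr_gt0.
have [r1 r10 h1] := h _ e20; have [r2 r20 h2] := h' _ e20.
exists (Num.min r1 r2); first by rewrite lt_min r10.
move=> n a b ab tr; rewrite lt_min => /andP[l1 l2]; rewrite [ltRHS]splitr.
apply: le_lt_trans (ltrD (h1 n a b ab tr l1) (h2 n a b ab tr l2)).
rewrite -big_split; apply: ler_sum => k _ /=.
by rewrite opprD addrACA; exact: mnormD.
Qed.

(** Expansion of the square: as [c] is constant, the cross term integrates to an increment of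
    [gamma]. Finite energy makes the three terms integrable. Slope [-1] gives the lower bounds
    below, and the two affine pieces of a hat give the first variation. *)
Lemma kin_tilt gamma s t a b c : s < t -> abs_continuous m s t gamma ->
  (kin gamma s t < +oo)%E ->
  abs_continuous m s t (fun r => gamma r + (a + r * b) *: c) /\
  kin (fun r => gamma r + (a + r * b) *: c) s t =
    (kin gamma s t + (b * wdot m c (gamma t - gamma s) + 2^-1 * b ^+ 2 * wdot m c c * (t - s))%:E)%E.
Proof.
move=> st h Kfin; have h' : abs_continuous m s t (fun r => gamma r + (a + r * b) *: c).
  apply: abs_continuousD h _; apply: (abs_continuous_lipschitz (L := mnorm m (b *: c))).
  move=> p q sp pq qt; have -> : (a + q * b) *: c - (a + p * b) *: c = (q - p) *: (b *: c).
    by rewrite -scalerBl scalerA; congr (_ *: _); ring.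
  by rewrite mnormZ ger0_norm ?subr_ge0 // mulrC.
split; first exact: h'.
have [rho [ir iE ae mrho kE]] := kin_density st h.
have il : mu.-integrable `[s, t] (fun x => (wdot m c (rho x))%:E).
  have -> : (fun x => (wdot m c (rho x))%:E) =
      (fun x => \sum_i \sum_k (m i * c i k)%:E * (rho x i k)%:E)%E.
    apply/funext => x; rewrite /wdot -sumEFin; apply: eq_bigr => i _.
    by rewrite -sumEFin; apply: eq_bigr => k _; rewrite -EFinM mulrA.
  apply: integrable_sum => // i _; apply: integrable_sum => // k _.
  by apply: integrableZl => //; exact: integrableS (ir i k).
have El : (\int[mu]_(x in `[s, t]) (wdot m c (rho x))%:E = (wdot m c (gamma t - gamma s))%:E)%E.
  have -> : (\int[mu]_(x in `[s, t]) (wdot m c (rho x))%:E =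
      \int[mu]_(x in `[s, t]) \sum_i \sum_k (m i * c i k)%:E * (rho x i k)%:E)%E.
    apply: eq_integral => x _; rewrite /wdot -sumEFin; apply: eq_bigr => i _.
    by rewrite -sumEFin; apply: eq_bigr => k _; rewrite -EFinM mulrA.
  rewrite integral_sum //; last first.
    move=> i; apply: integrable_sum => // k _.
    by apply: integrableZl => //; exact: integrableS (ir i k).
  rewrite /wdot -sumEFin; apply: eq_bigr => i _.
  rewrite integral_sum //; last first.
    by move=> k; apply: integrableZl => //; exact: integrableS (ir i k).
  rewrite -sumEFin; apply: eq_bigr => k _.
  rewrite integralZl //; last exact: integrableS (ir i k).
  by rewrite (iE s t i k (lexx s) (ltW st) (lexx t)) /= !mxE mulrA.
have ic (e : R) : mu.-integrable `[s, t] (fun x => e%:E).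
  apply: (@continuous_compact_integrable R (fun=> e)); first exact: segment_compact.
  by apply: continuous_subspaceT => x; exact: cvg_cst.
have ibl : mu.-integrable `[s, t] (fun x => (b * wdot m c (rho x))%:E).
  by apply: eq_integrable (integrableZl _ b il).
pose g x := (b * wdot m c (rho x) + 2^-1 * b ^+ 2 * wdot m c c)%:E.
have ig : mu.-integrable `[s, t] g by apply: eq_integrable (integrableD _ ibl (ic _)).
have ik : mu.-integrable `[s, t] (fun x => (2^-1 * mnorm m (rho x) ^+ 2)%:E).
  apply/integrableP; split; first exact: (measurable_funS measurableT).
  apply: le_lt_trans Kfin; rewrite (kE _ _ (lexx s) (lexx t)) le_eqVlt; apply/orP; left; apply/eqP.
  by apply: eq_integral => x _; rewrite /= ger0_norm // mulr_ge0 ?sqr_ge0.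
have -> : (b * wdot m c (gamma t - gamma s) + 2^-1 * b ^+ 2 * wdot m c c * (t - s))%:E =
    (\int[mu]_(x in `[s, t]) g x)%E.
  rewrite /g; under eq_integral do rewrite EFinD.
  rewrite integralD // integral_itv_cst ?ltW // EFinD; congr (_ + _)%E.
  by under eq_integral do rewrite EFinM; rewrite integralZl // El EFinM.
rewrite (kE _ _ (lexx s) (lexx t)) -integralD //.
apply: ge0_ae_eq_integral_left.
- exact: measurable_itv.
- by apply: emeasurable_funD; [exact: (measurable_int mu ik)|exact: (measurable_int mu ig)].
- by move=> x _; rewrite lee_fin mulr_ge0 ?sqr_ge0.
- move=> x _; rewrite -EFinD lee_fin (mnorm_sqr m0).
  have := wdot_ge0 m0 (rho x + b *: c).
  by rewrite !(wdotDl, wdotDr, wdotZl, wdotZr) (wdotC m (rho x) c); lra.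
apply: lebesgue_ae_sub (ae_itvcc (lexx s) (lexx t) ae) => x hx xst.
have -> : derive1 (fun r => gamma r + (a + r * b) *: c) x = rho x + b *: c.
  apply: derive1_entries => i k.
  have -> : (fun y => (gamma y + (a + y * b) *: c) i k) =
      (fun y => gamma y i k) + (fun y => a * c i k + y * (b * c i k)).
    by apply/funext => y; rewrite fctE !mxE; ring.
  rewrite !mxE; apply: is_deriveD; [exact: hx|exact: is_derive_affine].
rewrite -EFinD !(mnorm_sqr m0) !(wdotDl, wdotDr, wdotZl, wdotZr) (wdotC m (rho x) c).
by congr EFin; field.
Qed.

(** The curve seen from a frame moving with velocity [c] has nonnegative kinetic energy. *)
Lemma kin_ge_linear gamma s t c : s <= t -> abs_continuous m s t gamma ->
  ((wdot m c (gamma t - gamma s) - 2^-1 * wdot m c c * (t - s))%:E <= kin gamma s t)%E.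
Proof.
rewrite le_eqVlt => /orP[/eqP <-|st] h.
  by rewrite !subrr mulr0 subr0 -(scale0r 0) wdotZr mul0r kin_ge0.
have [fin|] := ltP (kin gamma s t) +oo%E; last by rewrite leye_eq => /eqP ->; rewrite leey.
have [_ E] := kin_tilt 0 (-1) c st h fin.
have := kin_ge0 (fun r => gamma r + (0 + r * -1) *: c) s t; rewrite {}E.
have := kin_ge0 gamma s t; move: fin; case: (kin gamma s t) => [u| |] // _ _.
by rewrite -EFinD !lee_fin; lra.
Qed.

(** The best [c] in the linear bound is the mean velocity. *)
Lemma kin_ge_sqr gamma s t : s <= t -> abs_continuous m s t gamma ->
  ((mnorm m (gamma t - gamma s) ^+ 2 / (2 * (t - s)))%:E <= kin gamma s t)%E.
Proof.
rewrite le_eqVlt => /orP[/eqP <-|st] h.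
  by rewrite (subrr s) mulr0 invr0 mulr0 kin_ge0.
have t0 : 0 < t - s by rewrite subr_gt0.
apply: le_trans (kin_ge_linear ((t - s)^-1 *: (gamma t - gamma s)) (ltW st) h).
rewrite lee_fin !(wdotZl, wdotZr) -mnorm_sqr //.
by rewrite le_eqVlt; apply/orP; left; apply/eqP; field; rewrite gt_eqF.
Qed.

End action_of_curves.

(** * Time shifts and time reversal of curves *)

Section isometric_reparametrization.
Variables (R : realType) (N d : nat) (m : 'I_N -> R).
Hypothesis m0 : forall i, 0 < m i.
Notation mu := (@lebesgue_measure R).
Implicit Types (gamma : R -> 'M[R]_(N, d)).
Variables (b : bool) (c s t s' t' : R).
Hypothesis phi_itv : forall x, (s <= line_isometry b c x <= t) = (s' <= x <= t').

Let phi := line_isometry b c.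
(** The inverse of [phi]; a reflection is its own inverse. *)
Let psi := line_isometry b (if b then c else - c).

Lemma abs_continuous_isometry gamma :
  abs_continuous m s t gamma -> abs_continuous m s' t' (gamma \o phi).
Proof.
move=> h eps /h[r r0 k]; exists r => // n p q pq tr sm.
pose p' i := if b then phi (q i) else phi (p i).
pose q' i := if b then phi (p i) else phi (q i).
have len i : q' i - p' i = q i - p i.
  by rewrite /p' /q' /phi /line_isometry; case: (b); rewrite ?expr1 ?expr0; ring.
have in_ x : s' <= x <= t' -> s <= phi x <= t by rewrite phi_itv.
have -> : \sum_(i < n) mnorm m ((gamma \o phi) (q i) - (gamma \o phi) (p i)) =
    \sum_(i < n) mnorm m (gamma (q' i) - gamma (p' i)).
  by apply: eq_bigr => i _; rewrite /p' /q' /=; case: (b) => //; rewrite mnorm_distC.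
apply: k.
- move=> i; have [h1 h2 h3] := pq i.
  have /andP[k1 k2] := in_ (p i) (introT andP (conj h1 (le_trans h2 h3))).
  have /andP[k3 k4] := in_ (q i) (introT andP (conj (le_trans h1 h2) h3)).
  by split; [rewrite /p'; case: (b)|rewrite -subr_ge0 len subr_ge0|rewrite /q'; case: (b)].
- apply/trivIsetP => i j _ _ ij; move/trivIsetP : tr => /(_ i j I I ij).
  rewrite -!subset0 => H x [/= hi hj]; apply: (H (psi x)).
  move: hi hj; rewrite /= !in_itv /= /p' /q' /phi /psi /line_isometry.
  by case: (b); rewrite ?expr1 ?expr0 => /andP[h1 h2] /andP[h3 h4];
    split; apply/andP; split; lra.
- by rewrite (eq_bigr _ (fun i _ => len i)).
Qed.

Lemma kin_isometry gamma : s < t -> s' < t' -> abs_continuous m s t gamma ->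
  kin m (gamma \o phi) s' t' = kin m gamma s t.
Proof.
move=> st st' h; have [rho [_ _ ae mrho kE]] := kin_density m0 st h.
rewrite (kE _ _ (lexx s) (lexx t)).
have E : (phi @^-1` `[s, t] = `[s', t'])%classic.
  by apply/seteqP; split => x /=; rewrite !in_itv /= phi_itv.
have mr : measurable_fun `[s, t] (fun x => (2^-1 * mnorm m (rho x) ^+ 2)%:E).
  exact: (measurable_funS measurableT).
rewrite -(ge0_integral_line_isometry b c (measurable_itv _) mr); last first.
  by move=> x; rewrite lee_fin mulr_ge0 ?sqr_ge0.
rewrite -/phi E; apply: ge0_ae_eq_integral_left.
- exact: measurable_itv.
- apply: (measurable_funS measurableT) => //.
  apply: (@measurableT_comp _ _ _ _ _ _ (fun x => (2^-1 * mnorm m (rho x) ^+ 2)%:E)).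
    exact: mrho.
  exact: line_isometry_measurable.
- by move=> x _; rewrite lee_fin mulr_ge0 ?sqr_ge0.
- by move=> x _; rewrite lee_fin mulr_ge0 ?sqr_ge0.
have := lebesgue_ae_and (ae_line_isometry b c (ae_itvcc (lexx s) (lexx t) ae)) (lebesgue_ae_and (ae_neq s') (ae_neq t')).
apply: lebesgue_ae_sub => x [hx [xs xt]]; rewrite /= in_itv /= -phi_itv => xst.
have {}hx := hx xst.
have hd i k : is_derive x 1 (fun y => (gamma \o phi) y i k) (((-1) ^+ b *: rho (phi x)) i k).
  have dphi : is_derive x 1 phi ((-1) ^+ b).
    rewrite /phi /line_isometry; apply: is_derive_eq.
    by rewrite /GRing.scale /= mulr1 !addr0.
  by rewrite mxE mulrC; exact: (@is_derive1_comp _ (fun y => gamma y i k) phi x _ _ (hx i k) dphi).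
by rewrite (derive1_entries hd) mnormZ normrX normrN1 expr1n mul1r.
Qed.

End isometric_reparametrization.

(** * The action on an interval *)

Section action.
Variables (R : realType) (N d : nat) (m : 'I_N -> R) (Fp : pair_potentials R N d).
Hypotheses (m0 : forall i, 0 < m i) (hF : condF Fp).
Notation mu := (@lebesgue_measure R).
Implicit Types (gamma : R -> 'M[R]_(N, d)).

Definition pot gamma s t : \bar R :=
  (\int[mu]_(r in `[s, t]) potential Fp (gamma r))%E.

(** [action] is the case [s = 0]; a general initial time lets curves be cut without reparametrizing
    the pieces. *)
Definition act lambda gamma s t : \bar R :=
  (\int[mu]_(r in `[s, t])
    ((2^-1 * mnorm m (derive1 gamma r) ^+ 2)%:E + potential Fp (gamma r) + lambda%:E))%E.

Lemma pot_ge0 gamma s t : (0 <= pot gamma s t)%E.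
Proof. by apply: integral_ge0 => x _; exact: potential_ge0. Qed.

Lemma pot_measurable s t gamma : s <= t -> abs_continuous m s t gamma ->
  measurable_fun `[s, t] (fun r => potential Fp (gamma r)).
Proof.
by move=> st h; apply: potential_curve_measurable => //; exact: abs_continuous_clip h.
Qed.

Lemma pot_cat s p t gamma : s <= p -> p <= t -> abs_continuous m s t gamma ->
  pot gamma s t = (pot gamma s p + pot gamma p t)%E.
Proof.
move=> sp pt h; apply: ge0_integral_itv_cat => //; last by move=> x; exact: potential_ge0.
by apply: pot_measurable => //; exact: le_trans pt.
Qed.

Lemma actE lambda s t gamma : 0 <= lambda -> s <= t -> abs_continuous m s t gamma ->
  act lambda gamma s t = (kin m gamma s t + pot gamma s t + (lambda * (t - s))%:E)%E.
Proof.
move=> l0; have lag0 (e : R) x : 0 <= e -> (0 <= e%:E + potential Fp (gamma x) + lambda%:E)%E.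
  by move=> e0; rewrite !adde_ge0 ?lee_fin // potential_ge0.
rewrite le_eqVlt => /orP[/eqP <-|st] h.
  rewrite kin_point /pot ge0_integral_point; last by move=> x; exact: potential_ge0.
  rewrite subrr mulr0 !adde0; apply: ge0_integral_point => x.
  by apply: lag0; rewrite mulr_ge0 ?sqr_ge0.
have [rho [_ _ ae mrho kE]] := kin_density m0 st h.
have mp := pot_measurable (ltW st) h.
have mr : measurable_fun `[s, t] (fun r => (2^-1 * mnorm m (rho r) ^+ 2)%:E).
  exact: (measurable_funS measurableT).
have k0 r : (0 <= (2^-1 * mnorm m (rho r) ^+ 2)%:E)%E by rewrite lee_fin mulr_ge0 ?sqr_ge0.
have l0' (r : R) : (0 <= lambda%:E)%E by rewrite lee_fin.
have kp0 r : (0 <= (2^-1 * mnorm m (rho r) ^+ 2)%:E + potential Fp (gamma r))%E.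
  by rewrite adde_ge0 // potential_ge0.
have mkp := emeasurable_funD mr mp.
have mD := measurable_itv `[s, t].
rewrite (kE _ _ (lexx s) (lexx t)) -(integral_itv_cst lambda (ltW st)) /pot /act.
rewrite -(ge0_integralD mu mD (fun x _ => k0 x) mr (fun x _ => potential_ge0 hF (gamma x)) mp).
rewrite -(ge0_integralD mu mD (fun x _ => kp0 x) mkp (fun x _ => l0' x) (measurable_cst _)).
apply: ge0_ae_eq_integral_left; first exact: mD.
- by apply: emeasurable_funD mkp _; exact: measurable_cst.
- by move=> x _; apply: lag0; rewrite mulr_ge0 ?sqr_ge0.
- by move=> x _; apply: lag0; rewrite mulr_ge0 ?sqr_ge0.
apply: lebesgue_ae_sub (ae_itvcc (lexx s) (lexx t) ae) => x hx xpq.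
by rewrite (derive1_entries (hx xpq)).
Qed.

Variable lambda : R.
Hypothesis l0 : 0 < lambda.
Let lW := ltW l0.

Lemma act_ge0 gamma s t : (0 <= act lambda gamma s t)%E.
Proof.
apply: integral_ge0 => x _.
apply: adde_ge0; last by rewrite lee_fin.
by apply: adde_ge0; [rewrite lee_fin mulr_ge0 ?sqr_ge0|exact: potential_ge0].
Qed.

Lemma act_cat s p t gamma : s <= p -> p <= t -> abs_continuous m s t gamma ->
  act lambda gamma s t = (act lambda gamma s p + act lambda gamma p t)%E.
Proof.
move=> sp pt h; have st := le_trans sp pt.
have h1 : abs_continuous m s p gamma := abs_continuous_sub (lexx s) pt h.
have h2 : abs_continuous m p t gamma := abs_continuous_sub sp (lexx t) h.
rewrite !actE // (kin_cat m0 sp pt h) (pot_cat sp pt h).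
have -> : (lambda * (t - s))%:E = ((lambda * (p - s))%:E + (lambda * (t - p))%:E)%E.
  by rewrite -EFinD; congr EFin; ring.
rewrite (addeACA (kin m gamma s p)) [RHS]addeACA //.
Qed.

Lemma act_ge_kin s t gamma : s <= t -> abs_continuous m s t gamma ->
  (kin m gamma s t <= act lambda gamma s t)%E.
Proof.
move=> st h; rewrite actE // -addeA leeDl // adde_ge0 // ?pot_ge0 //.
by rewrite lee_fin mulr_ge0 // subr_ge0.
Qed.

(** The linear function [<w, _>] calibrates: its gradient has energy exactly [lambda], so
    [|p|^2 / 2 + lambda >= <w, p>], and the potential is nonnegative. *)
Lemma act_ge_ray s t gamma w : s <= t -> abs_continuous m s t gamma ->
  wdot m w w = 2 * lambda -> ((wdot m w (gamma t - gamma s))%:E <= act lambda gamma s t)%E.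
Proof.
move=> st h ww; rewrite actE //.
apply: (@le_trans _ _ (kin m gamma s t + (lambda * (t - s))%:E)%E); last first.
  by apply: leeD => //; rewrite leeDl // pot_ge0.
apply: (@le_trans _ _ ((wdot m w (gamma t - gamma s) - 2^-1 * wdot m w w * (t - s))%:E
    + (lambda * (t - s))%:E)%E); last by apply: leeD => //; exact: kin_ge_linear.
by rewrite -EFinD lee_fin ww le_eqVlt; apply/orP; left; apply/eqP; field.
Qed.

(** Completing the square: for a displacement [D] in time [T], [|D|^2 / (2 T) + lambda T] equals
    [<w, D> + |D - T w|^2 / (2 T)]. This is the calibration bound with its quadratic remainder
    kept. *)
Lemma act_ge_deviation s t gamma w : s < t -> abs_continuous m s t gamma ->
  wdot m w w = 2 * lambda ->
  ((wdot m w (gamma t - gamma s) +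
    mnorm m (gamma t - gamma s - (t - s) *: w) ^+ 2 / (2 * (t - s)))%:E <= act lambda gamma s t)%E.
Proof.
move=> st h ww; rewrite (actE lW (ltW st) h).
apply: (@le_trans _ _ (kin m gamma s t + (lambda * (t - s))%:E)%E); last first.
  by apply: leeD => //; rewrite leeDl // pot_ge0.
apply: (@le_trans _ _ ((mnorm m (gamma t - gamma s) ^+ 2 / (2 * (t - s)))%:E
    + (lambda * (t - s))%:E)%E); last by apply: leeD => //; apply: kin_ge_sqr => //; exact: ltW.
have t0 : 0 < t - s by rewrite subr_gt0.
rewrite -EFinD lee_fin !mnorm_sqr // !(wdotDl, wdotDr, wdotNl, wdotNr, wdotZl, wdotZr).
rewrite (wdotC m (gamma t) w) (wdotC m (gamma s) w) ww.
by rewrite le_eqVlt; apply/orP; left; apply/eqP; field; rewrite gt_eqF.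
Qed.

Lemma act_isometry b c s t s' t' gamma :
  (forall x, (s <= line_isometry b c x <= t) = (s' <= x <= t')) ->
  s < t -> s' < t' -> t' - s' = t - s -> abs_continuous m s t gamma ->
  act lambda (gamma \o line_isometry b c) s' t' = act lambda gamma s t.
Proof.
move=> hphi st st' len h.
have h' := abs_continuous_isometry hphi h.
rewrite (actE lW (ltW st) h) (actE lW (ltW st') h') (kin_isometry m0 hphi st st' h) len.
have E := ge0_integral_line_isometry b c (measurable_itv `[s, t])
  (pot_measurable (ltW st) h) (fun x => potential_ge0 hF (gamma x)).
rewrite /pot -E; congr (_ + _ + _)%E; congr (integral _ _ _).
by apply/seteqP; split => x /=; rewrite !in_itv /= hphi.
Qed.

End action.

(** * Mane's potential *)

Section mane_potential.
Variables (R : realType) (N d : nat) (m : 'I_N -> R) (Fp : pair_potentials R N d).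
Hypotheses (m0 : forall i, 0 < m i) (hF : condF Fp).
Notation mu := (@lebesgue_measure R).
Implicit Types (gamma : R -> 'M[R]_(N, d)) (x y z : 'M[R]_(N, d)).

(** At [s] and [t] the derivatives may differ, as nothing relates the curves outside [[s, t]]; near
    interior points the curves agree, and the two ends form a null set. *)
Lemma kin_eq gamma gamma' s t :
  (forall r, s <= r <= t -> gamma r = gamma' r) -> s <= t ->
  abs_continuous m s t gamma -> kin m gamma s t = kin m gamma' s t.
Proof.
move=> e; rewrite le_eqVlt => /orP[/eqP <-|st h]; first by rewrite !kin_point.
have [rho [_ _ ae mrho kE]] := kin_density m0 st (eq_abs_continuous e h).
rewrite (kE _ _ (lexx s) (lexx t)); apply: ge0_ae_eq_integral_left.
- exact: measurable_itv.
- exact: (measurable_funS measurableT).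
- by move=> x _; rewrite lee_fin mulr_ge0 ?sqr_ge0.
- by move=> x _; rewrite lee_fin mulr_ge0 ?sqr_ge0.
have ae' : {ae mu, forall x : R, s < x < t -> derive1 gamma x = rho x}.
  apply: lebesgue_ae_sub ae => x hx sxt; rewrite -(derive1_entries (hx sxt)) !derive1E.
  apply: near_eq_derive; near=> y; apply: e.
  have : y \in `]s, t[ by near: y; apply: near_in_itvoo; rewrite in_itv.
  by rewrite in_itv /= => /andP[/ltW -> /ltW ->].
by apply: lebesgue_ae_sub (ae_itvcc (lexx s) (lexx t) ae') => x hx /hx ->.
Unshelve. all: by end_near. Qed.

Lemma pot_eq gamma gamma' s t : (forall r, s <= r <= t -> gamma r = gamma' r) ->
  pot Fp gamma s t = pot Fp gamma' s t.
Proof. by move=> e; apply: eq_integral => r; rewrite inE /= in_itv /= => /e ->. Qed.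

Section fixed_energy.
Variable lambda : R.
Hypothesis l0 : 0 < lambda.
Let lW := ltW l0.
Notation mane := (mane m Fp lambda).
Notation act := (act m Fp lambda).

Lemma act_eq gamma gamma' s t :
  (forall r, s <= r <= t -> gamma r = gamma' r) -> s <= t ->
  abs_continuous m s t gamma -> act gamma s t = act gamma' s t.
Proof.
move=> e st h; rewrite (actE m0 hF lW st h) (actE m0 hF lW st (eq_abs_continuous e h)).
by rewrite (kin_eq e st h) (pot_eq e).
Qed.

Lemma mane_ge0 x y : (0 <= mane x y)%E.
Proof.
by apply: le_ereal_inf_tmp => _ [sigma [gamma [_ _ ->]]]; exact: act_ge0.
Qed.

Lemma mane_le_act gamma s t : s < t -> abs_continuous m s t gamma ->
  (mane (gamma s) (gamma t) <= act gamma s t)%E.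
Proof.
move=> st h; have t0 : 0 < t - s by rewrite subr_gt0.
have hphi (x : R) : (s <= line_isometry false s x <= t) = (0 <= x <= t - s).
  rewrite /line_isometry expr0 mul1r lerDr; congr (_ && _).
  by rewrite lerBrDr.
apply: ereal_inf_lbound.
exists (t - s), (gamma \o line_isometry false s); split; first exact: t0.
  split; [exact: (abs_continuous_isometry hphi h)|by []| |].
  - by rewrite /= /line_isometry mulr0 add0r.
  - by rewrite /= /line_isometry expr0 mul1r subrK.
rewrite /action -/(act _ 0 (t - s)).
by rewrite (act_isometry m0 hF l0 hphi st t0 (subr0 _) h).
Qed.

Lemma mane_near x y e : (mane x y < +oo)%E -> 0 < e ->
  exists (sigma : R) gamma, [/\ 0 < sigma, abs_continuous m 0 sigma gamma,
    gamma 0 = x, gamma sigma = y & (act gamma 0%R sigma < mane x y + e%:E)%E].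
Proof.
move=> fin e0; have ff : mane x y \is a fin_num by rewrite ge0_fin_numE // mane_ge0.
have [_ [sigma [gamma [s0 [h _ h0 hs] ->]]] lt] := lb_ereal_inf_adherent e0 ff.
by exists sigma, gamma; split; [exact: s0|exact: h|exact: h0|exact: hs|exact: lt].
Qed.

Lemma mane_triangle x y z : (mane x z <= mane x y + mane y z)%E.
Proof.
have [f1|] := ltP (mane x y) +oo%E; last first.
  by rewrite leye_eq => /eqP ->; rewrite addye ?leey // -ltNye (lt_le_trans (ltNyr 0)) // mane_ge0.
have [f2|] := ltP (mane y z) +oo%E; last first.
  by rewrite leye_eq => /eqP ->; rewrite addey ?leey // -ltNye (lt_le_trans (ltNyr 0)) // mane_ge0.
apply/lee_addgt0Pr => e e0.
have [s1 [g1 [s10 h1 g10 g1s a1]]] := mane_near f1 (divr_gt0 e0 (ltr0Sn _ 1)).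
have [s2 [g2 [s20 h2 g20 g2s a2]]] := mane_near f2 (divr_gt0 e0 (ltr0Sn _ 1)).
pose g r := if r <= s1 then g1 r else g2 (r - s1).
have hphi r : (0 <= line_isometry false (- s1) r <= s2) = (s1 <= r <= s1 + s2).
  by rewrite /line_isometry expr0 mul1r subr_ge0 lerBlDr (addrC s2).
have s12 : s1 < s1 + s2 by rewrite ltrDl.
have e1 r : 0 <= r <= s1 -> g1 r = g r by move=> /andP[_ h]; rewrite /g h.
have e2 r : s1 <= r <= s1 + s2 -> (g2 \o line_isometry false (- s1)) r = g r.
  move=> /andP[h _]; rewrite /= /line_isometry expr0 mul1r /g.
  case: ifPn => // h'; have -> : r = s1 by apply/eqP; rewrite eq_le h h'.
  by rewrite subrr g20 g1s.
have k2 := abs_continuous_isometry hphi h2.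
have ac1 := eq_abs_continuous e1 h1.
have ac2 := eq_abs_continuous e2 k2.
have ac := abs_continuous_cat m0 (ltW s10) (ltW s12) ac1 ac2.
have := mane_le_act (lt_trans s10 s12) ac.
have -> : g 0 = x by rewrite /g ltW.
have -> : g (s1 + s2) = z by rewrite /g leNgt s12 /= addrC addKr.
move=> /le_trans; apply.
rewrite (act_cat m0 hF l0 (ltW s10) (ltW s12) ac) -(act_eq e1 (ltW s10) h1) -(act_eq e2 (ltW s12) k2).
rewrite (act_isometry m0 hF l0 hphi s20 s12 _ h2); last by rewrite subr0 addrC addKr.
apply: le_trans (leeD (ltW a1) (ltW a2)) _.
by rewrite addeACA -EFinD -splitr.
Qed.

Lemma line_kin x c s t : s <= t ->
  [/\ abs_continuous m s t (fun r => x + r *: c) &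
      kin m (fun r => x + r *: c) s t = (2^-1 * wdot m c c * (t - s))%:E].
Proof.
move=> st; split.
  apply: (abs_continuous_lipschitz (L := mnorm m c)) => p q sp pq qt.
  have -> : x + q *: c - (x + p *: c) = (q - p) *: c.
    by rewrite opprD addrACA subrr add0r -scalerBl.
  by rewrite mnormZ ger0_norm ?subr_ge0 // mulrC.
rewrite -(integral_itv_cst _ st); apply: eq_integral => r _.
rewrite -(mnorm_sqr m0); congr ((_ * mnorm m _ ^+ 2)%:E).
apply: derive1_entries => i k.
have -> : (fun y : R => (x + y *: c) i k) = (fun y : R => x i k + y * c i k).
  by apply/funext => y; rewrite !mxE.
exact: is_derive_affine.
Qed.

Lemma mane_line x c tau : 0 < tau ->
  (mane x (x + tau *: c) <= ((2^-1 * wdot m c c + lambda) * tau)%:E +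
     pot Fp (fun r => x + r *: c)%R 0%R tau)%E.
Proof.
move=> t0; have [h k] := line_kin x c (ltW t0).
have := mane_le_act t0 h; rewrite scale0r addr0 => /le_trans; apply.
rewrite (actE m0 hF lW (ltW t0) h) k subr0 addeAC -EFinD.
by rewrite -mulrDl.
Qed.

(** The travel time stays free: a small [tau] limits the second term, and then [y] close to [x] the
    first, which gives continuity of Mane's potential where the potential is locally bounded. *)
Lemma mane_segment x y M tau : 0 < tau ->
  (forall r, 0 <= r <= 1 -> (potential Fp (x + r *: (y - x)) <= M%:E)%E) ->
  (mane x y <= (mnorm m (y - x) ^+ 2 / (2 * tau) + (lambda + M) * tau)%:E)%E.
Proof.
move=> t0 hM; have := mane_line x (tau^-1 *: (y - x)) t0.
rewrite scalerA divff ?gt_eqF // scale1r addrC subrK => /le_trans; apply.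
have P : (pot Fp (fun r => x + r *: (tau^-1 *: (y - x)))%R 0%R tau <= (M * tau)%:E)%E.
  rewrite -[X in (M * X)%:E]subr0 -(integral_itv_cst M (ltW t0)).
  apply: ge0_integral_mono => r /=; first by move=> _; exact: potential_ge0.
  rewrite in_itv /= => /andP[r0 rt]; rewrite scalerA; apply: hM.
  by rewrite divr_ge0 ?(ltW t0) //= ler_pdivrMr // mul1r.
apply: le_trans (leeD (lexx _) P) _; rewrite -EFinD lee_fin wdotZl wdotZr -mnorm_sqr //.
by rewrite le_eqVlt; apply/orP; left; apply/eqP; field; rewrite gt_eqF.
Qed.

End fixed_energy.

(** Finite action means finite kinetic and potential integrals over a bounded time, a condition
    insensitive to the energy constant and to the direction of time. *)
Lemma mane_reverse lambda lambda' x y : 0 < lambda -> 0 < lambda' ->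
  (mane m Fp lambda x y < +oo)%E -> (mane m Fp lambda' y x < +oo)%E.
Proof.
move=> l0 l0' fin; have [s [g [s0 h g0 gs lt]]] := mane_near l0 fin ltr01.
have hphi r : (0 <= line_isometry true s r <= s) = (0 <= r <= s).
  rewrite /line_isometry expr1 mulN1r andbC gerDr oppr_le0; congr (_ && _).
  by rewrite addrC subr_ge0.
have k := abs_continuous_isometry hphi h.
have := mane_le_act l0' s0 k.
rewrite /= /line_isometry !expr1 !mulN1r oppr0 add0r addNr g0 gs => /le_lt_trans; apply.
rewrite (act_isometry m0 hF l0' hphi s0 s0 _ h) //.
have : (act m Fp lambda g 0%R s < +oo)%E by rewrite (lt_trans lt) // lte_add_pinfty // ltry.
rewrite (actE m0 hF (ltW l0) (ltW s0) h) (actE m0 hF (ltW l0') (ltW s0) h).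
have := kin_ge0 m g 0 s; have := pot_ge0 hF g 0 s.
by case: (kin m g 0 s) => [u| |] //; case: (pot Fp g 0 s) => [v| |] // _ _ _; exact: ltry.
Qed.

Lemma mane_energy lambda lambda' x y : 0 < lambda -> 0 < lambda' ->
  (mane m Fp lambda x y < +oo)%E -> (mane m Fp lambda' x y < +oo)%E.
Proof. by move=> l0 l0' /(mane_reverse l0 l0') /(mane_reverse l0' l0'). Qed.

Lemma tOmega_mane lambda x y : 0 < lambda -> tOmega m Fp x ->
  (mane m Fp lambda x y < +oo)%E -> tOmega m Fp y.
Proof.
move=> l0 [l' [x0 [l0' ox fin]]] fin'; exists lambda, x0; split => //.
apply: le_lt_trans (mane_triangle l0 _ x _) _; apply: lte_add_pinfty => //.
exact: mane_energy fin.
Qed.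

End mane_potential.

(** * Lower semicontinuity of the action *)

Section straddle.
Variable R : realType.

(** The first order errors at [a] and [b] are at most [e (x - a)] and [e (b - x)], which add up to
    [e (b - a)]. Both ends may move, as they do for the grid cell containing [x]. *)
Lemma straddle_quotient (f : R -> R) (x v e : R) : is_derive x 1 f v -> 0 < e ->
  exists2 r : R, 0 < r & forall a b, a <= x -> x <= b -> a < b -> b - a < r ->
    `|(f b - f a) / (b - a) - v| <= e.
Proof.
move=> [df dv] e0.
have cv : h^-1 *: (f (h *: (1 : R) + x) - f x) @[h --> 0^'] --> v.
  by rewrite -dv; move: df => /cvg_ex [l hl]; rewrite /derive (cvg_lim _ hl).
have /cvgrPdist_le /(_ e e0) [r /= r0 hr] := cv.
exists r => // a b ax xb ab bar.
have key y : `|y - x| < r -> `|f y - f x - v * (y - x)| <= e * `|y - x|.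
  move=> yx; have [->|ne] := eqVneq y x; first by rewrite !subrr mulr0 subr0 !normr0 mulr0.
  have nz : y - x != 0 by rewrite subr_eq0.
  have := hr (y - x); rewrite /= sub0r normrN => /(_ yx nz).
  rewrite /GRing.scale /= mulr1 subrK => h.
  have -> : f y - f x - v * (y - x) = - (v - (y - x)^-1 * (f y - f x)) * (y - x) by field.
  by rewrite normrM normrN ler_wpM2r.
have ba : 0 < b - a by rewrite subr_gt0.
have -> : (f b - f a) / (b - a) - v =
    ((f b - f x - v * (b - x)) - (f a - f x - v * (a - x))) / (b - a).
  by field; rewrite gt_eqF.
rewrite normrM normfV (gtr0_norm ba) ler_pdivrMr //.
apply: le_trans (ler_normB _ _) _.
have h1 : `|b - x| = b - x by rewrite ger0_norm ?subr_ge0.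
have h2 : `|a - x| = x - a by rewrite distrC ger0_norm ?subr_ge0.
have k1 : `|b - x| < r by rewrite h1; lra.
have k2 : `|a - x| < r by rewrite h2; lra.
by have := key b k1; have := key a k2; rewrite h1 h2; nra.
Qed.

Lemma cvg_finite_sum (T : Type) (G : set_system T) (I : Type) (r : seq I) (F : I -> T -> R)
    (l : I -> R) : Filter G -> (forall i, F i n @[n --> G] --> l i) ->
  (\sum_(i <- r) F i n) @[n --> G] --> \sum_(i <- r) l i.
Proof.
move=> FG h; elim: r => [|i r ih].
  rewrite big_nil; have -> : (fun n => \sum_(i <- [::]) F i n) = (fun=> 0).
    by apply/funext => n; rewrite big_nil.
  exact: cvg_cst.
rewrite big_cons.
have -> : (fun n => \sum_(j <- i :: r) F j n) = (fun n => F i n + \sum_(j <- r) F j n).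
  by apply/funext => n; rewrite big_cons.
exact: cvgD.
Qed.

Lemma limn_einf_le (u : nat -> \bar R) (c : \bar R) :
  (\forall n \near \oo, (u n <= c)%E) -> (limn_einf u <= c)%E.
Proof.
move=> [n _ hn]; rewrite limn_einf_lim; apply: lime_le; first exact: is_cvg_einfs.
exists n => // k nk; apply: le_trans (hn k nk).
by apply: ereal_inf_lbound; exists k => /=.
Qed.

Lemma limn_einf_ge (u : nat -> \bar R) (c : \bar R) :
  (forall n, (c <= u n)%E) -> (c <= limn_einf u)%E.
Proof.
move=> h; rewrite limn_einf_lim; apply: lime_ge; first exact: is_cvg_einfs.
by apply: nearW => n; apply: le_ereal_inf_tmp => _ [k _ <-].
Qed.

Lemma limn_einf_mono (u v : nat -> \bar R) :
  (forall n, (u n <= v n)%E) -> (limn_einf u <= limn_einf v)%E.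
Proof.
move=> h; rewrite !limn_einf_lim; apply: lee_lim; [exact: is_cvg_einfs|exact: is_cvg_einfs|].
apply: nearW => n; apply: le_ereal_inf_tmp => _ [k nk <-].
by apply: le_trans (h k); apply: ereal_inf_lbound; exists k.
Qed.

End straddle.

Section lower_semicontinuity_of_action.
Variables (R : realType) (N d : nat) (m : 'I_N -> R) (Fp : pair_potentials R N d).
Hypotheses (m0 : forall i, 0 < m i) (hF : condF Fp).
Notation mu := (@lebesgue_measure R).
Implicit Types (gamma : R -> 'M[R]_(N, d)).

Lemma mnorm_continuous_seq (u : nat -> 'M[R]_(N, d)) l :
  u n @[n --> \oo] --> l -> mnorm m (u n) @[n --> \oo] --> mnorm m l.
Proof.
move=> ul; have [c c0 hc] := @mnorm_le_norm R N d m m0.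
apply/cvgrPdist_lt => e e0.
have /cvgrPdist_lt /(_ _ (divr_gt0 e0 c0)) := ul.
apply: filterS => n; rewrite ltr_pdivlMr // mulrC => h.
apply: le_lt_trans h; apply: le_trans (hc _).
rewrite ler_norml; have := mnorm_dist_le m0 l (u n) 0; have := mnorm_dist_le m0 (u n) l 0.
rewrite !subr0 (mnorm_distC _ (u n) l) => h1 h2.
by apply/andP; split; lra.
Qed.

Lemma kin_sum_le s t gamma n (a b : 'I_n -> R) : s < t -> abs_continuous m s t gamma ->
  (forall k, [/\ s <= a k, a k <= b k & b k <= t]) ->
  trivIset setT (fun k => `]a k, b k[%classic) ->
  (\sum_(k < n) kin m gamma (a k) (b k) <= kin m gamma s t)%E.
Proof.
move=> st h ab tr; have [rho [_ _ _ mrho kE]] := kin_density m0 st h.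
have f0 x : (0 <= (2^-1 * mnorm m (rho x) ^+ 2)%:E)%E by rewrite lee_fin mulr_ge0 ?sqr_ge0.
have mr (D : set R) : measurable D -> measurable_fun D (fun x => (2^-1 * mnorm m (rho x) ^+ 2)%:E).
  by move=> mD; exact: (measurable_funS measurableT).
rewrite (kE _ _ (lexx s) (lexx t)).
have -> : (\sum_(k < n) kin m gamma (a k) (b k) =
   \sum_(k < n) \int[mu]_(x in `]a k, b k[) (2^-1 * mnorm m (rho x) ^+ 2)%:E)%E.
  apply: eq_bigr => k _; have [h1 h2 h3] := ab k; rewrite (kE _ _ h1 h3).
  by apply: integral_itv_bndoo; exact: mr.
have mI k : measurable `]a k, b k[%classic by exact: measurable_itv.
have mU : measurable (\big[setU/set0]_(k < n) `]a k, b k[%classic : set R).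
  by apply: bigsetU_measurable => k _; exact: mI.
rewrite -ge0_integral_bigsetU; last 5 first.
- exact: mI.
- exact: index_enum_uniq.
- by apply: sub_trivIset tr.
- exact: mr.
- by move=> x _; exact: f0.
apply: ge0_subset_integral => //; first exact: mr.
rewrite -bigcup_seq => x [k _] /=; rewrite !in_itv /= => /andP[x1 x2].
by have [h1 h2 h3] := ab k; rewrite (le_trans h1 (ltW x1)) (le_trans (ltW x2) h3).
Qed.

Lemma energy_sum_le s t gamma n (a b : 'I_n -> R) : s < t -> abs_continuous m s t gamma ->
  (forall k, [/\ s <= a k, a k <= b k & b k <= t]) ->
  trivIset setT (fun k => `]a k, b k[%classic) ->
  ((\sum_(k < n) mnorm m (gamma (b k) - gamma (a k)) ^+ 2 / (2 * (b k - a k)))%:E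
    <= kin m gamma s t)%E.
Proof.
move=> st h ab tr; apply: le_trans (kin_sum_le st h ab tr).
rewrite -sumEFin; apply: lee_sum => k _; have [h1 h2 h3] := ab k.
by apply: kin_ge_sqr => //; exact: abs_continuous_sub h.
Qed.

Section limit.
Variables (lambda T B : R) (g : nat -> R -> 'M[R]_(N, d)) (gamma : R -> 'M[R]_(N, d)).
Hypotheses (l0 : 0 < lambda) (T0 : 0 < T)
  (gAC : forall n, abs_continuous m 0 T (g n))
  (gact : forall n, (act m Fp lambda (g n) 0%R T <= B%:E)%E)
  (gcvg : forall r, 0 <= r <= T -> g n r @[n --> \oo] --> gamma r).

Let qsum n (a b : 'I_n -> R) (eta : R -> 'M[R]_(N, d)) :=
  \sum_(k < n) mnorm m (eta (b k) - eta (a k)) ^+ 2 / (2 * (b k - a k)).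

Let family n (a b : 'I_n -> R) := (forall k, [/\ 0 <= a k, a k <= b k & b k <= T]) /\
  trivIset setT (fun k => `]a k, b k[%classic).

Let qsum_cvg n (a b : 'I_n -> R) : family a b ->
  qsum a b (g j) @[j --> \oo] --> qsum a b gamma.
Proof.
move=> [ab _]; apply: cvg_finite_sum => k; have [h1 h2 h3] := ab k.
apply: cvgM; last exact: cvg_cst.
have c : mnorm m (g j (b k) - g j (a k)) @[j --> \oo] --> mnorm m (gamma (b k) - gamma (a k)).
  apply: (mnorm_continuous_seq (u := fun j => g j (b k) - g j (a k))).
  apply: cvgB; apply: gcvg; first by rewrite h3 (le_trans h1).
  by rewrite h1 (le_trans h2).
by rewrite expr2; under eq_fun do rewrite expr2; exact: cvgM.
Qed.

(** The kinetic energy is replaced by a discrete lower bound, which depends on finitely many values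
    of the curve and hence passes to pointwise limits. *)
Let qsum_pot n (a b : 'I_n -> R) j : family a b ->
  (pot Fp (g j) 0%R T <= (B - lambda * T - qsum a b (g j))%:E)%E.
Proof.
move=> [ab tr]; have := gact j.
rewrite (actE m0 hF (ltW l0) (ltW T0) (gAC j)) subr0.
have := energy_sum_le T0 (gAC j) ab tr; rewrite -/(qsum a b (g j)).
have := kin_ge0 m (g j) 0 T; have := pot_ge0 hF (g j) 0 T.
case: (kin m (g j) 0 T) => [u| |] //; case: (pot Fp (g j) 0%R T) => [v| |] // _ _.
rewrite -!EFinD !lee_fin; lra.
Qed.

Let pot_fatou : (pot Fp gamma 0%R T <= limn_einf (fun j => pot Fp (g j) 0%R T))%E.
Proof.
apply: (@le_trans _ _ (\int[mu]_(x in `[0%R, T]) limn_einf (fun j => potential Fp (g j x)))%E).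
  apply: ge0_integral_mono => x /=; first by move=> _; exact: potential_ge0.
  rewrite in_itv /= => /gcvg h.
  by apply: (lower_semicontinuous_liminf (potential_lsc hF) _ h); exact: potential_ge0.
apply: fatou.
- exact: measurable_itv.
- by move=> j; exact: (pot_measurable m0 hF (ltW T0) (gAC j)).
- by move=> j x _; exact: potential_ge0.
Qed.

(** For a fixed family the discrete energies converge, while the potential passes to the limit by
    Fatou. The resulting inequality gives the absolute continuity of [gamma] and, over refined
    grids, the bound on its action. *)
Let qsum_limit n (a b : 'I_n -> R) : family a b ->
  ((qsum a b gamma)%:E + pot Fp gamma 0%R T + (lambda * T)%:E <= B%:E)%E.
Proof.
move=> ab.
have H : (pot Fp gamma 0%R T <= (B - lambda * T - qsum a b gamma)%:E)%E.
  apply/lee_addgt0Pr => e e0; apply: le_trans pot_fatou _; apply: limn_einf_le.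
  have /cvgrPdist_lt /(_ e e0) := qsum_cvg ab.
  apply: filterS => j hj; apply: le_trans (qsum_pot j ab) _.
  rewrite -EFinD lee_fin; move: hj; rewrite ltr_norml => /andP[h1 h2]; lra.
apply: le_trans (leeD (leeD (lexx _) H) (lexx _)) _.
by rewrite -!EFinD lee_fin; lra.
Qed.

Lemma limit_abs_continuous : abs_continuous m 0 T gamma.
Proof.
apply: (@abs_continuous_energy R N d m 0 T gamma (2 * B)) => n a b ab tr.
have := qsum_limit (conj ab tr).
have := pot_ge0 hF gamma 0 T; case: (pot Fp gamma 0 T) => [u| |] // u0.
rewrite -!EFinD lee_fin => h.
have E : \sum_(k < n) mnorm m (gamma (b k) - gamma (a k)) ^+ 2 / (b k - a k) =
   2 * qsum a b gamma.
  by rewrite /qsum mulr_sumr; apply: eq_bigr => k _; rewrite invfM mulrCA [2 * _]mulrA divff // mul1r.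
rewrite E ler_pM2l //; move: u0; rewrite lee_fin => u0.
have lT : 0 < lambda * T by rewrite mulr_gt0.
lra.
Qed.

Let cell j (k : 'I_j.+1) : R := k%:R * (T / j.+1%:R).
Let cell' j (k : 'I_j.+1) : R := k.+1%:R * (T / j.+1%:R).

Let h0 j : 0 < T / j.+1%:R. Proof. by rewrite divr_gt0. Qed.

Let cell_len j (k : 'I_j.+1) : cell' k - cell k = T / j.+1%:R.
Proof. by rewrite /cell /cell' -mulrBl -natrB // subSnn mul1r. Qed.

Let cell_family j : family (@cell j) (@cell' j).
Proof.
split.
  move=> k; split; first by rewrite mulr_ge0 // ltW.
    by rewrite -subr_ge0 cell_len ltW.
  rewrite /cell' mulrA ler_pdivrMr // mulrC ler_pM2l // ler_nat.
  exact: ltn_ord.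
apply/trivIsetP => i k _ _ ik; rewrite -subset0 => x [/=].
rewrite !in_itv /= => /andP[h1 h2] /andP[h3 h4]; apply/negP: ik; rewrite negbK.
have cellP (l : 'I_j.+1) : cell l < x -> x < cell' l -> Num.truncn (x / (T / j.+1%:R)) = l.
  move=> c1 c2; apply: truncn_def; rewrite ler_pdivlMr // ltr_pdivrMr // ltW //.
by rewrite -val_eqE /= -(cellP i) // (cellP k).
Qed.

(** Half the squared speed of the piecewise linear interpolation of [gamma] on the grid. The cells
    are half-open, so each time in [[0, T[] lies in exactly one. *)
Let stepE j x := \sum_(k < j.+1)
  2^-1 * (mnorm m (gamma (cell' k) - gamma (cell k)) / (T / j.+1%:R)) ^+ 2 *
  \1_(`[cell k, cell' k[%classic : set R) x.

Let step_ge0 j x : 0 <= stepE j x.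
Proof.
by apply: sumr_ge0 => k _; rewrite mulr_ge0 // mulr_ge0 ?sqr_ge0.
Qed.

Let step_measurable j : measurable_fun `[0, T] (EFin \o stepE j).
Proof.
apply/measurable_EFinP; apply: measurable_sum => k.
apply: measurable_funM => //; apply: measurable_indic; exact: measurable_itv.
Qed.

Let step_integral j : (\int[mu]_(x in `[0%R, T]) (stepE j x)%:E <=
  (qsum (@cell j) (@cell' j) gamma)%:E)%E.
Proof.
under eq_integral do rewrite -sumEFin.
rewrite ge0_integral_sum; last 3 first.
- exact: measurable_itv.
- by move=> k; apply/measurable_EFinP; apply: measurable_funM.
- by move=> k x _; rewrite lee_fin mulr_ge0 // mulr_ge0 ?sqr_ge0.
rewrite /qsum -sumEFin; apply: lee_sum => k _.
set c := 2^-1 * _; have c0 : 0 <= c by rewrite mulr_ge0 ?sqr_ge0.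
under eq_integral do rewrite EFinM.
rewrite ge0_integralZl_EFin //; last by apply/measurable_EFinP.
rewrite integral_indic; last exact: measurable_itv.
  apply: (@le_trans _ _ (c%:E * (cell' k - cell k)%:E)%E); last first.
    rewrite -EFinM lee_fin cell_len /c le_eqVlt; apply/orP; left; apply/eqP.
    move: (T / _) (gt_eqF (h0 j)) => w /negbT w0; field.
    by rewrite w0.
  apply: lee_wpmul2l; first by rewrite lee_fin.
  apply: (@le_trans _ _ (mu `[cell k, cell' k]%classic)).
    apply: lebesgue_le; [by apply: measurableI; exact: measurable_itv|exact: measurable_itv|].
    by move=> x [] /=; rewrite !in_itv /= => /andP[-> /ltW ->].
  by rewrite lebesgue_itvcc // -subr_ge0 cell_len ltW.
all: exact: measurable_itv.
Qed.

Let step_cvg x (v : 'M[R]_(N, d)) : 0 < x < T ->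
  (forall i k, is_derive x 1 (fun y => gamma y i k) (v i k)) ->
  ((2^-1 * mnorm m v ^+ 2)%:E <= limn_einf (fun j => (stepE j x)%:E))%E.
Proof.
move=> /andP[x0 xT] dv.
(* The index of the grid cell that contains [x]. *)
pose idx j := Num.truncn (x / (T / j.+1%:R)).
have idx_itv j : (idx j)%:R * (T / j.+1%:R) <= x < (idx j).+1%:R * (T / j.+1%:R).
  rewrite -ler_pdivlMr // -ltr_pdivrMr //; apply: truncn_itv.
  by rewrite divr_ge0 ?ltW.
have idx_lt j : (idx j < j.+1)%N.
  have /andP[h _] := idx_itv j; rewrite -(ltr_nat R).
  have := le_lt_trans h xT; rewrite mulrA ltr_pdivrMr // mulrC ltr_pM2l //.
pose q j : 'M[R]_(N, d) := (T / j.+1%:R)^-1 *: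
  (gamma ((idx j).+1%:R * (T / j.+1%:R)) - gamma ((idx j)%:R * (T / j.+1%:R))).
have stepq j : stepE j x = 2^-1 * mnorm m (q j) ^+ 2.
  rewrite /stepE (bigD1 (Ordinal (idx_lt j))) //= big1 ?addr0.
    rewrite indicE mem_set; last by rewrite /= in_itv /=; exact: idx_itv.
    rewrite mulr1 /q mnormZ gtr0_norm ?invr_gt0 //; congr (_ * _ ^+ 2).
    by rewrite mulrC.
  move=> k /eqP ki; rewrite indicE memNset ?mulr0 // /= in_itv /= => /andP[c1 c2].
  apply: ki; apply/val_inj => /=; apply/esym; apply: truncn_def.
  by rewrite ler_pdivlMr // ltr_pdivrMr // c1 c2.
have qv : q j @[j --> \oo] --> v.
  apply/cvgrPdist_le => e e0.
  have /choice[r hr] : forall ik : 'I_N * 'I_d, exists r : R, 0 < r /\ forall a b, a <= x -> x <= b -> a < b -> b - a < r ->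
    `|(gamma b ik.1 ik.2 - gamma a ik.1 ik.2) / (b - a) - v ik.1 ik.2| <= e.
    by move=> ik; have [r r0 hr] := straddle_quotient (dv ik.1 ik.2) e0; exists r.
  have H : \forall j \near \oo, forall ik, T / j.+1%:R < r ik.
    apply: filter_forall => ik; have [r0 _] := hr ik.
    exists (Num.truncn (T / r ik)) => // j /= lej.
    rewrite ltr_pdivrMr // mulrC -ltr_pdivrMr //.
    by apply: lt_le_trans (truncnS_gt _) _; rewrite ler_nat.
  apply: filterS H => j H; apply: norm_le_entries; first exact: ltW.
  move=> i k; have [_] := hr (i, k); have /andP[i1 i2] := idx_itv j.
  have e1 : (idx j).+1%:R * (T / j.+1%:R) - (idx j)%:R * (T / j.+1%:R) = T / j.+1%:R.
    by rewrite -mulrBl -natrB // subSnn mul1r.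
  move=> /(_ _ _ i1 (ltW i2)); rewrite e1 -subr_gt0 e1 => /(_ (h0 j) (H (i, k))) /=.
  by rewrite distrC /q !mxE mulrC.
have := mnorm_continuous_seq qv => cm.
have c : (stepE j x)%:E @[j --> \oo] --> (2^-1 * mnorm m v ^+ 2)%:E.
  apply: cvg_EFin; first by apply: nearW.
  rewrite (_ : _ \o _ = (fun j => 2^-1 * mnorm m (q j) ^+ 2)); last first.
    by apply/funext => j; rewrite /= stepq.
  apply: cvgM; first exact: cvg_cst.
  by rewrite expr2; under eq_fun do rewrite expr2; exact: cvgM.
by rewrite (cvg_limn_einf_sup c).1.
Qed.

(* Fatou's lemma is applied to the potential and, for the kinetic part, to the squared difference
   quotients over uniform grids, which converge almost everywhere to the squared speed. *)
Lemma limit_act_le : (act m Fp lambda gamma 0%R T <= B%:E)%E.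
Proof.
have h := limit_abs_continuous.
rewrite (actE m0 hF (ltW l0) (ltW T0) h) subr0.
have [rho [_ _ ae mrho kE]] := kin_density m0 T0 h.
have kle : (kin m gamma 0%R T <= limn_einf (fun j => (qsum (@cell j) (@cell' j) gamma)%:E))%E.
  pose L x := limn_einf (fun j => (stepE j x)%:E).
  have L0 x : (0 <= L x)%E.
    by rewrite /L; apply: limn_einf_ge => j; rewrite lee_fin; exact: step_ge0.
  apply: (@le_trans _ _ (\int[mu]_(x in `[0%R, T]) L x)%E); last first.
    apply: (@le_trans _ _ (limn_einf (fun j => \int[mu]_(x in `[0%R, T]) (stepE j x)%:E))%E).
      apply: fatou; [exact: measurable_itv|exact: step_measurable|].
      by move=> j x _; rewrite lee_fin; exact: step_ge0.
    by apply: limn_einf_mono => j; exact: step_integral.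
  rewrite (kE _ _ (lexx 0) (lexx T)).
  (* The comparison with [L] holds only almost everywhere. Taking the minimum with [L] keeps the
     integral and makes the comparison valid everywhere. *)
  have <- : (\int[mu]_(x in `[0%R, T]) mine (2^-1 * mnorm m (rho x) ^+ 2)%:E (L x) =
             \int[mu]_(x in `[0%R, T]) (2^-1 * mnorm m (rho x) ^+ 2)%:E)%E.
    apply: ge0_ae_eq_integral_left.
    - exact: measurable_itv.
    - exact: (measurable_funS measurableT).
    - by move=> x _; rewrite le_min L0 lee_fin mulr_ge0 ?sqr_ge0.
    - by move=> x _; rewrite lee_fin mulr_ge0 ?sqr_ge0.
    apply: lebesgue_ae_sub (lebesgue_ae_and ae (lebesgue_ae_and (ae_neq 0) (ae_neq T))).
    move=> x [hx [xn0 xnT]] /=; rewrite in_itv /= => /andP[x0 xT].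
    have x0T : 0 < x < T by rewrite !lt_neqAle x0 xT xnT eq_sym xn0.
    by apply: min_l; apply: step_cvg => //; exact: hx.
  apply: ge0_integral_mono => x _; first by rewrite le_min L0 lee_fin mulr_ge0 ?sqr_ge0.
  by rewrite ge_min lexx orbT.
have := fun j => qsum_limit (cell_family j).
have := pot_ge0 hF gamma 0 T; case: (pot Fp gamma 0 T) => [u| |] // u0 ql; last first.
  by have := ql 0%N; rewrite -?EFinD.
apply: (@le_trans _ _ ((B - lambda * T - u)%:E + u%:E + (lambda * T)%:E)%E); last first.
  by rewrite -!EFinD lee_fin; lra.
apply: leeD => //; apply: leeD => //; apply: le_trans kle _.
apply: limn_einf_le; apply: nearW => j; move: (ql j).
by rewrite -!EFinD !lee_fin; lra.
Qed.

End limit.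
End lower_semicontinuity_of_action.

(** * Bounds for Mane's potential *)

Section pair_distance.
Variables (R : realType) (d : nat).
Implicit Types v w : 'rV[R]_d.

Lemma enorm_entry v k : `|v ord0 k| <= enorm v.
Proof.
rewrite -sqrtr_sqr; apply: ler_wsqrtr; rewrite (bigD1 k) //= lerDl.
by apply: sumr_ge0 => l _; exact: sqr_ge0.
Qed.

Lemma enorm_le v e : (forall k, `|v ord0 k| <= e) -> enorm v <= Num.sqrt d%:R * `|e|.
Proof.
move=> h; rewrite -[`|e|]sqrtr_sqr -sqrtrM ?ler0n //; apply: ler_wsqrtr.
apply: (@le_trans _ _ (\sum_(k < d) e ^+ 2)).
  apply: ler_sum => k _; rewrite -[v _ _ ^+ 2](real_normK (num_real _)).
  by rewrite ler_pXn2r ?nnegrE //; exact: le_trans (h k).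
by rewrite sumr_const card_ord mulr_natl.
Qed.

Lemma enormZ c v : enorm (c *: v) = `|c| * enorm v.
Proof.
rewrite /enorm -[`|c|]sqrtr_sqr -sqrtrM ?sqr_ge0 // mulr_sumr; congr Num.sqrt.
by apply: eq_bigr => k _; rewrite mxE exprMn.
Qed.

End pair_distance.

(** * Finiteness and local bounds at collision-free configurations *)

Section noncollision_configurations.
Variables (R : realType) (N d : nat) (m : 'I_N -> R) (Fp : pair_potentials R N d).
Hypotheses (m0 : forall i, 0 < m i) (hF : condF Fp).
Implicit Types (x y z p q : 'M[R]_(N, d)).

Lemma OmegaP x : Omega x <-> forall i j : 'I_N, (i < j)%N -> exists k, x i k != x j k.
Proof.
split=> h i j ij; last first.
  by move=> /rowP e; have [k] := h i j ij; have := e k; rewrite !mxE => ->; rewrite eqxx.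
apply: contrapT => H; apply: (h i j ij); apply/rowP => k; rewrite !mxE.
by apply/eqP; apply: contrapT => e; apply: H; exists k; apply/negP.
Qed.

Lemma OmegaZ c x : c != 0 -> Omega x -> Omega (c *: x).
Proof.
move=> c0 /OmegaP h; apply/OmegaP => i j ij; have [k hk] := h i j ij; exists k.
by rewrite !mxE (inj_eq (mulfI c0)).
Qed.

Lemma segment_potential_bounded x y : (forall r, 0 <= r <= 1 -> Omega (x + r *: (y - x))) ->
  exists2 M : R, 0 <= M & forall r, 0 <= r <= 1 -> (potential Fp (x + r *: (y - x)) <= M%:E)%E.
Proof.
move=> h; pose f (r : R) := x + r *: (y - x).
have cf : {within `[0, 1], continuous f}.
  apply: continuous_subspaceT => r; apply: cvgD; first exact: cvg_cst.
  by apply: cvgZr_tmp; exact: cvg_id.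
have cK : compact (f @` `[0, 1]) by apply: continuous_compact cf _; exact: segment_compact.
have KO : f @` `[0, 1] `<=` Omega by move=> q [r /=]; rewrite in_itv /= => r01 <-; exact: h.
have [M M0 hM] := potential_compact hF cK KO.
by exists M => // r r01; apply: hM; exists r => //=; rewrite in_itv.
Qed.

Lemma mane_visible lambda x y : 0 < lambda ->
  (forall r, 0 <= r <= 1 -> Omega (x + r *: (y - x))) -> (mane m Fp lambda x y < +oo)%E.
Proof.
move=> l0 /segment_potential_bounded[M M0 hM].
exact: le_lt_trans (mane_segment m0 hF l0 ltr01 hM) (ltry _).
Qed.

(* The bodies of [z] lie on a line of slope [s], so the segment from [x] to [z] meets a collision
   only if two bodies of [x] are themselves joined by a line of slope [s]. *)
Lemma aligned_visible (s : R) (k0 k1 : 'I_d) x : k1 != k0 -> Omega x ->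
  (forall i j : 'I_N, s != (x i k1 - x j k1) / (x i k0 - x j k0)) ->
  let z := \matrix_(i < N, k < d) (i%:R * (if k == k0 then 1 else if k == k1 then s else 0)) in
  forall r, 0 <= r <= 1 -> Omega (x + r *: (z - x)).
Proof.
move=> k10 ox sx z r /andP[r0 r1]; apply/OmegaP => i j ij.
apply: contrapT => H.
have e k : x i k + r * (z i k - x i k) = x j k + r * (z j k - x j k).
  by apply/eqP; apply: contrapT => /negP h; apply: H; exists k; move: h; rewrite !mxE.
have [r_1|rn1] := eqVneq r 1.
  have := e k0; rewrite r_1 !mxE eqxx !mul1r !mulr1 => h.
  have /eqP : i%:R = j%:R :> R by lra.
  by rewrite eqr_nat => /eqP ij'; move: ij; rewrite ij' ltnn.
have [r_0|rn0] := eqVneq r 0.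
  move/OmegaP : ox => /(_ i j ij) [k]; have := e k.
  by rewrite r_0 !mul0r !addr0 => ->; rewrite eqxx.
pose c : R := r / (1 - r).
have c0 : c != 0 by rewrite mulf_neq0 // invr_eq0 subr_eq0 eq_sym.
have E k : x i k - x j k = c * (z j k - z i k).
  have h : 1 - r != 0 by rewrite subr_eq0 eq_sym.
  apply: (mulfI h); rewrite /c mulrA [_ * (r / _)]mulrC mulfVK //.
  by have := e k; lra.
have := sx i j; rewrite !E !mxE eqxx (negbTE k10) eqxx !mulr1 -!mulrBl mulrA.
have nz : c * (j%:R - i%:R) != 0.
  by rewrite mulf_neq0 // subr_eq0 eqr_nat; apply/negP => /eqP ji; move: ij; rewrite ji ltnn.
by rewrite mulrAC divff // mul1r eqxx.
Qed.

(** The dimension enters here. A line steeper than all those joining two bodies of [x] or two bodies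
    of [y] carries a configuration that both see along collision-free segments. *)
Lemma mane_Omega_fin lambda x y : (2 <= d)%N -> 0 < lambda -> Omega x -> Omega y ->
  (mane m Fp lambda x y < +oo)%E.
Proof.
move=> d2 l0 ox oy.
have d1 : (0 < d)%N by exact: leq_trans d2.
pose k0 : 'I_d := Ordinal d1; pose k1 : 'I_d := Ordinal d2.
pose slope p (i j : 'I_N) := (p i k1 - p j k1) / (p i k0 - p j k0).
(* Larger than every slope of [x] and of [y]. Bodies with equal coordinate [k0] get the slope 0 by
   division by zero, which only adds a harmless constraint on [s]. *)
pose s := 1 + \sum_i \sum_j (`|slope x i j| + `|slope y i j|).
have hs (i j : 'I_N) : `|slope x i j| + `|slope y i j| < s.
  rewrite /s (bigD1 i) //= (bigD1 j) //=; set X := \sum_(_ | _ != j) _.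
  set Y := \sum_(_ | _ != i) _.
  have X0 : 0 <= X by apply: sumr_ge0 => l _; rewrite addr_ge0.
  have Y0 : 0 <= Y by apply: sumr_ge0 => l _; apply: sumr_ge0 => l' _; rewrite addr_ge0.
  lra.
have sx i j : s != slope x i j.
  rewrite gt_eqF //; apply: le_lt_trans (hs i j); apply: le_trans (ler_norm _) _.
  by rewrite lerDl.
have sy i j : s != slope y i j.
  rewrite gt_eqF //; apply: le_lt_trans (hs i j); apply: le_trans (ler_norm _) _.
  by rewrite lerDr.
have k10 : k1 != k0 by [].
have vx := mane_visible l0 (aligned_visible k10 ox sx).
have vy := mane_visible l0 (aligned_visible k10 oy sy).
apply: le_lt_trans (mane_triangle m0 hF l0 _ _ _) _; apply: lte_add_pinfty; first exact: vx.
exact: mane_reverse vy.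
Qed.

(** Balls are convex, so segments between points near [p] stay where the potential is at most
    [M]. *)
Lemma mane_ball p : Omega p -> exists r M : R, [/\ 0 < r, 0 <= M,
  forall q, `|q - p| < r -> Omega q &
  forall lambda q q' tau, 0 < lambda -> `|q - p| < r -> `|q' - p| < r -> 0 < tau ->
   (mane m Fp lambda q q' <= (mnorm m (q' - q) ^+ 2 / (2 * tau) + (lambda + M) * tau)%:E)%E].
Proof.
move=> op; have [M] := potential_near hF op.
move=> /nbhs_ballP [r /= r0 hr].
have H q : `|q - p| < r -> Omega q /\ (potential Fp q <= M%:E)%E.
  by move=> h; apply: hr; rewrite -ball_normE /= distrC.
exists r, M; split => //.
- have [_ h] : Omega p /\ (potential Fp p <= M%:E)%E by apply: H; rewrite subrr normr0.
  by have := le_trans (potential_ge0 hF p) h; rewrite lee_fin.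
- by move=> q /H [].
move=> lambda q q' tau l0 hq hq' t0; apply: mane_segment => // s /andP[s0 s1].
apply: (H _ _).2.
have -> : q + s *: (q' - q) - p = (1 - s) *: (q - p) + s *: (q' - p).
  by apply/matrixP => i k; rewrite !mxE; ring.
apply: le_lt_trans (ler_normD _ _) _; rewrite !normrZ !ger0_norm ?subr_ge0 //.
have [->|s00] := eqVneq s 0; first by rewrite subr0 mul1r mul0r addr0.
have h1 : (1 - s) * `|q - p| <= (1 - s) * r by rewrite ler_wpM2l ?subr_ge0 // ltW.
have h2 : s * `|q' - p| < s * r by rewrite ltr_pM2l // lt_neqAle eq_sym s00.
by lra.
Qed.

End noncollision_configurations.

(** * Dyadic integrals of the growth function *)

Section growth_function.
Variables (R : realType) (f : R -> R).
Hypotheses (f0 : forall s, 0 <= f s) (cf : forall s, 0 < s -> {for s, continuous f}).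
Notation mu := (@lebesgue_measure R).

Definition dyadic_integral k : R := \int[mu]_(s in `[2 ^+ k, 2 ^+ k.+1]) f s.
Local Notation J := dyadic_integral.

Lemma growth_continuous (s t : R) : 0 < s -> {within `[s, t], continuous f}.
Proof.
move=> s0; apply: continuous_in_subspaceT => x; rewrite inE /= in_itv /= => /andP[sx _].
by apply: cf; exact: lt_le_trans sx.
Qed.

Lemma growth_measurable (s t : R) : 0 < s -> measurable_fun `[s, t] (EFin \o f).
Proof.
move=> s0; apply/measurable_EFinP; apply: subspace_continuous_measurable_fun.
  exact: measurable_itv.
exact: growth_continuous.
Qed.

Lemma dyadic_integralE k : (\int[mu]_(s in `[(2 ^+ k)%R, (2 ^+ k.+1)%R]) (f s)%:E)%E = (J k)%:E.
Proof.
rewrite /J /Rintegral fineK //; apply: integrable_fin_num; first exact: measurable_itv.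
apply: (@continuous_compact_integrable R f); first exact: segment_compact.
by apply: growth_continuous; rewrite exprn_gt0.
Qed.

Lemma dyadic_integral_ge0 k : 0 <= J k.
Proof. by rewrite -lee_fin -dyadic_integralE; apply: integral_ge0 => x _; rewrite lee_fin. Qed.

Lemma growth_integral K :
  (\int[mu]_(s in `[2%R, (2 ^+ K.+1)%R]) (f s)%:E)%E = (\sum_(1 <= k < K.+1) J k)%:E.
Proof.
elim: K => [|K ih]; first by rewrite big_nil expr1 ge0_integral_point // => x; rewrite lee_fin.
have h1 : 2 <= 2 ^+ K.+1 :> R by rewrite exprS ler_peMr // exprn_ege1 // ler1n.
have h2 : 2 ^+ K.+1 <= 2 ^+ K.+2 :> R by rewrite [leRHS]exprS ler_peMl ?ler1n // exprn_ge0.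
rewrite (ge0_integral_itv_cat h1 h2); last 2 first.
- exact: growth_measurable.
- by move=> x; rewrite lee_fin.
by rewrite [RHS]/= big_nat_recr //= EFinD -ih -dyadic_integralE.
Qed.

Lemma growth_integral_le (s t : R) K : 2 <= s -> t <= 2 ^+ K.+1 ->
  (\int[mu]_(s in `[s, t]) (f s)%:E <= (\sum_(1 <= k < K.+1) J k)%:E)%E.
Proof.
move=> s2 tK; rewrite -growth_integral; apply: ge0_subset_integral.
- exact: measurable_itv.
- exact: measurable_itv.
- exact: growth_measurable.
- by move=> x _; rewrite lee_fin.
by move=> x /=; rewrite !in_itv /= => /andP[h1 h2]; rewrite (le_trans s2 h1) (le_trans h2 tK).
Qed.

Lemma affine_continuous (a c : R) : continuous (fun r : R => (a + r) * c).
Proof.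
move=> r; apply: (@cvgM _ _ _ _ (fun r : R => a + r) (cst c)); last exact: cvg_cst.
by apply: cvgD; [exact: cvg_cst|exact: cvg_id].
Qed.

Lemma growth_ray_measurable (a c t : R) : 0 < a -> 0 < c ->
  measurable_fun `[0, t] (fun r => (f ((a + r) * c))%:E).
Proof.
move=> a0 c0; apply/measurable_EFinP; apply: subspace_continuous_measurable_fun.
  exact: measurable_itv.
apply: continuous_in_subspaceT => x; rewrite inE /= in_itv /= => /andP[x0 _].
apply: (@continuous_comp _ _ _ (fun r => (a + r) * c) f); first exact: affine_continuous.
by apply: cf; rewrite mulr_gt0 // ltr_pwDl.
Qed.

(** Substitution [s = (a + r) * c], whose Jacobian gives the factor [c^-1]. The range of [s] lies in
    [[2, 2 ^+ K.+1]], the union of the dyadic intervals that are summed. *)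
Lemma growth_ray (a c t : R) K : 0 < c -> 2 <= a * c -> 0 <= t -> (a + t) * c <= 2 ^+ K.+1 ->
  (\int[mu]_(r in `[0%R, t]) (f ((a + r) * c))%:E <= (c^-1 * \sum_(1 <= k < K.+1) J k)%:E)%E.
Proof.
move=> c0 ac t0 tK; have a0 : 0 < a.
  by rewrite -(pmulr_lgt0 _ c0); apply: lt_le_trans ac.
pose G r := (a + r) * c.
have dG (r : R) : is_derive r 1 G c.
  have -> : G = (fun y => a * c + y * c) by apply/funext => y; rewrite /G mulrDl.
  exact: is_derive_affine.
have G' : derive1 G = cst c by apply/funext => r; rewrite derive1E (@derive_val _ _ _ _ _ _ _ (dG r)).
have := growth_integral_le ac tK.
have -> : a * c = G 0 by rewrite /G addr0.
rewrite -/(G t).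
rewrite integration_by_substitution_increasing //; last 6 first.
- by move=> x y _ _ xy; rewrite /G ltr_pM2r // ltrD2l.
- by rewrite G' => x _; exact: cvg_cst.
- by rewrite G'; exact: is_cvg_cst.
- by rewrite G'; exact: is_cvg_cst.
- split; first by move=> x _; have [] := dG x.
    by apply: cvg_at_right_filter; exact: affine_continuous.
  by apply: cvg_at_left_filter; exact: affine_continuous.
- by apply: growth_continuous; rewrite /G addr0 mulr_gt0.
move=> h; rewrite EFinM.
rewrite lee_pdivlMl //.
rewrite -ge0_integralZl_EFin; last 4 first.
- exact: measurable_itv.
- by move=> x _; rewrite lee_fin.
- exact: growth_ray_measurable.
- exact: ltW.
apply: le_trans h; apply: ge0_integral_mono => x _.
  by rewrite -EFinM lee_fin mulr_ge0 // ltW.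
by rewrite -EFinM lee_fin G' /= mulrC.
Qed.

End growth_function.

(** * The cost of moving along a ray *)

Section ray_cost.
Variables (R : realType) (N d : nat) (m : 'I_N -> R) (Fp : pair_potentials R N d).
Hypotheses (m0 : forall i, 0 < m i) (hF : condF Fp).
Variable f : R -> R.
Hypotheses (f0 : forall s, 0 <= f s) (cf : forall s, 0 < s -> {for s, continuous f}).
Hypothesis hf : forall (i j : 'I_N) (p : 'rV[R]_d * 'rV[R]_d), (i < j)%N ->
  2 <= enorm (p.1 - p.2) -> Fp i j p <= f (enorm (p.1 - p.2)).
Notation mu := (@lebesgue_measure R).

(** On the ray the kinetic energy plus [lambda] is [2 * lambda], and bodies [i] and [j] are at
    distance [(a + r) * c i j], at least 2 because [2 <= a * kappa]. Hence each pair costs at most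
    an integral of [f]; the factor [(N * N)] over-counts the pairs. *)
Lemma mane_ray (lambda : R) (u : 'M[R]_(N, d)) (a t kappa L : R) K : 0 < lambda ->
  wdot m u u = 2 * lambda -> 0 < kappa ->
  (forall i j : 'I_N, (i < j)%N -> kappa <= enorm (row i u - row j u) <= L) ->
  2 <= a * kappa -> 0 < t -> (a + t) * L <= 2 ^+ K.+1 ->
  (mane m Fp lambda (a *: u) ((a + t) *: u) <=
    (2 * lambda * t + (N * N)%:R * (kappa^-1 * \sum_(1 <= k < K.+1) dyadic_integral f k))%:E)%E.
Proof.
move=> l0 uu k0 hu ak t0 tL.
have a0 : 0 < a by rewrite -(pmulr_lgt0 _ k0); apply: lt_le_trans ak.
pose S := \sum_(1 <= k < K.+1) dyadic_integral f k.
have S0 : 0 <= S by apply: sumr_ge0 => k _; exact: dyadic_integral_ge0.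
pose c (i j : 'I_N) := enorm (row i u - row j u).
pose g (i j : 'I_N) r := if (i < j)%N then f ((a + r) * c i j) else 0.
have g0 i j r : 0 <= g i j r by rewrite /g; case: ifP.
have := mane_line m0 hF l0 (a *: u) u t0.
rewrite -scalerDl => /le_trans; apply.
rewrite EFinD; apply: leeD.
  by rewrite lee_fin uu; rewrite le_eqVlt; apply/orP; left; apply/eqP; field.
apply: (@le_trans _ _ (\int[mu]_(r in `[0%R, t])
   (\sum_(i < N) \sum_(j < N) (g i j r)%:E))%E).
  apply: ge0_integral_mono => r /=; first by move=> _; exact: potential_ge0.
  rewrite in_itv /= => /andP[r0 rt].
  rewrite -scalerDl; have ar : 0 < a + r by rewrite ltr_pwDl.
  have cE i j : enorm (row i ((a + r) *: u) - row j ((a + r) *: u)) = (a + r) * c i j.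
    have -> : row i ((a + r) *: u) - row j ((a + r) *: u) = (a + r) *: (row i u - row j u).
      by apply/rowP => k; rewrite !mxE; ring.
    by rewrite enormZ gtr0_norm.
  rewrite potentialE; last first.
    apply: OmegaZ; first by rewrite gt_eqF.
    move=> i j ij e; have := hu i j ij; rewrite e subrr => /andP[+ _].
    by rewrite -(scale0r 0) enormZ normr0 mul0r leNgt k0.
  rewrite -sumEFin; apply: lee_sum => i _; rewrite big_mkcond -sumEFin; apply: lee_sum => j _.
  rewrite /g; case: ifP => // ij.
  rewrite lee_fin -cE; apply: (@hf i j (_, _) ij) => /=; rewrite cE.
  have /andP[h _] := hu i j ij; apply: le_trans ak _.
  by apply: ler_pM => //; [exact: ltW|exact: ltW|rewrite lerDl].
have cp (i j : 'I_N) : (i < j)%N -> 0 < c i j.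
  by move=> ij; have /andP[h _] := hu i j ij; exact: lt_le_trans h.
have mg i j : measurable_fun `[0, t] (fun r => (g i j r)%:E).
  rewrite /g; case: (i < j)%N (cp i j) => // /(_ isT) cij; exact: growth_ray_measurable.
rewrite ge0_integral_sum; last 3 first.
- exact: measurable_itv.
- by move=> i; apply: emeasurable_sum => j; exact: mg.
- by move=> i r _; apply: sume_ge0 => j _; rewrite lee_fin.
have -> : (N * N)%:R * (kappa^-1 * S) = \sum_(i < N) \sum_(j < N) kappa^-1 * S.
  by rewrite !sumr_const !card_ord -mulrnA mulr_natl.
rewrite -sumEFin; apply: lee_sum => i _; rewrite -sumEFin.
rewrite ge0_integral_sum; last 3 first.
- exact: measurable_itv.
- by move=> j; exact: mg.
- by move=> j r _; rewrite lee_fin.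
apply: lee_sum => j _; rewrite /g; case: (i < j)%N (cp i j) (hu i j) => [/(_ isT) cij /(_ isT) /andP[h1 h2]|_ _]; last first.
  by rewrite integral0 lee_fin mulr_ge0 // invr_ge0 ltW.
apply: (@le_trans _ _ ((c i j)^-1 * S)%:E).
  apply: growth_ray => //.
  - by apply: le_trans ak _; rewrite ler_pM2l.
  - exact: ltW.
  - by apply: le_trans tL; rewrite ler_pM2l // ltr_pwDl // ltW.
by rewrite lee_fin ler_wpM2r // lef_pV2 ?posrE.
Qed.

End ray_cost.

(** * Directions of near-minimizers *)

Section summation.
Variable R : realType.

Lemma sqrtr_le_add (a b : R) : 0 <= a -> 0 <= b -> Num.sqrt (a + b) <= Num.sqrt a + Num.sqrt b.
Proof.
move=> a0 b0; rewrite -(@ler_pXn2r _ 2) ?nnegrE ?addr_ge0 ?sqrtr_ge0 //.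
rewrite sqr_sqrtr ?addr_ge0 // sqrrD !sqr_sqrtr // addrAC lerDl.
by rewrite mulrn_wge0 // mulr_ge0 ?sqrtr_ge0.
Qed.

(** Summing the recursion bounds the partial sum [U] by [u 0 + q U + B], and [q < 1] lets [q U] be
    absorbed. *)
Lemma geometric_recursion_bound (u b : nat -> R) q B : 0 <= q -> q < 1 ->
  (forall k, 0 <= u k) -> (forall k, u k.+1 <= q * u k + b k) ->
  (forall n, \sum_(0 <= k < n) b k <= B) ->
  forall n, \sum_(0 <= k < n) u k <= (u 0%N + B) / (1 - q).
Proof.
move=> q0 q1 u0 hu hb n; rewrite ler_pdivlMr ?subr_gt0 //.
have mono : \sum_(0 <= k < n) u k <= \sum_(0 <= k < n.+1) u k.
  by rewrite [leRHS]big_nat_recr //= lerDl.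
have : \sum_(0 <= k < n.+1) u k <= u 0%N + (q * \sum_(0 <= k < n) u k + B).
  rewrite big_nat_recl //= lerD2l; apply: le_trans (lerD (lexx _) (hb n)).
  by rewrite mulr_sumr -big_split /=; apply: ler_sum => k _.
by lra.
Qed.

Lemma bounded_sum_tail (u : nat -> R) B : (forall k, 0 <= u k) ->
  (forall n, \sum_(0 <= k < n) u k <= B) ->
  forall e, 0 < e -> exists k0, forall k n, (k0 <= k)%N -> \sum_(k <= j < n) u j <= e.
Proof.
move=> u0 hB e e0; pose S := [set s | exists n, s = \sum_(0 <= k < n) u k].
have hS : has_sup S.
  split; first by exists (\sum_(0 <= k < 0) u k), 0%N.
  by exists B => _ [n ->].
have [_ [k0 ->] hk0] := sup_adherent e0 hS.
exists k0 => k n k0k; have [kn|nk] := leqP k n; last by rewrite big_geq ?ltW // ltnW.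
have := ub_le_sup hS.2 (ex_intro _ n erefl).
rewrite (@big_cat_nat _ _ _ k) //= => h1.
have : \sum_(0 <= j < k0) u j <= \sum_(0 <= j < k) u j.
  by rewrite [leRHS](@big_cat_nat _ _ _ k0) //= lerDl sumr_ge0.
by lra.
Qed.

Lemma dyadic_interval (t : R) k1 : 2 ^+ k1 <= t -> exists k, [/\ (k1 <= k)%N,
  2 ^+ k <= t & t < 2 ^+ k.+1].
Proof.
move=> h; have E : exists k, t < 2 ^+ k by exists (Num.bound t); exact: upper_nthrootP.
have [[|k] hk mk] := ex_minnP E.
  exists k1; split => //; apply: lt_le_trans hk _; apply: ler_weXn2l => //; exact: ler1n.
exists k; split => //; last by rewrite leNgt; apply/negP => /mk; rewrite ltnn.
rewrite leqNgt; apply/negP => kk1; have hk' : 2 ^+ k.+1 <= 2 ^+ k1 :> R by apply: ler_weXn2l => //; exact: ler1n.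
by have := lt_le_trans hk (le_trans hk' h); rewrite ltxx.
Qed.

End summation.

(** * Mane's potential far out along rays close to [b] *)

Section asymptotic_direction.
Variables (R : realType) (N d : nat) (m : 'I_N -> R) (Fp : pair_potentials R N d).
Hypotheses (m0 : forall i, 0 < m i) (hF : condF Fp).
Implicit Types (x y u w b : 'M[R]_(N, d)).

(** Any two bodies of [b] differ by at least [mu] in some coordinate; changing both entries by at
    most [mu / 4] leaves a difference of [mu / 2]. *)
Lemma pair_distances_near b : Omega b -> exists e kappa L : R,
  [/\ 0 < e, 0 < kappa & forall u, `|u - b| <= e -> forall i j : 'I_N, (i < j)%N ->
     kappa <= enorm (row i u - row j u) <= L].
Proof.
move=> ob; pose c (ij : 'I_N * 'I_N) := `|row ij.1 b - row ij.2 b|.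
pose mu := \big[Num.min/1]_(ij : 'I_N * 'I_N | (ij.1 < ij.2)%N) c ij.
have mu0 : 0 < mu.
  rewrite /mu; elim/big_ind: _ => //; first by move=> p q p0 q0; rewrite lt_min p0.
  by move=> [i j] /= ij; rewrite normr_gt0 subr_eq0; apply/eqP; exact: ob.
have mu_le (i j : 'I_N) : (i < j)%N -> mu <= `|row i b - row j b|.
  by move=> ij; rewrite /mu (bigminD1 (i, j)) //= ge_min lexx.
exists (mu / 4), (mu / 2), (Num.sqrt d%:R * (2 * (`|b| + mu))).
split; [by rewrite divr_gt0|by rewrite divr_gt0|move=> u ub i j ij].
apply/andP; split.
  have [k hk] : exists k, mu <= `|b i k - b j k|.
    apply: contrapT => H; have := mu_le i j ij; apply/negP; rewrite -ltNge.
    have h k : `|b i k - b j k| < mu by rewrite ltNge; apply/negP => hk; apply: H; exists k.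
    have [k0|] := pselect (exists k : 'I_d, True); last first.
      move=> nk; apply: le_lt_trans mu0; apply: norm_le_entries => // i' k.
      by case: nk; exists k.
    rewrite [ltLHS]mx_normrE; apply: bigmax_lt => // -[i' k] _ /=.
    by rewrite !mxE.
  apply: le_trans (enorm_entry _ k); rewrite !mxE.
  have := entry_le_norm (u - b) i k; have := entry_le_norm (u - b) j k; rewrite !mxE.
  move: hk; rewrite !ler_norml; case: (lerP 0 (b i k - b j k)) => h0.
    rewrite ger0_norm // => h1 /andP[h2 h3] /andP[h4 h5].
    by apply: le_trans (ler_norm _); lra.
  rewrite ltr0_norm // => h1 /andP[h2 h3] /andP[h4 h5].
  by rewrite -normrN; apply: le_trans (ler_norm _); lra.
have un : `|u| <= `|b| + mu.
  by have := ler_normD (u - b) b; rewrite subrK => h; lra.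
apply: le_trans (enorm_le (e := 2 * (`|b| + mu)) _) _ => [k|].
  rewrite !mxE; have := entry_le_norm u i k; have := entry_le_norm u j k => h1 h2.
  by apply: le_trans (ler_normB _ _) _; lra.
by rewrite ger0_norm // mulr_ge0 // addr_ge0 // ltW.
Qed.

Variable f : R -> R.
Hypotheses (f0 : forall s, 0 <= f s) (cf : forall s, 0 < s -> {for s, continuous f}).
Hypothesis hf : forall (i j : 'I_N) (p : 'rV[R]_d * 'rV[R]_d), (i < j)%N ->
  2 <= enorm (p.1 - p.2) -> Fp i j p <= f (enorm (p.1 - p.2)).
Variables (lambda : R) (x b : 'M[R]_(N, d)).
Hypotheses (d2 : (2 <= d)%N) (l0 : 0 < lambda) (tx : tOmega m Fp x) (ob : Omega b).
Notation mane := (mane m Fp lambda).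
Notation act := (act m Fp lambda).

Lemma mane_from_tOmega y : Omega y -> (mane x y < +oo)%E.
Proof.
move=> oy; have [l' [x0 [l'0 ox0 fin]]] := tx.
apply: le_lt_trans (mane_triangle m0 hF l0 _ x0 _) _; apply: lte_add_pinfty.
  exact: mane_reverse fin.
exact: mane_Omega_fin.
Qed.

(** The route is [x], [a *: b], [a *: u], [T *: u]. The first two legs cost a constant uniform in
    [u]; the last one is governed by condition (G). *)
Lemma mane_upper_bound : exists (e s0 C c : R) (p : nat),
  [/\ 0 < e, 0 <= C, 0 <= c & forall u T k, wdot m u u = 2 * lambda -> mnorm m (u - b) <= e ->
    s0 <= T -> T <= 2 ^+ k ->
    (mane x (T *: u) <=
      (2 * lambda * T + (C + c * \sum_(1 <= j < k + p) dyadic_integral f j))%:E)%E].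
Proof.
have [e1 [kappa [L [e10 k0 hu]]]] := pair_distances_near ob.
(* From [a *: u] on, all pairs are at distance at least 2. *)
have [a [a0 ak]] : exists a, 0 < a /\ a * kappa = 2.
  by exists (2 / kappa); rewrite divfK ?gt_eqF // divr_gt0.
have oab : Omega (a *: b) by apply: OmegaZ => //; rewrite gt_eqF.
have [r [M [r0 M0 _ hr]]] := mane_ball m0 hF oab.
have [cn cn0 hcn] := @norm_le_mnorm R N d m m0.
(* The first bound puts [u] where the pair distances are controlled, the second puts [a *: u] in the
   ball around [a *: b] given by [mane_ball]. *)
pose e := Num.min (e1 / cn) (r / (2 * a * cn)).
have e0 : 0 < e.
  by rewrite lt_min (divr_gt0 e10 cn0) divr_gt0 // mulr_gt0 // mulr_gt0.
have fin := mane_from_tOmega oab.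
have ff : mane x (a *: b) \is a fin_num by rewrite ge0_fin_numE // (mane_ge0 m hF l0).
pose A := fine (mane x (a *: b)); have hA : mane x (a *: b) = A%:E by rewrite /A fineK.
have A0 : 0 <= A by rewrite -lee_fin -hA; exact: mane_ge0.
pose C := A + ((a * e) ^+ 2 / 2 + (lambda + M)).
(* [a + 1 <= T] leaves a positive time for the last leg, and the shift [p] absorbs the factor [L]
   between times and distances, as [L <= 2 ^+ p]. *)
exists e, (a + 1), C, ((N * N)%:R / kappa), (Num.bound L).+1; split => //.
- by rewrite !addr_ge0 // ?divr_ge0 ?sqr_ge0 // ltW.
- by rewrite divr_ge0 // ltW.
move=> u T k uu ub aT Tk.
have ub1 : `|u - b| <= e1.
  apply: le_trans (hcn _) _; rewrite -ler_pdivlMl // mulrC.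
  by apply: le_trans ub _; rewrite ge_min lexx.
have ub2 : `|a *: u - a *: b| < r.
  rewrite -scalerBr normrZ gtr0_norm //.
  have : mnorm m (u - b) <= r / (2 * a * cn) by apply: le_trans ub _; rewrite ge_min lexx orbT.
  have ac : 0 < 2 * a * cn by rewrite mulr_gt0 // mulr_gt0.
  rewrite ler_pdivlMr // => h; have := hcn (u - b) => h'.
  have : a * `|u - b| <= a * (cn * mnorm m (u - b)) by rewrite ler_pM2l.
  by lra.
have aT' : 0 < T - a by lra.
have := mane_ray m0 hF f0 cf hf l0 uu k0 (hu u ub1) (a := a) (t := T - a) (K := (k + Num.bound L)%N).
have -> : a + (T - a) = T by ring.
move=> H.
apply: le_trans (mane_triangle m0 hF l0 _ (a *: b) _) _.
have h1 : (mane (a *: b) (T *: u) <= ((a * e) ^+ 2 / 2 + (lambda + M) +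
   (2 * lambda * (T - a) + (N * N)%:R / kappa * \sum_(1 <= j < k + (Num.bound L).+1) dyadic_integral f j))%:E)%E.
  apply: le_trans (mane_triangle m0 hF l0 _ (a *: u) _) _; rewrite EFinD; apply: leeD.
    have := hr lambda (a *: b) (a *: u) 1 l0 _ ub2 ltr01; rewrite subrr normr0 => /(_ r0).
    move=> /le_trans; apply; rewrite lee_fin !mulr1 lerD2r ler_wpM2r //.
    rewrite ler_pXn2r ?nnegrE ?mnorm_ge0 ?mulr_ge0 ?(ltW a0) ?(ltW e0) //.
    by rewrite -scalerBr mnormZ gtr0_norm // ler_pM2l.
  apply: le_trans (H _ aT' _) _.
  - by rewrite ak.
  - rewrite -addnS exprD; apply: (@le_trans _ _ (T * 2 ^+ (Num.bound L).+1)).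
      by rewrite ler_wpM2l ?ltW // ?(upper_nthrootP (leqnSn _)) //; lra.
    by rewrite ler_wpM2r // exprn_ge0.
  - by rewrite addnS mulrA.
apply: le_trans (leeD (lexx _) h1) _; rewrite hA -EFinD lee_fin.
have la := mulr_gt0 l0 a0; rewrite /C; move: (_ * \sum_(_ <= _ < _) _) ((a * e) ^+ 2 / 2) => Z Y; lra.
Qed.

End asymptotic_direction.

(** * Deviation of near-minimizers from straight motion *)

Section near_minimizers.
Variables (R : realType) (N d : nat) (m : 'I_N -> R) (Fp : pair_potentials R N d).
Hypotheses (m0 : forall i, 0 < m i) (hF : condF Fp).
Variable lambda : R.
Hypothesis l0 : 0 < lambda.
Notation mane := (mane m Fp lambda).
Notation act := (act m Fp lambda).
Notation v := (Num.sqrt (2 * lambda)).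
Implicit Types (u w b : 'M[R]_(N, d)) (gamma : R -> 'M[R]_(N, d)).

(** [eta = 0] means minimality. Finiteness of Mane's potential is included so that actions of
    subarcs are finite and can be cancelled. *)
Definition near_minimizer (eta S : R) gamma :=
  [/\ abs_continuous m 0 S gamma, (mane (gamma 0%R) (gamma S) < +oo)%E &
      (act gamma 0%R S <= mane (gamma 0%R) (gamma S) + eta%:E)%E].

(** By the triangle inequality through [gamma t], an initial arc wastes no more than the whole
    curve: the action of the final arc is finite and cancels. *)
Lemma near_minimizer_sub eta S t gamma : 0 < t -> t <= S -> near_minimizer eta S gamma ->
  near_minimizer eta t gamma.
Proof.
move=> t0; rewrite le_eqVlt => /predU1P[-> //|tS] [h fin le].
have S0 := lt_trans t0 tS.
have h1 : abs_continuous m 0 t gamma := abs_continuous_sub (lexx _) (ltW tS) h.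
have h2 : abs_continuous m t S gamma := abs_continuous_sub (ltW t0) (lexx _) h.
have cat := act_cat m0 hF l0 (ltW t0) (ltW tS) h.
have fin2 : (act gamma 0%R S < +oo)%E.
  by apply: le_lt_trans le _; rewrite lte_add_pinfty // ltry.
have a0 := act_ge0 m hF l0 gamma 0 t; have a1 := act_ge0 m hF l0 gamma t S.
have f0 : act gamma 0%R t \is a fin_num.
  by rewrite ge0_fin_numE //; apply: le_lt_trans fin2; rewrite cat leeDl.
have f1 : act gamma t S \is a fin_num.
  by rewrite ge0_fin_numE //; apply: le_lt_trans fin2; rewrite cat leeDr.
split; first exact: h1.
  apply: le_lt_trans (mane_le_act m0 hF l0 t0 h1) _.
  by rewrite -ge0_fin_numE.
move: le; rewrite cat => le.
rewrite -(leeD2rE _ _ f1); apply: le_trans le _.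
rewrite addeAC; apply: leeD; last exact: lexx.
apply: le_trans (mane_triangle m0 hF l0 _ (gamma t) _) _.
by apply: leeD; [exact: lexx|exact: mane_le_act].
Qed.

Lemma mnorm_speed u : wdot m u u = 2 * lambda -> mnorm m u = v.
Proof. by move=> uu; rewrite mnormE uu. Qed.

(** The calibration terms on [[0, t]] and [[t, S]] add up to [<u, gamma S - gamma 0>], which is
    [2 lambda T] up to [v |gamma 0|]. The remaining excess of action bounds the quadratic remainder
    on [[0, t]]. *)
Lemma near_minimizer_deviation eta S t gamma u T E : near_minimizer eta S gamma ->
  0 < t -> t <= S -> gamma S = T *: u -> wdot m u u = 2 * lambda ->
  (mane (gamma 0%R) (T *: u) <= (2 * lambda * T + E)%:E)%E ->
  mnorm m (gamma t - gamma 0 - t *: u) ^+ 2 <= 2 * t * (E + eta + v * mnorm m (gamma 0)).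
Proof.
move=> [h fin le] t0 tS gS uu hE.
have h1 : abs_continuous m 0 t gamma := abs_continuous_sub (lexx _) tS h.
have h2 : abs_continuous m t S gamma := abs_continuous_sub (ltW t0) (lexx _) h.
have := act_ge_deviation m0 hF l0 t0 h1 uu; have := act_ge_ray m0 hF l0 tS h2 uu.
move=> k2 k1; have := leeD k1 k2; rewrite -(act_cat m0 hF l0 (ltW t0) tS h).
move=> /le_trans /(_ le); rewrite gS subr0.
move=> /le_trans /(_ (leeD hE (lexx _))); rewrite -!EFinD lee_fin.
have := wdot_le m0 u (gamma 0); rewrite (mnorm_speed uu).
rewrite !(wdotDr, wdotNr, wdotZr) uu => h3 h4.
have : mnorm m (gamma t - gamma 0 - t *: u) ^+ 2 / (2 * t) <= E + eta + v * mnorm m (gamma 0).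
  by lra.
by rewrite ler_pdivrMr ?mulr_gt0 // mulrC.
Qed.

(** Radial projection to norm [v], with [T = |w| / v]. One [e] pays for the deviation of [w] from
    [t *: u], the other for the change of length; [e <= v / 2] keeps [T] within a factor 2 of
    [t]. *)
Lemma renormalize u w t e : wdot m u u = 2 * lambda -> 0 < t -> e <= v / 2 ->
  mnorm m (w - t *: u) <= t * e -> exists u' T, [/\ w = T *: u', wdot m u' u' = 2 * lambda,
    mnorm m (u' - u) <= 2 * e & t / 2 <= T <= 2 * t].
Proof.
move=> uu t0 ev hw; have v0 : 0 < v by rewrite sqrtr_gt0 mulr_gt0.
have tu : mnorm m (t *: u) = t * v by rewrite mnormZ gtr0_norm // (mnorm_speed uu).
have te : t * e <= t * (v / 2) by rewrite ler_pM2l.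
have h1 : mnorm m w <= t * v + t * e.
  have := mnorm_dist_le m0 w (t *: u) 0; rewrite !subr0 tu => h; lra.
have h2 : t * v - t * e <= mnorm m w.
  have := mnorm_dist_le m0 (t *: u) w 0; rewrite !subr0 tu (mnorm_distC _ (t *: u)) => h; lra.
have w0 : 0 < mnorm m w by have := mulr_gt0 t0 v0; lra.
pose T := mnorm m w / v; have T0 : 0 < T by rewrite divr_gt0.
have Tv : T * v = mnorm m w by rewrite divfK // gt_eqF.
exists (T^-1 *: w), T; split.
- by rewrite scalerA divff ?gt_eqF // scale1r.
- rewrite wdotZl wdotZr -(mnorm_sqr m0) -Tv.
  have -> : T^-1 * (T^-1 * (T * v) ^+ 2) = v ^+ 2 by field; rewrite gt_eqF.
  by rewrite sqr_sqrtr // mulr_ge0 // ltW.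
- apply: le_trans (mnorm_dist_le m0 _ (t^-1 *: w) _) _.
  have -> : T^-1 *: w - t^-1 *: w = (T^-1 - t^-1) *: w by rewrite scalerBl.
  have -> : t^-1 *: w - u = t^-1 *: (w - t *: u).
    by rewrite scalerBr scalerA mulVf ?gt_eqF // scale1r.
  rewrite !mnormZ (gtr0_norm (_ : 0 < t^-1)) ?invr_gt0 //.
  have k1 : t^-1 * mnorm m (w - t *: u) <= e by rewrite ler_pdivrMl.
  have k2 : `|T^-1 - t^-1| * mnorm m w <= e.
    rewrite -Tv mulrA -[X in _ * X * _](gtr0_norm T0) -normrM.
    have -> : (T^-1 - t^-1) * T = t^-1 * (t - T) by field; rewrite !gt_eqF.
    rewrite normrM (gtr0_norm (_ : 0 < t^-1)) ?invr_gt0 // -mulrA ler_pdivrMl //.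
    rewrite -[X in _ * X](gtr0_norm v0) -normrM mulrBl Tv ler_norml; apply/andP; split; lra.
  by lra.
apply/andP; split.
  by rewrite -(ler_pM2r v0) Tv; lra.
by rewrite -(ler_pM2r v0) Tv; have := mulr_gt0 t0 v0; lra.
Qed.

Section direction.
Variables (f : R -> R) (x b : 'M[R]_(N, d)) (B : R).
Hypotheses (f0 : forall s, 0 <= f s) (cf : forall s, 0 < s -> {for s, continuous f}).
Hypothesis hf : forall (i j : 'I_N) (p : 'rV[R]_d * 'rV[R]_d), (i < j)%N ->
  2 <= enorm (p.1 - p.2) -> Fp i j p <= f (enorm (p.1 - p.2)).
Hypothesis hB : forall n, \sum_(1 <= k < n) Num.sqrt (2 ^- k * dyadic_integral f k) <= B.
Hypotheses (d2 : (2 <= d)%N) (tx : tOmega m Fp x) (ob : Omega b) (bb : wdot m b b = 2 * lambda).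

(* [delta k = |x| / 2^k + sqrt (2 E_k / 2^k)], where [2 lambda T + E_k] bounds Mane's potential at
   scale [2^k]; as [E_k] grows by a dyadic integral of [f], [delta] obeys a contracting recursion
   of ratio [1 / sqrt 2] driven by the summable terms of condition (G). *)
Lemma deviation_rate : exists (e0 s0 : R) (delta : nat -> R) (B' : R),
  [/\ 0 < e0, forall k, 0 <= delta k, forall n, \sum_(0 <= k < n) delta k <= B' &
   forall S t t' gamma u T k, near_minimizer 1 S gamma -> gamma 0 = x -> gamma S = T *: u ->
     wdot m u u = 2 * lambda -> mnorm m (u - b) <= e0 -> s0 <= T -> T <= 2 ^+ k.+2 ->
     0 < t -> t <= S -> t <= t' -> 2 ^+ k <= t' -> mnorm m (gamma t - t *: u) <= t' * delta k].
Proof.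
have [e0 [s0 [C [c [p [e00 C0 c0 hU]]]]]] := mane_upper_bound m0 hF f0 cf hf d2 l0 tx ob.
(* The summand 1 is the error of the near-minimizers, and [k.+2] is the scale of [T]: at scale [k]
   the end point may have a parameter up to [2 ^+ k.+2]. *)
pose E k := C + c * (\sum_(1 <= j < k.+2 + p) dyadic_integral f j) + 1 + v * mnorm m x.
have J0 := dyadic_integral_ge0 f0 cf.
have E0 k : 0 <= E k.
  have h : 0 <= \sum_(1 <= j < k.+2 + p) dyadic_integral f j by apply: sumr_ge0 => j _; exact: J0.
  by rewrite /E !addr_ge0 // ?mulr_ge0 ?sqrtr_ge0 ?mnorm_ge0.
pose D k := Num.sqrt (2 * E k / 2 ^+ k).
pose delta k := mnorm m x / 2 ^+ k + D k.
have delta0 k : 0 <= delta k.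
  by rewrite addr_ge0 ?sqrtr_ge0 // divr_ge0 ?mnorm_ge0 // exprn_ge0.
(* The ratio of successive [D k] if [E] were constant; the term in [|x|] is halved, hence decays
   faster. *)
pose q : R := Num.sqrt (2^-1).
have q2 : q ^+ 2 = 2^-1 by rewrite sqr_sqrtr // invr_ge0.
have q0 : 0 <= q by exact: sqrtr_ge0.
have q1 : q < 1 by nra.
have qh : 2^-1 <= q by nra.
pose r k := Num.sqrt (2 ^- k * dyadic_integral f k).
(* The increment of [E] is a dyadic integral of index [k.+2 + p]; weighting it by the power of 2 of
   its own index leaves the factor [2 ^+ (2 + p)]. *)
pose c' := Num.sqrt (c * 2 ^+ (2 + p)).
have rec k : delta k.+1 <= q * delta k + c' * r (k.+2 + p)%N.
  rewrite /delta mulrDr -addrA; apply: lerD.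
    have -> : mnorm m x / 2 ^+ k.+1 = 2^-1 * (mnorm m x / 2 ^+ k) by rewrite exprS invfM mulrCA.
    by rewrite ler_wpM2r // divr_ge0 ?mnorm_ge0 // exprn_ge0.
  have ES : E k.+1 = E k + c * dyadic_integral f (k.+2 + p)%N.
    by rewrite /E addSn big_nat_recr //=; ring.
  rewrite {1}/D; have -> : 2 * E k.+1 / 2 ^+ k.+1 = 2^-1 * (2 * E k / 2 ^+ k) +
      c * 2 ^+ (2 + p) * (2 ^- (k.+2 + p) * dyadic_integral f (k.+2 + p)%N).
    rewrite ES; move: (dyadic_integral _ _) (E k) => X Y.
    rewrite (exprD _ k.+2 p) (exprD _ 2 p) !exprS expr0.
    have A0 : 2 ^+ k != 0 :> R by rewrite expf_neq0.
    have B0 : 2 ^+ p != 0 :> R by rewrite expf_neq0.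
    move: (2 ^+ k) A0 (2 ^+ p) B0 => P P0 Q Q0.
    by field; rewrite ?P0 ?Q0.
  have a1 : 0 <= 2 * E k / 2 ^+ k by rewrite divr_ge0 ?mulr_ge0 // exprn_ge0.
  have a2 : 0 <= 2 ^- (k.+2 + p) * dyadic_integral f (k.+2 + p)%N.
    by rewrite mulr_ge0 // invr_ge0 exprn_ge0.
  have a3 : 0 <= c * 2 ^+ (2 + p) by rewrite mulr_ge0 // exprn_ge0.
  apply: le_trans (sqrtr_le_add _ _) _; first by rewrite mulr_ge0.
    by rewrite mulr_ge0 // invr_ge0 exprn_ge0.
  by rewrite (@sqrtrM _ _ (2 * E k / 2 ^+ k)) ?invr_ge0 // (@sqrtrM _ _ (2 ^- _ * _)).
have hb n : \sum_(0 <= k < n) c' * r (k.+2 + p)%N <= c' * B.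
  rewrite -mulr_sumr ler_wpM2l ?sqrtr_ge0 //.
  apply: le_trans (hB (n + p.+2)); rewrite [leRHS](@big_cat_nat _ _ _ p.+2) //= ?leq_addl //.
  rewrite -[leLHS]add0r; apply: lerD.
    by apply: sumr_ge0 => k _; exact: sqrtr_ge0.
  rewrite (@big_addn _ _ _ 0 _ p.+2) addnK; apply: ler_sum => k _.
  by rewrite addSnnS addSnnS.
exists e0, s0, delta, ((delta 0%N + c' * B) / (1 - q)); split => //.
  exact: (geometric_recursion_bound q0 q1 delta0 rec hb).
(* A separate [t'] admits times [t] below [2 ^+ k], which is what excludes an early arrival later
   on. *)
move=> S t t' gamma u T k ng g0 gS uu ub sT Tk t0 tS tt' kt'.
have t'0 := lt_le_trans t0 tt'.
have := hU u T k.+2 uu ub sT Tk; rewrite -{1}g0 => hE.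
have := near_minimizer_deviation ng t0 tS gS uu hE; rewrite g0 -/(E k) => dev.
have h1 : mnorm m (gamma t - x - t *: u) <= Num.sqrt (2 * t' * E k).
  rewrite -[leLHS]ger0_norm ?mnorm_ge0 // -sqrtr_sqr ler_wsqrtr //.
  by apply: le_trans dev _; rewrite ler_wpM2r // ler_pM2l.
have h2 : mnorm m (gamma t - t *: u) <= mnorm m x + Num.sqrt (2 * t' * E k).
  have -> : gamma t - t *: u = x + (gamma t - x - t *: u).
    by apply/matrixP => i l; rewrite !mxE; ring.
  by apply: le_trans (mnormD m0 _ _) _; rewrite lerD2l.
have tk1 : 1 <= t' / 2 ^+ k by rewrite ler_pdivlMr ?exprn_gt0 // mul1r.
apply: le_trans h2 _; rewrite [leRHS]mulrDr; apply: lerD.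
  by rewrite mulrCA -[leLHS]mulr1 ler_wpM2l ?mnorm_ge0.
have -> : t' * D k = Num.sqrt (2 * t' * E k * (t' / 2 ^+ k)).
  rewrite -{1}(gtr0_norm t'0) -sqrtr_sqr -sqrtrM ?sqr_ge0 //; congr Num.sqrt.
  by field; rewrite expf_neq0.
apply: ler_wsqrtr; rewrite -[leLHS]mulr1 ler_wpM2l //.
by rewrite mulr_ge0 // mulr_ge0 // ltW.
Qed.

(* Downward induction on [k]: the directions [u_k] of [gamma (2^k)] satisfy
   [|u_k - u_(k+1)| <= 2 delta_k]. *)
Lemma near_minimizer_direction (e : R) : 0 < e -> exists k1 : nat, forall n S gamma, (k1 <= n)%N ->
  0 < S -> near_minimizer 1 S gamma -> gamma 0 = x -> gamma S = 2 ^+ n.+1 *: b ->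
  2 ^+ n <= S /\ forall t, 2 ^+ k1 <= t -> t <= 2 ^+ n -> mnorm m (gamma t - t *: b) <= t * e.
Proof.
move=> e_gt0; have v0 : 0 < v by rewrite sqrtr_gt0 mulr_gt0.
have [e0 [s0 [delta [B' [e00 delta0 hB' hdev]]]]] := deviation_rate.
pose e1 := Num.min (Num.min e0 (v / 2)) e / 2.
have e10 : 0 < e1 by rewrite divr_gt0 // !lt_min e00 e_gt0 divr_gt0.
have e1e0 : 2 * e1 <= e0 by rewrite mulrC divfK // !ge_min lexx.
have e1v : 2 * e1 <= v / 2 by rewrite mulrC divfK // !ge_min lexx orbT.
have e1e : 2 * e1 <= e by rewrite mulrC divfK // !ge_min lexx !orbT.
have [k0 hk0] := bounded_sum_tail delta0 hB' e10.
pose k1 := maxn k0 (Num.bound s0).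
have sk k : (k1 <= k)%N -> s0 <= 2 ^+ k.
  by rewrite geq_max => /andP[_ h]; apply: ltW; exact: upper_nthrootP.
have tail k n : (k1 <= k)%N -> \sum_(k <= j < n) delta j <= e1.
  by rewrite geq_max => /andP[h _]; exact: hk0.
have dk k : (k1 <= k)%N -> delta k <= e1.
  by move=> h; have := tail k k.+1 h; rewrite big_nat1.
have pow0 k : 0 < 2 ^+ k :> R by exact: exprn_gt0.
exists k1 => n S gamma k1n S0 ng g0 gS.
(* At a time [S < 2 ^+ n] the end point [2 ^+ n.+1 *: b] would be at distance at least [2 ^+ n * v]
   from [S *: b], while the deviation is at most a quarter of that. *)
have nS : 2 ^+ n <= S.
  rewrite leNgt; apply/negP => Sn.
  have := hdev S S (2 ^+ n) gamma b (2 ^+ n.+1) n ng g0 gS bb.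
  rewrite subrr mnorm0 => /(_ (ltW e00) _ _ S0 (lexx _) (ltW Sn) (lexx _)).
  rewrite (le_trans (sk n k1n)) ?ler_weXn2l ?ler1n // => /(_ isT isT).
  rewrite gS -scalerBl mnormZ (mnorm_speed bb) ger0_norm; last first.
    by rewrite subr_ge0 ltW // (lt_le_trans Sn) // ler_weXn2l ?ler1n.
  have h1 : 2 ^+ n * delta n <= 2 ^+ n * (v / 4).
    by rewrite ler_pM2l //; apply: le_trans (dk n k1n) _; lra.
  have h2 : 2 ^+ n * v <= (2 ^+ n.+1 - S) * v by rewrite ler_pM2r // exprS; lra.
  have h3 := mulr_gt0 (pow0 n) v0; lra.
split=> //.
(* The time at which the direction of scale [k] is read off. At the last scale this is the arrival
   time [S], where the direction is exactly [b]; there the downward induction starts. *)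
pose s k : R := if (k < n)%N then 2 ^+ k.+1 else S.
have s_ge k : (k <= n)%N -> 2 ^+ k <= s k /\ s k <= S.
  rewrite leq_eqVlt => /predU1P[->|kn]; first by rewrite /s ltnn.
  rewrite /s kn; split; first by rewrite ler_weXn2l ?ler1n.
  by apply: le_trans nS; rewrite ler_weXn2l ?ler1n.
have I j : forall k, (k1 <= k)%N -> (k + j = n)%N -> exists u T,
    [/\ gamma (s k) = T *: u, wdot m u u = 2 * lambda,
        mnorm m (u - b) <= 2 * \sum_(k.+1 <= i < n.+1) delta i & 2 ^+ k <= T <= 2 ^+ k.+2].
  elim: j => [k k1k|j ih k k1k kj].
    rewrite addn0 => ->; exists b, (2 ^+ n.+1); rewrite /s ltnn; split => //.
      by rewrite subrr mnorm0 // mulr_ge0 // sumr_ge0.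
    by rewrite !ler_weXn2l ?ler1n.
  have kn : (k < n)%N by rewrite -kj -addSnnS leq_addr.
  have [|//|u [T [gu uu ub /andP[T1 T2]]]] := ih k.+1; first exact: leqW.
    by rewrite addSnnS.
  have [s1 s2] := s_ge _ kn.
  have ng' : near_minimizer 1 (s k.+1) gamma.
    by apply: near_minimizer_sub ng => //; exact: lt_le_trans s1.
  have ub' : mnorm m (u - b) <= e0.
    apply: le_trans ub _; apply: le_trans e1e0; rewrite ler_pM2l //.
    by apply: tail; rewrite ltnW // ltnW.
  have := hdev _ (2 ^+ k.+1) _ _ _ _ _ ng' g0 gu uu ub' (le_trans (sk _ (leqW k1k)) T1) T2
     (pow0 _) s1 (lexx _) (lexx _).
  have dv : delta k.+1 <= v / 2 by apply: le_trans (dk _ (leqW k1k)) _; lra.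
  move=> /(renormalize uu (pow0 _) dv) [u' [T' [gu' uu' u'u /andP[T3 T4]]]].
  exists u', T'; rewrite /s kn; split => //.
    apply: le_trans (mnorm_dist_le m0 _ u _) _.
    rewrite (@big_cat_nat _ _ _ k.+2) //= big_nat1 mulrDr.
    by apply: lerD.
  move: T3 T4; rewrite !exprS => T3 T4; apply/andP; split; lra.
move=> t tk1 tn; have t0 := lt_le_trans (pow0 _) tk1.
have [k [k1k kt tk]] := dyadic_interval tk1.
have kn : (k <= n)%N.
  by rewrite -(@ler_eXn2l R 2) ?ltr1n //; exact: le_trans tn.
have [|u [T [gu uu ub /andP[T1 T2]]]] := I (n - k)%N k k1k; first by rewrite subnKC.
have [s1 s2] := s_ge _ kn.
have ts : t <= s k.
  rewrite /s; case: ifP => _; first exact: ltW.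
  exact: le_trans tn nS.
have ng' : near_minimizer 1 (s k) gamma.
  by apply: near_minimizer_sub ng => //; exact: lt_le_trans s1.
have ub' : mnorm m (u - b) <= e0.
  apply: le_trans ub _; apply: le_trans e1e0; rewrite ler_pM2l //.
  by apply: tail; rewrite ltnW.
have := hdev _ t t _ _ _ _ ng' g0 gu uu ub' (le_trans (sk _ k1k) T1) T2 t0 ts (lexx _) kt => dev.
apply: le_trans (mnorm_dist_le m0 _ (t *: u) _) _.
have h1 : mnorm m (t *: u - t *: b) <= t * (2 * \sum_(k.+1 <= i < n.+1) delta i).
  by rewrite -scalerBr mnormZ gtr0_norm // ler_pM2l.
have h2 : delta k + 2 * \sum_(k.+1 <= i < n.+1) delta i <= e.
  have := tail k n.+1 k1k; rewrite (@big_cat_nat _ _ _ k.+1) //= big_nat1 => h.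
  by have := delta0 k; lra.
by apply: le_trans (lerD dev h1) _; rewrite -mulrDr ler_pM2l.
Qed.

End direction.
End near_minimizers.

(** * Limits of near-minimizers *)

Section diagonal_extraction.
Variables (R : realType) (N d : nat).
Implicit Types (g : nat -> R -> 'M[R]_(N, d)).

Lemma ultrafilter_limit (U : set_system nat) (u : nat -> R) (K : R) : UltraFilter U ->
  U [set n | `|u n| <= K] -> exists l : R, forall e : R, 0 < e -> U [set n | `|u n - l| < e].
Proof.
move=> UU UK; have PU : ProperFilter (u @ U) by apply: fmap_proper_filter.
have UK' : U (u @^-1` `[- K, K]%classic).
  by apply: filterS UK => n h; rewrite /preimage /= in_itv /= -ler_norml; exact: h.
have [l [_ cl]] := @segment_compact R (- K) K _ PU UK'.
exists l => e e0; have [//|UC] := in_ultra_setVsetC [set n | `|u n - l| < e] UU.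
have [y [hy1 hy2]] : [set y | ~ (`|y - l| < e)] `&` ball l e !=set0.
  by apply: cl; [exact: UC|exact: nbhsx_ballx].
by case: hy1; rewrite distrC; move: hy2; rewrite -ball_normE.
Qed.

(* The limit along an ultrafilter defines the curve; a sequence converging to it is then chosen
   with the [j]-th term close on all fractions with numerator and denominator up to [j]. *)
Lemma equicontinuous_extraction g : (forall T : R, 0 <= T -> exists (H : R) n0, 0 <= H /\
    forall n s t, (n0 <= n)%N -> 0 <= s -> s <= t -> t <= T ->
      `|g n t - g n s| ^+ 2 <= H * (t - s)) ->
  (exists K : R, forall n, `|g n 0| <= K) ->
  exists (phi : nat -> nat) (gamma : R -> 'M[R]_(N, d)), (forall j, (j <= phi j)%N) /\
    forall t, 0 <= t -> g (phi j) t @[j --> \oo] --> gamma t.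
Proof.
move=> hH [K hK]; have [U [UU oU]] := @ultraFilterLemma nat \oo _.
have PU : ProperFilter U by exact: ultra_proper.
have large n : U [set k | (n <= k)%N] by apply: oU; exists n.
have /choice[L hL] : forall p : R * ('I_N * 'I_d), exists l, 0 <= p.1 -> forall e : R, 0 < e ->
    U [set n | `|g n p.1 p.2.1 p.2.2 - l| < e].
  move=> [t [i k]] /=.
  have [t0|] := boolP (0 <= t); last by exists 0.
  have [H [n0 [H0 hn]]] := hH t t0.
  have [l hl] : exists l : R, forall e : R, 0 < e -> U [set n | `|g n t i k - l| < e].
    apply: (@ultrafilter_limit U _ (K + (H * t + 1))) => //.
    apply: filterS (large n0) => n /= nn0; apply: le_trans (entry_le_norm _ i k) _.
    have := hn n 0 t nn0 (lexx _) t0 (lexx _); rewrite subr0 => h.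
    have := ler_normD (g n 0) (g n t - g n 0); rewrite addrC subrK => h'.
    by have := hK n; have := normr_ge0 (g n t - g n 0); nra.
  by exists l.
pose gamma (t : R) : 'M[R]_(N, d) := \matrix_(i, k) L (t, (i, k)).
have gammaU (t e : R) : 0 <= t -> 0 < e -> U [set n | `|g n t - gamma t| <= e].
  move=> t0 e0.
  have H : U [set n | forall ik : 'I_N * 'I_d, `|g n t ik.1 ik.2 - L (t, ik)| < e].
    apply: filter_forall => -[i k] /=.
    exact: (hL (t, (i, k))).
  apply: filterS H => n /= H; apply: norm_le_entries; first exact: ltW.
  by move=> i k; have := H (i, k); rewrite !mxE => /ltW.
pose grid (ab : nat * nat) : R := ab.1%:R / ab.2.+1%:R.
have grid0 ab : 0 <= grid ab by rewrite divr_ge0.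
have /choice[phi hphi] j : exists n, (j <= n)%N /\ forall ab : 'I_j.+1 * 'I_j.+1,
    `|g n (grid (val ab.1, val ab.2)) - gamma (grid (val ab.1, val ab.2))| <= j.+1%:R^-1.
  have H : U [set n | forall ab : 'I_j.+1 * 'I_j.+1,
      `|g n (grid (val ab.1, val ab.2)) - gamma (grid (val ab.1, val ab.2))| <= j.+1%:R^-1].
    by apply: filter_forall => ab; apply: gammaU => //; rewrite invr_gt0.
  by have [n [h1 h2]] := filter_ex (filterI (large j) H); exists n.
exists phi, gamma; split; first by move=> j; have [] := hphi j.
move=> t t0; apply/cvgrPdist_le => e e0.
have [H [n0 [H0 hn]]] := hH (t + 1) (addr_ge0 t0 ler01).
(* Three parts for the oscillation of [gamma] between [t] and [q], one for the error at the fraction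
   [q], one for the oscillation of the sequence. *)
have [e' [e'0 E]] : exists e', 0 < e' /\ e = 5 * e'.
  by exists (e / 5); rewrite divr_gt0 // mulrC divfK.
(* The denominator makes the Hoelder bound over one grid step at most [e']; [a] is the numerator of
   the largest such fraction below [t]. *)
pose b := Num.truncn ((H + 1) / e' ^+ 2 + 1); pose a := Num.truncn (t * b.+1%:R).
have b_gt : (H + 1) / e' ^+ 2 + 1 < b.+1%:R by exact: truncnS_gt.
have be : H * b.+1%:R^-1 <= e' ^+ 2.
  rewrite ler_pdivrMr // mulrC -ler_pdivrMr ?exprn_gt0 //.
  apply: le_trans (ltW b_gt); rewrite ler_wpDr // ler_wpM2r ?lerDl //.
  by rewrite invr_ge0 sqr_ge0.
have b1 : b.+1%:R^-1 <= 1 :> R by rewrite invf_le1 ?ler1n.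
have /andP[at1 at2] : a%:R <= t * b.+1%:R < a.+1%:R by apply: truncn_itv; rewrite mulr_ge0.
pose q := grid (a, b).
have qt : q <= t by rewrite ler_pdivrMr.
have tq : t - q <= b.+1%:R^-1.
  have B0 : b.+1%:R != 0 :> R by rewrite pnatr_eq0.
  rewrite /q /grid /= -[X in X - _ <= _](mulfK B0) -mulrBl ler_pdivrMr // mulVf //.
  by move: at2; rewrite -natr1; lra.
have osc n : (n0 <= n)%N -> `|g n t - g n q| <= e'.
  move=> nn0; rewrite -(@ler_pXn2r _ 2) ?nnegrE // ?(ltW e'0) //.
  apply: le_trans (hn n q t nn0 (grid0 _) qt _) _; first by rewrite lerDl.
  by apply: le_trans be; rewrite ler_wpM2l.
(* A single index [n], good at both [t] and [q], transfers the modulus of [g n] to the ultrafilter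
   limit. *)
have oscg : `|gamma t - gamma q| <= 3 * e'.
  have [n [/= h1 [/= h2 h3]]] := filter_ex (filterI (large n0)
     (filterI (gammaU t e' t0 e'0) (gammaU q e' (grid0 _) e'0))).
  have -> : gamma t - gamma q = (g n t - g n q) - (g n t - gamma t) + (g n q - gamma q).
    by apply/matrixP => i k; rewrite !mxE; ring.
  apply: le_trans (ler_normD _ _) _.
  have := ler_normB (g n t - g n q) (g n t - gamma t); have := osc n h1; lra.
exists (maxn (maxn n0 (maxn a b)) (Num.truncn (e'^-1))) => // j /=.
rewrite !geq_max => /andP[/andP[nj /andP[aj bj]] ej].
have [jphi hq] := hphi j.
have := hq (@Ordinal j.+1 a aj, @Ordinal j.+1 b bj); rewrite /= -/q => h1.
have h2 : j.+1%:R^-1 <= e'.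
  rewrite -[e']invrK lef_pV2 ?posrE ?invr_gt0 //; apply: le_trans (ltW (truncnS_gt _)) _.
  by rewrite ler_nat.
have h3 := osc (phi j) (leq_trans nj jphi).
have -> : gamma t - g (phi j) t = (gamma t - gamma q) - (g (phi j) q - gamma q) - (g (phi j) t - g (phi j) q).
  by apply/matrixP => i k; rewrite !mxE; ring.
apply: le_trans (ler_normB _ _) _.
have := ler_normB (gamma t - gamma q) (g (phi j) q - gamma q).
have h4 := le_trans h1 h2; lra.
Qed.

End diagonal_extraction.

(** [f] is replaced by its absolute value, which agrees with it on positive reals and is nonnegative
    on the whole line. *)
Lemma condG_growth (R : realType) (N d : nat) (Fp : pair_potentials R N d) : condG Fp ->
  exists (f : R -> R) (B : R), [/\ forall s, 0 <= f s,
    forall s, 0 < s -> {for s, continuous f},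
    forall (i j : 'I_N) (p : 'rV[R]_d * 'rV[R]_d), (i < j)%N ->
      2 <= enorm (p.1 - p.2) -> Fp i j p <= f (enorm (p.1 - p.2)) &
    forall n, \sum_(1 <= k < n) Num.sqrt (2 ^- k * dyadic_integral f k) <= B].
Proof.
move=> [f [cf f0 fin hf]].
have J k : dyadic_integral (fun s => `|f s|) k =
    \int[@lebesgue_measure R]_(s in `[2 ^+ k, 2 ^+ k.+1]) f s.
  apply: eq_Rintegral => s; rewrite inE /= in_itv /= => /andP[ks _].
  by rewrite gtr0_norm // f0 // (lt_le_trans _ ks) // exprn_gt0.
pose u k : R := Num.sqrt (2 ^- k * dyadic_integral (fun s => `|f s|) k).
exists (fun s => `|f s|), (fine (\sum_(1 <= k <oo) (u k)%:E)%E); split.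
- by move=> s.
- move=> s s0; have := cf; rewrite continuous_open_subspace; last exact: interval_open.
  move=> /(_ s); rewrite inE /= in_itv /= s0 => /(_ isT) cs.
  exact: (@continuous_comp _ _ _ f (fun y : R => `|y|) s cs (@norm_continuous _ _ _)).
- by move=> i j p ij h; apply: le_trans (hf i j p ij h) (ler_norm _).
move=> n; have u0 k : (0 <= (u k)%:E)%E by rewrite lee_fin sqrtr_ge0.
have E : (\sum_(1 <= k <oo) (u k)%:E < +oo)%E.
  apply: le_lt_trans fin; apply: lee_nneseries => k; first by [].
  by move=> _; rewrite /u J.
rewrite -lee_fin fineK; last by rewrite ge0_fin_numE //; apply: nneseries_ge0.
rewrite -sumEFin; exact: nneseries_lim_ge.
Qed.

(** * Construction of the minimizing ray *)

Section ray.
Variables (R : realType) (N d : nat) (m : 'I_N -> R) (Fp : pair_potentials R N d).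
Hypotheses (m0 : forall i, 0 < m i) (hF : condF Fp).
Variable lambda : R.
Hypothesis l0 : 0 < lambda.
Notation mane := (mane m Fp lambda).
Notation act := (act m Fp lambda).
Notation v := (Num.sqrt (2 * lambda)).
Notation near_minimizer := (near_minimizer m Fp lambda).
Implicit Types (u w : 'M[R]_(N, d)) (gamma : R -> 'M[R]_(N, d)).

Lemma act_sub gamma (s t T : R) : 0 <= s -> s <= t -> t <= T -> abs_continuous m 0 T gamma ->
  (act gamma s t <= act gamma 0%R T)%E.
Proof.
move=> s0 st tT h.
rewrite (act_cat m0 hF l0 (le_trans s0 st) tT h).
rewrite (act_cat m0 hF l0 s0 st (abs_continuous_sub (lexx _) tT h)).
apply: (@le_trans _ _ (act gamma 0%R s + act gamma s t)%E).
  by rewrite leeDr //; exact: act_ge0.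
by rewrite leeDl //; exact: act_ge0.
Qed.

Lemma act_holder gamma (s t T A : R) : 0 <= s -> s <= t -> t <= T -> abs_continuous m 0 T gamma ->
  (act gamma 0%R T <= A%:E)%E -> mnorm m (gamma t - gamma s) ^+ 2 <= 2 * A * (t - s).
Proof.
move=> s0; rewrite le_eqVlt => /predU1P[-> tT _ _|st tT h hA].
  by rewrite !subrr mnorm0 expr0n mulr0.
have hst : abs_continuous m s t gamma := abs_continuous_sub s0 tT h.
have := le_trans (kin_ge_sqr m0 (ltW st) hst) (act_ge_kin m0 hF l0 (ltW st) hst).
move=> /le_trans /(_ (le_trans (act_sub s0 (ltW st) tT h) hA)); rewrite lee_fin.
have ts : 0 < t - s by rewrite subr_gt0.
by rewrite ler_pdivrMr ?mulr_gt0 // mulrA [A * 2]mulrC.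
Qed.

Variables (f : R -> R) (x b : 'M[R]_(N, d)) (B : R).
Hypotheses (f0 : forall s, 0 <= f s) (cf : forall s, 0 < s -> {for s, continuous f}).
Hypothesis hf : forall (i j : 'I_N) (p : 'rV[R]_d * 'rV[R]_d), (i < j)%N ->
  2 <= enorm (p.1 - p.2) -> Fp i j p <= f (enorm (p.1 - p.2)).
Hypothesis hB : forall n, \sum_(1 <= k < n) Num.sqrt (2 ^- k * dyadic_integral f k) <= B.
Hypotheses (d2 : (2 <= d)%N) (tx : tOmega m Fp x) (ob : Omega b) (bb : wdot m b b = 2 * lambda).

(** At time [T] a near-minimizer is close to [T *: b], so the upper bound on Mane's potential
    applies to its position, uniformly in [n]; being near-minimizing up to [T], it has bounded
    action there. *)
Lemma near_minimizer_action : exists k2 : nat, forall T : R, 2 ^+ k2 <= T -> exists (A : R) (n0 : nat),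
  0 <= A /\ forall n S gamma, (n0 <= n)%N -> 0 < S -> near_minimizer 1 S gamma -> gamma 0 = x ->
    gamma S = 2 ^+ n.+1 *: b -> T <= S /\ (act gamma 0%R T <= A%:E)%E.
Proof.
have v0 : 0 < v by rewrite sqrtr_gt0 mulr_gt0.
have [e0 [s0 [C [c [p [e00 C0 c0 hU]]]]]] := mane_upper_bound m0 hF f0 cf hf d2 l0 tx ob.
pose e := Num.min (v / 2) (e0 / 2).
have e_gt0 : 0 < e by rewrite lt_min !divr_gt0.
have ev : e <= v / 2 by rewrite ge_min lexx.
have ee : 2 * e <= e0 by rewrite mulrC -ler_pdivlMr // ge_min lexx orbT.
have [k1 hk1] := near_minimizer_direction m0 hF l0 f0 cf hf hB d2 tx ob bb e_gt0.
(* Renormalizing may halve the time, so [T] must be at least [2 * s0]. *)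
exists (maxn k1 (Num.bound (2 * s0))) => T hT.
have hk T' k : (Num.bound T' <= k)%N -> T' <= 2 ^+ k :> R by move=> h; apply: ltW; exact: upper_nthrootP.
have T1 : 2 ^+ k1 <= T by apply: le_trans hT; rewrite ler_weXn2l ?ler1n // leq_maxl.
have T2 : s0 <= T / 2.
  by rewrite ler_pdivlMr // mulrC; apply: le_trans hT; apply: hk; rewrite leq_maxr.
have T0 : 0 < T by apply: lt_le_trans T1; exact: exprn_gt0.
pose K := Num.bound (2 * T).
pose A := 2 * lambda * (2 * T) + (C + c * \sum_(1 <= j < K + p) dyadic_integral f j) + 1.
have S0 : 0 <= \sum_(1 <= j < K + p) dyadic_integral f j.
  by apply: sumr_ge0 => j _; exact: dyadic_integral_ge0.
exists A, (maxn k1 K); split.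
  by rewrite /A !addr_ge0 // ?mulr_ge0 // ltW.
move=> n S gamma; rewrite geq_max => /andP[k1n Kn] S_gt0 ng g0 gS.
have [nS dev] := hk1 n S gamma k1n S_gt0 ng g0 gS.
have Tn : T <= 2 ^+ n by apply: le_trans (hk _ _ Kn); lra.
have TS := le_trans Tn nS; split=> //.
have [u [T' [gT uu ub /andP[h1 h2]]]] := renormalize m0 l0 bb T0 ev (dev T T1 Tn).
have [_ _] := near_minimizer_sub m0 hF l0 T0 TS ng.
move=> /le_trans; apply.
have := hU u T' K uu (le_trans ub ee) (le_trans T2 h1) (le_trans h2 (hk _ _ (leqnn _))).
rewrite -gT g0 => /(leeD) /(_ (lexx 1%:E)) /le_trans; apply.
rewrite -EFinD lee_fin /A lerD2r lerD2r.
by rewrite ler_pM2l // mulr_gt0.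
Qed.

Lemma minimizing_ray : exists gamma : R -> 'M[R]_(N, d),
  [/\ gamma 0 = x, forall T, 0 < T -> near_minimizer 0 T gamma &
    forall e : R, 0 < e -> exists T1 : R, 0 < T1 /\ forall t, T1 <= t ->
      Omega (gamma t) /\ mnorm m (gamma t - t *: b) <= t * e].
Proof.
have fin n : (mane x (2 ^+ n.+1 *: b) < +oo)%E.
  by apply: (mane_from_tOmega m0 hF d2 l0 tx); apply: OmegaZ => //; rewrite expf_neq0.
have /choice[Sg hSg] : forall n, exists Sg : R * (R -> 'M[R]_(N, d)),
  [/\ 0 < Sg.1, Sg.2 0 = x, Sg.2 Sg.1 = 2 ^+ n.+1 *: b & near_minimizer n.+1%:R^-1 Sg.1 Sg.2].
  move=> n; have e0 : 0 < n.+1%:R^-1 :> R by rewrite invr_gt0.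
  have [S [g [S0 h g0 gS lt]]] := mane_near hF l0 (fin n) e0.
  exists (S, g); split => //; split => //=; rewrite g0 gS //.
  exact: ltW.
pose S n := (Sg n).1; pose g n := (Sg n).2.
have S0 n : 0 < S n by have [] := hSg n.
have g0 n : g n 0 = x by have [] := hSg n.
have gS n : g n (S n) = 2 ^+ n.+1 *: b by have [] := hSg n.
have gn n : near_minimizer n.+1%:R^-1 (S n) (g n) by have [] := hSg n.
have gn1 n : near_minimizer 1 (S n) (g n).
  have [h1 h2 h3] := gn n; split=> //; apply: le_trans h3 _.
  by rewrite leeD2l // lee_fin invf_le1 ?ler1n.
have [k2 hk2] := near_minimizer_action.
have [cn cn0 hcn] := @norm_le_mnorm R N d m m0.
have equi (T : R) : 0 <= T -> exists (H : R) n0, 0 <= H /\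
    forall n s t, (n0 <= n)%N -> 0 <= s -> s <= t -> t <= T ->
      `|g n t - g n s| ^+ 2 <= H * (t - s).
  move=> T0; have k2T : 2 ^+ k2 <= 2 ^+ k2 + T by rewrite lerDl.
  have [A [n0 [A0 hA]]] := hk2 _ k2T.
  exists (cn ^+ 2 * (2 * A)), n0; split; first by rewrite mulr_ge0 ?sqr_ge0 // mulr_ge0.
  move=> n s t nn0 s0 st tT; have [TS hact] := hA n _ _ nn0 (S0 n) (gn1 n) (g0 n) (gS n).
  have [h1 _ _] := gn n.
  have tT' : t <= 2 ^+ k2 + T by apply: le_trans tT _; rewrite lerDr exprn_ge0.
  have := act_holder s0 st tT' (abs_continuous_sub (lexx _) TS h1) hact => h.
  apply: (@le_trans _ _ ((cn * mnorm m (g n t - g n s)) ^+ 2)).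
    by rewrite ler_pXn2r ?nnegrE // mulr_ge0 ?mnorm_ge0 // ltW.
  by rewrite exprMn -[leRHS]mulrA ler_wpM2l ?sqr_ge0.
have [|phi [gamma [hphi cvg]]] := equicontinuous_extraction equi.
  by exists `|x| => n; rewrite g0.
have gamma0 : gamma 0 = x.
  have c := cvg 0 (lexx _); apply/eqP; rewrite eq_sym; apply/eqP.
  have -> : x = lim (g (phi j) 0 @[j --> \oo]).
    have -> : (fun j => g (phi j) 0) = (fun=> x) by apply/funext => j; exact: g0.
    by rewrite lim_cst.
  exact: cvg_lim.
have mcvg (t e : R) : 0 <= t -> 0 < e -> exists j0, forall j, (j0 <= j)%N ->
    mnorm m (g (phi j) t - gamma t) <= e.
  move=> t0 e0; have [c c0 hc] := @mnorm_le_norm R N d m m0.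
  have /cvgrPdist_le /(_ (e / c) (divr_gt0 e0 c0)) [j0 _ hj] := cvg t t0.
  exists j0 => j jj; have := hj j jj => /= h; apply: le_trans (hc _) _.
  by rewrite mulrC -ler_pdivlMr // distrC.
have asym (e : R) : 0 < e -> exists T1 : R, 0 < T1 /\ forall t, T1 <= t ->
    mnorm m (gamma t - t *: b) <= t * e.
  move=> e0; have [k1 hk1] := near_minimizer_direction m0 hF l0 f0 cf hf hB d2 tx ob bb e0.
  exists (2 ^+ k1); split; first exact: exprn_gt0.
  move=> t t1; have t0 : 0 < t by apply: lt_le_trans t1; exact: exprn_gt0.
  apply/ler_addgt0Pr => e' e'0; have [j0 hj0] := mcvg t e' (ltW t0) e'0.
  pose j := maxn j0 (maxn k1 (Num.bound t)).
  have jk : (maxn k1 (Num.bound t) <= phi j)%N by apply: leq_trans (hphi j); exact: leq_maxr.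
  move: jk; rewrite geq_max => /andP[jk1 jt].
  have [_ dev] := hk1 (phi j) _ _ jk1 (S0 _) (gn1 _) (g0 _) (gS _).
  have tj : t <= 2 ^+ phi j by apply: ltW; exact: upper_nthrootP.
  apply: le_trans (mnorm_dist_le m0 _ (g (phi j) t) _) _; rewrite addrC.
  by apply: lerD; [exact: dev|rewrite mnorm_distC; apply: hj0; exact: leq_maxl].
(* Dividing by [t] brings [gamma t] near [b], where pair distances are bounded below; scaling
   creates no collision. *)
have asymO (e : R) : 0 < e -> exists T1 : R, 0 < T1 /\ forall t, T1 <= t ->
    Omega (gamma t) /\ mnorm m (gamma t - t *: b) <= t * e.
  move=> e0; have [e1 [kappa [L [e10 k0 hu]]]] := pair_distances_near ob.
  have e'0 : 0 < Num.min e (e1 / cn) by rewrite lt_min e0 divr_gt0.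
  have [T1 [T10 hT1]] := asym _ e'0; exists T1; split=> // t tT.
  have t0 := lt_le_trans T10 tT; have h := hT1 t tT; split; last first.
    by apply: le_trans h _; rewrite ler_pM2l // ge_min lexx.
  have -> : gamma t = t *: (t^-1 *: gamma t) by rewrite scalerA divff ?gt_eqF // scale1r.
  apply: OmegaZ; first by rewrite gt_eqF.
  move=> i j ij e2; have hd : `|t^-1 *: gamma t - b| <= e1.
    apply: le_trans (hcn _) _; rewrite -ler_pdivlMl // mulrC.
    have -> : t^-1 *: gamma t - b = t^-1 *: (gamma t - t *: b).
      by rewrite scalerBr scalerA mulVf ?gt_eqF // scale1r.
    rewrite mnormZ gtr0_norm ?invr_gt0 // ler_pdivrMl //.
    by apply: le_trans h _; rewrite ler_pM2l // ge_min lexx orbT.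
  have := hu _ hd i j ij; rewrite e2 subrr => /andP[+ _].
  by rewrite -(scale0r 0) enormZ normr0 mul0r leNgt k0.
have [T1 [T10 hT1]] := asymO 1 ltr01.
(* Beyond [T1] the point [gamma T] is collision-free; beyond [2 ^+ k2] the approximating curves of
   large index are defined up to [T]. *)
have minim T : T1 + 2 ^+ k2 <= T -> near_minimizer 0 T gamma.
  move=> hT; have T0 : 0 < T by apply: lt_le_trans hT; rewrite addr_gt0 // exprn_gt0.
  have TT1 : T1 <= T by apply: le_trans hT; rewrite lerDl exprn_ge0.
  have Tk2 : 2 ^+ k2 <= T by apply: le_trans hT; rewrite lerDr ltW.
  have [oT _] := hT1 T TT1.
  have [A [n0 [A0 hA]]] := hk2 T Tk2.
  have finT := mane_from_tOmega m0 hF d2 l0 tx oT.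
  have ffT : mane x (gamma T) \is a fin_num by rewrite ge0_fin_numE // (mane_ge0 m hF l0).
  pose M0 := fine (mane x (gamma T)); have M0E : mane x (gamma T) = M0%:E by rewrite /M0 fineK.
  have key (e : R) : 0 < e -> abs_continuous m 0 T gamma /\ (act gamma 0%R T <= (M0 + e)%:E)%E.
    move=> e0; have [r [M [r0 Mge0 _ hr]]] := mane_ball m0 hF oT.
    have lM : 0 < lambda + M by rewrite ltr_pwDl.
    (* The error [e] is shared out: a quarter for near-minimality and two for moving from [gamma T]
       to the nearby [g (phi j) T] in time [tau]. [tau] limits the part proportional to duration,
       [eta] the kinetic part. *)
    have [tau [tau0 tauE]] : exists tau, 0 < tau /\ (lambda + M) * tau = e / 4.
      exists (e / 4 / (lambda + M)); split; first by rewrite !divr_gt0.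
      by rewrite mulrC divfK // gt_eqF.
    pose eta := Num.min (r / (2 * cn)) (Num.sqrt (e * tau / 2)).
    have eta0 : 0 < eta by rewrite lt_min divr_gt0 ?mulr_gt0 // sqrtr_gt0 divr_gt0 // mulr_gt0.
    have [j0 hj0] := mcvg T eta (ltW T0) eta0.
    pose j1 := maxn (maxn j0 n0) (Num.truncn (4 / e)).
    have hj j : (j1 <= j)%N -> T <= S (phi j) /\ (act (g (phi j)) 0%R T <= (M0 + e)%:E)%E.
      rewrite !geq_max => /andP[/andP[jj0 jn0] je].
      have [TS _] := hA (phi j) _ _ (leq_trans jn0 (hphi j)) (S0 _) (gn1 _) (g0 _) (gS _).
      split=> //; have [_ _] := near_minimizer_sub m0 hF l0 T0 TS (gn (phi j)).
      move=> /le_trans; apply; rewrite g0.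
      have h1 : (phi j).+1%:R^-1 <= e / 4.
        rewrite -[e / 4]invrK lef_pV2 ?posrE ?invr_gt0 ?divr_gt0 // invfM invrK mulrC.
        apply: le_trans (ltW (truncnS_gt _)) _; rewrite ler_nat ltnS.
        exact: leq_trans je (hphi j).
      have h2 := hj0 j jj0.
      have h3 : `|g (phi j) T - gamma T| < r.
        apply: le_lt_trans (hcn _) _.
        have : mnorm m (g (phi j) T - gamma T) <= r / (2 * cn).
          by apply: le_trans h2 _; rewrite ge_min lexx.
        by rewrite ler_pdivlMr ?mulr_gt0 //; nra.
      have h4 := hr lambda (gamma T) (g (phi j) T) tau l0 _ h3 tau0.
      rewrite subrr normr0 in h4; have {}h4 := h4 r0.
      have h5 : mnorm m (g (phi j) T - gamma T) ^+ 2 / (2 * tau) <= e / 4.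
        have h6 : mnorm m (g (phi j) T - gamma T) ^+ 2 <= e * tau / 2.
          rewrite -[leRHS]sqr_sqrtr; last by rewrite divr_ge0 // mulr_ge0 // ltW.
          rewrite ler_pXn2r ?nnegrE ?mnorm_ge0 ?sqrtr_ge0 //.
          by apply: le_trans h2 _; rewrite ge_min lexx orbT.
        by rewrite ler_pdivrMr ?mulr_gt0 //; lra.
      have h7 : (mane x (g (phi j) T) <= (M0 + e / 2)%:E)%E.
        apply: le_trans (mane_triangle m0 hF l0 _ (gamma T) _) _.
        apply: le_trans (leeD (lexx _) h4) _.
        by rewrite M0E -EFinD lee_fin tauE; lra.
      apply: le_trans (leeD h7 (lexx _)) _; rewrite -EFinD lee_fin.
      by apply: (@le_trans _ _ (M0 + e / 2 + e / 4)); [rewrite lerD2l|lra].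
    pose G j := g (phi (j + j1)%N).
    have GAC j : abs_continuous m 0 T (G j).
      have [TS _] := hj (j + j1)%N (leq_addl _ _); have [h _ _] := gn (phi (j + j1)%N).
      exact: abs_continuous_sub h.
    have Gact j : (act (G j) 0%R T <= (M0 + e)%:E)%E by have [] := hj (j + j1)%N (leq_addl _ _).
    have Gcvg (r' : R) : 0 <= r' <= T -> G j r' @[j --> \oo] --> gamma r'.
      move=> /andP[r'0 _]; have := cvg r' r'0.
      by rewrite -(cvg_shiftn j1).
    split; first exact: (limit_abs_continuous m0 hF l0 T0 GAC Gact Gcvg).
    exact: (limit_act_le m0 hF l0 T0 GAC Gact Gcvg).
  split; first by have [] := key 1 ltr01.
  - by rewrite gamma0.
  rewrite adde0 gamma0 M0E; apply/lee_addgt0Pr => e e0.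
  by rewrite -EFinD; have [] := key e e0.
exists gamma; split=> // T T0.
(* At an early time [gamma T] may be a collision, so minimality is inherited from a later time. *)
apply: near_minimizer_sub (minim (T + (T1 + 2 ^+ k2)) _) => //.
- by rewrite lerDl addr_ge0 ?exprn_ge0 // ltW.
- by rewrite lerDr ltW.
Qed.

End ray.

(** * Newton's equation *)

Section smooth_potential.
Variables (R : realType) (N d : nat) (Fp : pair_potentials R N d).
Hypotheses (hF : condF Fp) (hC : C2_potential Fp).
Implicit Types (x y e : 'M[R]_(N, d)).

Local Notation L := (@pair_rows R N d).

Lemma pair_rows_linear i j (h : R) e y : L i j (h *: e + y) = h *: L i j e + L i j y.
Proof. by rewrite /pair_rows !linearP. Qed.

(** Real-valued form of the potential on [Omega]; at collisions it need not agree with the extended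
    one. *)
Definition pair_sum y : R := \sum_(i < N) \sum_(j < N | (i < j)%N) Fp i j (L i j y).

Definition pair_sum_derive e y : R :=
  \sum_(i < N) \sum_(j < N | (i < j)%N) 'D_(L i j e) (Fp i j) (L i j y).

Lemma is_derive_pair_sum e y : Omega y -> is_derive y e pair_sum (pair_sum_derive e y).
Proof.
move=> oy.
pose G (i j : 'I_N) y := if (i < j)%N then Fp i j (L i j y) else 0.
pose dG (i j : 'I_N) := if (i < j)%N then 'D_(L i j e) (Fp i j) (L i j y) else 0.
have -> : pair_sum = \sum_(i < N) \sum_(j < N) G i j.
  apply/funext => z; rewrite /pair_sum fct_sumE; apply: eq_bigr => i _.
  by rewrite fct_sumE big_mkcond.
have -> : pair_sum_derive e y = \sum_(i < N) \sum_(j < N) dG i j.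
  by apply: eq_bigr => i _; rewrite big_mkcond.
apply: is_derive_sum => i; apply: is_derive_sum => j; rewrite /G /dG.
case: ifPn => ij; last exact: is_derive_cst.
have [hd _] := hC ij; have := hd _ (Omega_offdiag oy ij) => /(@diff_derivable _ _ _ _ _ (L i j e)) df.
have E : (fun h : R => h^-1 *: (Fp i j (L i j (h *: e + y)) - Fp i j (L i j y))) =
    (fun h : R => h^-1 *: (Fp i j (h *: L i j e + L i j y) - Fp i j (L i j y))).
  by apply/funext => h; rewrite pair_rows_linear.
by apply: DeriveDef; rewrite /derivable /derive /= E.
Qed.

Lemma pair_sum_derive_continuous e y : Omega y -> {for y, continuous (pair_sum_derive e)}.
Proof.
move=> oy.
pose dG (i j : 'I_N) y := if (i < j)%N then 'D_(L i j e) (Fp i j) (L i j y) else 0.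
have -> : pair_sum_derive e = (fun y => \sum_(i < N) \sum_(j < N) dG i j y).
  by apply/funext => z; apply: eq_bigr => i _; rewrite big_mkcond.
have FF : Filter (nbhs y) by exact: nbhs_filter.
apply: (@cvg_finite_sum R _ (nbhs y) _ _ (fun i z => \sum_(j < N) dG i j z) _ FF) => i.
apply: (@cvg_finite_sum R _ (nbhs y) _ _ (dG i) _ FF) => j; rewrite /dG.
case: ifPn => ij; last exact: cvg_cst.
have [_ hd] := hC ij; have [hd' _] := hd (L i j e).
have := hd' _ (Omega_offdiag oy ij) => /differentiable_continuous c.
exact: (cvg_comp _ _ (@pair_rows_continuous R N d i j y) c).
Qed.

Lemma Omega_open : open (@Omega R N d).
Proof.
rewrite openE => y oy; have [M hM] := potential_near hF oy.
by apply: filterS hM => z [].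
Qed.

Lemma potential_pair_sum y : Omega y -> potential Fp y = (pair_sum y)%:E.
Proof. exact: potentialE. Qed.

Lemma grad_potentialE (m : 'I_N -> R) y i k : Omega y ->
  grad_potential m Fp y i k = (m i)^-1 * pair_sum_derive (delta_mx i k) y.
Proof.
move=> oy; rewrite mxE; congr (_ * _).
have <- := @derive_val _ _ _ _ _ _ _ (is_derive_pair_sum (delta_mx i k) oy).
apply: near_eq_derive; have : nbhs y (@Omega R N d) by apply: open_nbhs_nbhs; split => //; exact: Omega_open.
by apply: filterS => z oz; rewrite potential_pair_sum.
Qed.

Lemma pair_sum_line e y (t : R) : Omega (y + t *: e) ->
  is_derive t 1 (fun s => pair_sum (y + s *: e)) (pair_sum_derive e (y + t *: e)).
Proof.
move=> oy; have [dF <-] := is_derive_pair_sum e oy.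
have E : (fun h : R => h^-1 *: (pair_sum (y + (h *: (1 : R) + t) *: e) - pair_sum (y + t *: e))) =
    (fun h : R => h^-1 *: (pair_sum (h *: e + (y + t *: e)) - pair_sum (y + t *: e))).
  apply/funext => h; congr (_ *: (pair_sum _ - _)).
  by rewrite scalerDl [h *: 1]mulr1 addrCA.
by apply: DeriveDef; rewrite /derivable /derive /= E.
Qed.

(** Mean value theorem with a derivative continuous at [p]. The estimate is uniform in [y] near [p]
    because the hat displaces a whole arc of the curve. *)
Lemma pair_sum_increment e p w : `|e| <= 1 -> Omega p -> 0 < w -> exists2 r : R, 0 < r &
  forall y (h : R), `|y - p| < r -> `|h| < r ->
    [/\ Omega y, Omega (y + h *: e) & `|pair_sum (y + h *: e) - pair_sum y - h * pair_sum_derive e p| <= w * `|h|].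
Proof.
move=> e1 op w0.
have no : nbhs p (@Omega R N d) by apply: open_nbhs_nbhs; split => //; exact: Omega_open.
have /cvgrPdist_le /(_ w w0) nc := @pair_sum_derive_continuous e p op.
have FF : Filter (nbhs p) by exact: nbhs_filter.
have /nbhs_ballP[r /= r0 hr] := @filterI _ _ FF _ _ no nc.
have {}hr z : `|z - p| < r -> Omega z /\ `|pair_sum_derive e p - pair_sum_derive e z| <= w.
  by move=> h; apply: hr; rewrite -ball_normE /= distrC.
exists (r / 3); first by rewrite divr_gt0.
(* The radius is doubled because for negative [h] the segment is run from [y + h *: e], which is
   only that close to [p]. *)
have main y (h : R) : `|y - p| < 2 * (r / 3) -> 0 <= h < r / 3 ->
    `|pair_sum (y + h *: e) - pair_sum y - h * pair_sum_derive e p| <= w * h.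
  move=> yp /andP[h0 hr3].
  have seg (t : R) : 0 <= t <= h -> `|y + t *: e - p| < r.
    move=> /andP[t0 th]; rewrite addrAC; apply: le_lt_trans (ler_normD _ _) _.
    rewrite normrZ ger0_norm //; have : t * `|e| <= t * 1 by rewrite ler_wpM2l.
    by move: yp; lra.
  have der (t : R) : 0 <= t <= h ->
      is_derive t 1 (fun s => pair_sum (y + s *: e)) (pair_sum_derive e (y + t *: e)).
    by move=> th; apply: pair_sum_line; have [] := hr _ (seg t th).
  have cont : {within `[0, h], continuous (fun s : R => pair_sum (y + s *: e))}.
    by apply: derivable_within_continuous => t; rewrite in_itv /= => th; have [] := der t th.
  have der' (t : R) : t \in `]0, h[ ->
      is_derive t 1 (fun s => pair_sum (y + s *: e)) (pair_sum_derive e (y + t *: e)).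
    by rewrite in_itv /= => /andP[/ltW t0 /ltW th]; apply: der; rewrite t0 th.
  have [c] := MVT_segment h0 der' cont.
  rewrite in_itv /= => ch; rewrite subr0 scale0r addr0 => ->.
  have [_ hc] := hr _ (seg c ch).
  by rewrite mulrC -mulrBr normrM ger0_norm // mulrC ler_wpM2r // distrC.
move=> y h yp hh; have r30 : 0 < r / 3 by rewrite divr_gt0.
have oy : Omega y by have [] := hr y; [lra|].
have yhp : `|y + h *: e - p| < 2 * (r / 3).
  rewrite addrAC; apply: le_lt_trans (ler_normD _ _) _; rewrite normrZ.
  have : `|h| * `|e| <= `|h| * 1 by rewrite ler_wpM2l.
  by move: yp hh; lra.
split=> //; first by have [] := hr (y + h *: e); [lra|].
have [h0|h0] := leP 0 h.
  rewrite (ger0_norm h0); apply: main; first by lra.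
  by move: hh; rewrite ger0_norm // h0.
have nh : `|h| = - h by rewrite ltr0_norm.
rewrite nh in hh *.
have := main (y + h *: e) (- h); rewrite scaleNr addrK mulNr opprK.
move=> H; have -> : pair_sum (y + h *: e) - pair_sum y - h * pair_sum_derive e p =
   - (pair_sum y - pair_sum (y + h *: e) + h * pair_sum_derive e p) by ring.
by rewrite normrN; apply: H; rewrite ?yhp // hh oppr_ge0 ltW.
Qed.

End smooth_potential.

(** * First variation of the action of a minimizer *)

Section first_variation.
Variables (R : realType) (N d : nat) (m : 'I_N -> R) (Fp : pair_potentials R N d).
Hypotheses (m0 : forall i, 0 < m i) (hF : condF Fp).
Notation mu := (@lebesgue_measure R).
Implicit Types (gamma : R -> 'M[R]_(N, d)) (e p : 'M[R]_(N, d)).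

Lemma is_derive_quadratic (a b r : R) :
  is_derive r 1 (fun y : R => a * y + b * (y ^+ 2 / 2)) (a + r * b).
Proof.
have -> : (fun y : R => a * y + b * (y ^+ 2 / 2)) =
    (fun y : R => 0 + y * a) + (b / 2) \*: (fun y : R => (0 + y * 1) ^+ 2).
  by apply/funext => y; rewrite fctE /=; rewrite /GRing.scale /=; field.
by apply: is_derive_eq; rewrite /GRing.scale /=; field.
Qed.

Lemma integral_affine (s t a b : R) : s < t ->
  (\int[mu]_(r in `[s, t]) (a + r * b)%:E =
   (a * (t - s) + b * ((t ^+ 2 - s ^+ 2) / 2))%:E)%E.
Proof.
move=> st; pose G y : R := a * y + b * (y ^+ 2 / 2).
have cG : continuous G.
  move=> y; apply: differentiable_continuous; apply/derivable1_diffP.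
  by have [] := is_derive_quadratic a b y.
rewrite (@continuous_FTC2 _ _ G) //.
- by rewrite -EFinB /G; congr EFin; field.
- apply: continuous_subspaceT => y; apply: differentiable_continuous; apply/derivable1_diffP.
  by have [] := is_derive_affine a b y.
- split; first by move=> y _; have [] := is_derive_quadratic a b y.
    by apply: cvg_at_right_filter; exact: cG.
  by apply: cvg_at_left_filter; exact: cG.
move=> y _; rewrite derive1E.
exact: (@derive_val _ _ _ _ _ _ _ (is_derive_quadratic a b y)).
Qed.

(** The pointwise increment is bounded by an affine function of time, since the weight [a + r * b]
    is nonnegative and comes out of the absolute value. *)
Lemma pot_tilt gamma s t a b h D w e : s < t -> abs_continuous m s t gamma ->
  (pot Fp gamma s t < +oo)%E ->
  (forall r, s <= r <= t -> [/\ 0 <= a + r * b, Omega (gamma r),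
     Omega (gamma r + (h * (a + r * b)) *: e) &
     `|pair_sum Fp (gamma r + (h * (a + r * b)) *: e) - pair_sum Fp (gamma r) -
       (h * (a + r * b)) * D| <= w * `|h * (a + r * b)|]) ->
  (pot Fp (fun r => gamma r + (h * (a + r * b)) *: e)%R s t <= pot Fp gamma s t +
    ((h * D + w * `|h|) * (a * (t - s) + b * ((t ^+ 2 - s ^+ 2) / 2)))%:E)%E.
Proof.
move=> st hAC fin hr; pose K := h * D + w * `|h|.
pose g (r : R) := K * a + r * (K * b).
have ip : mu.-integrable `[s, t] (fun r => potential Fp (gamma r)).
  apply/integrableP; split; first exact: (pot_measurable m0 hF (ltW st) hAC).
  apply: le_lt_trans fin; rewrite le_eqVlt; apply/orP; left; apply/eqP.
  by apply: eq_integral => r _; rewrite gee0_abs // potential_ge0.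
have ig : mu.-integrable `[s, t] (fun r => (g r)%:E).
  apply: (@continuous_compact_integrable R g); first exact: segment_compact.
  apply: continuous_subspaceT => y; apply: differentiable_continuous; apply/derivable1_diffP.
  by have [] := is_derive_affine (K * a) (K * b) y.
have -> : (K * (a * (t - s) + b * ((t ^+ 2 - s ^+ 2) / 2)))%:E = (\int[mu]_(r in `[s, t]) (g r)%:E)%E.
  by rewrite integral_affine //; congr EFin; ring.
rewrite /pot -integralD //.
apply: ge0_integral_mono => r /=; first by move=> _; exact: potential_ge0.
rewrite in_itv /= => rst; have [h0 o1 o2] := hr r rst.
rewrite !potential_pair_sum // -EFinD lee_fin normrM (ger0_norm h0) => /ler_normlW.
rewrite /g /K; nra.
Qed.

Variable lambda : R.
Hypothesis l0 : 0 < lambda.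
Notation act := (act m Fp lambda).
Notation mane := (mane m Fp lambda).

Variable gamma : R -> 'M[R]_(N, d).
Hypothesis gmin : forall T, 0 < T -> near_minimizer m Fp lambda 0 T gamma.

Lemma minimizer_AC s t : 0 <= s -> s <= t -> abs_continuous m s t gamma.
Proof.
move=> s0 st; have t1 : 0 < t + 1 by rewrite ltr_wpDl // (le_trans s0).
have [h _ _] := gmin t1; apply: abs_continuous_sub h => //.
by rewrite lerDl.
Qed.

Lemma minimizer_act_fin s t : 0 <= s -> s <= t -> act gamma s t \is a fin_num.
Proof.
move=> s0 st; have t1 : 0 < t + 1 by rewrite ltr_wpDl // (le_trans s0).
have [h fin le] := gmin t1; rewrite ge0_fin_numE ?act_ge0 //.
have tt1 : t <= t + 1 by rewrite lerDl.
apply: le_lt_trans (act_sub m0 hF l0 s0 st tt1 h) _.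
by apply: le_lt_trans le _; rewrite adde0.
Qed.

(** The initial arc has finite action and cancels from the minimality on [[0, t]]. *)
Lemma minimizer_between s t gamma' : 0 < s -> s < t -> abs_continuous m s t gamma' ->
  gamma' s = gamma s -> gamma' t = gamma t -> (act gamma s t <= act gamma' s t)%E.
Proof.
move=> s0 st h' es et; have t0 := lt_trans s0 st.
have [h _] := gmin t0; rewrite adde0 (act_cat m0 hF l0 (ltW s0) (ltW st) h) => le.
have f1 := minimizer_act_fin (lexx 0) (ltW s0).
rewrite -(leeD2lE _ _ f1); apply: le_trans le _.
apply: le_trans (mane_triangle m0 hF l0 _ (gamma s) _) _; apply: leeD.
  exact: (mane_le_act m0 hF l0 s0 (minimizer_AC (lexx _) (ltW s0))).
by rewrite -es -et; exact: (mane_le_act m0 hF l0 st h').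
Qed.

Lemma minimizer_continuous q (e : R) : 0 < q -> 0 < e -> exists2 r : R, 0 < r &
  forall s, `|s - q| < r -> `|gamma s - gamma q| < e.
Proof.
move=> q0 e0; have [c c0 hc] := @norm_le_mnorm R N d m m0.
have AC2 : abs_continuous m 0 (q + 1) gamma by apply: minimizer_AC => //; rewrite addr_ge0 // ltW.
have [r r0 hr] := abs_continuous_unif AC2 (divr_gt0 e0 c0).
exists (Num.min r (Num.min q 1)); first by rewrite !lt_min r0 q0 ltr01.
move=> s; rewrite !lt_min => /andP[sr /andP[sq s1]]; apply: le_lt_trans (hc _) _.
rewrite mulrC -ltr_pdivlMr //; move: sr sq s1; rewrite !ltr_norml.
move=> /andP[a1 a2] /andP[a3 a4] /andP[a5 a6].
have [qs|sq] := leP q s; first by apply: hr => //; lra.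
by rewrite mnorm_distC; apply: hr; lra.
Qed.

Lemma wdot_delta i k p : wdot m (delta_mx i k) p = m i * p i k.
Proof.
rewrite /wdot (bigD1 i) //= [X in _ + X]big1 => [|j ji]; last first.
  by apply: big1 => l _; rewrite mxE (negbTE ji) mul0r mulr0.
rewrite addr0 (bigD1 k) //= big1 => [|l lk]; last first.
  by rewrite mxE (negbTE lk) andbF mul0r mulr0.
by rewrite addr0 mxE !eqxx mul1r.
Qed.

(* [gamma] is compared with [gamma] plus [h] times the hat function of width [ep] at [q], whose
   kinetic energy is computed exactly on the two pieces where the hat is affine. *)
Lemma hat_variation i k q ep h D w r : 0 < ep -> 0 < q - ep -> 0 <= w -> `|h| < r ->
  (forall s h', q - ep <= s <= q + ep -> `|h'| < r ->
    [/\ Omega (gamma s), Omega (gamma s + h' *: delta_mx i k) &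
     `|pair_sum Fp (gamma s + h' *: delta_mx i k) - pair_sum Fp (gamma s) - h' * D| <= w * `|h'|]) ->
  0 <= h * m i / ep * (2 * gamma q i k - gamma (q - ep) i k - gamma (q + ep) i k) +
       h ^+ 2 * m i / ep + ep * (h * D + w * `|h|).
Proof.
move=> e0 qe w0 hr hv; set e := delta_mx i k in hv.
pose a := q - ep; pose c := q + ep.
have aq : a < q by rewrite /a; lra.
have qc : q < c by rewrite /c; lra.
have ac := lt_trans aq qc.
have a0 : 0 <= a by exact: ltW.
have q0 : 0 <= q by apply: le_trans a0 (ltW aq).
pose b := ep^-1; have b0 : 0 < b by rewrite invr_gt0.
have eb : ep * b = 1 by rewrite divff // gt_eqF.
(* With [b = 1 / ep] the hat is [1 - (q - r) b] before [q] and [1 - (r - q) b] after it, written as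
   affine functions of [r] to fit [kin_tilt]. *)
pose L r := gamma r + (h * (1 - q * b + r * b)) *: e.
pose U r := gamma r + (h * (1 + q * b + r * - b)) *: e.
pose V r := if r <= q then L r else U r.
have LV r' : a <= r' <= q -> L r' = V r' by rewrite /V => /andP[_ ->].
have UV r' : q <= r' <= c -> U r' = V r'.
  move=> /andP[qr _]; rewrite /V; case: ifPn => // rq.
  have -> : r' = q by apply/eqP; rewrite eq_le rq.
  by rewrite /U /L; congr (_ + (_ * _) *: _); ring.
have hat1 r' : a <= r' <= q -> 0 <= 1 - q * b + r' * b <= 1.
  rewrite /a => /andP[h1 h2]; have := ler_wpM2r (ltW b0) h1; have := ler_wpM2r (ltW b0) h2.
  by rewrite mulrBl eb => h3 h4; apply/andP; split; lra.
have hat2 r' : q <= r' <= c -> 0 <= 1 + q * b + r' * - b <= 1.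
  rewrite /c => /andP[h1 h2]; have := ler_wpM2r (ltW b0) h1; have := ler_wpM2r (ltW b0) h2.
  by rewrite mulrDl eb => h3 h4; apply/andP; split; lra.
have small y : 0 <= y <= 1 -> `|h * y| < r.
  move=> /andP[y0 y1]; rewrite normrM (ger0_norm y0); apply: le_lt_trans hr.
  by rewrite ler_piMr.
have AC1 := minimizer_AC a0 (ltW aq); have AC2 := minimizer_AC q0 (ltW qc).
have fin1 := minimizer_act_fin a0 (ltW aq); have fin2 := minimizer_act_fin q0 (ltW qc).
have finite s t : s <= t -> abs_continuous m s t gamma -> act gamma s t \is a fin_num ->
    (kin m gamma s t < +oo)%E /\ (pot Fp gamma s t < +oo)%E.
  move=> st h'; rewrite (actE m0 hF (ltW l0) st h').
  have := kin_ge0 m gamma s t; have := pot_ge0 hF gamma s t.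
  by case: (kin m gamma s t) => [u| |] //; case: (pot Fp gamma s t) => [u'| |] // _ _ _; split; exact: ltry.
have [k1 p1] := finite _ _ (ltW aq) AC1 fin1; have [k2 p2] := finite _ _ (ltW qc) AC2 fin2.
have Lf : L = (fun r => gamma r + (h * (1 - q * b) + r * (h * b)) *: e).
  by apply/funext => y; rewrite /L; congr (_ + _ *: _); ring.
have Uf : U = (fun r => gamma r + (h * (1 + q * b) + r * (h * - b)) *: e).
  by apply/funext => y; rewrite /U; congr (_ + _ *: _); ring.
have [ACL kL] := kin_tilt m0 (h * (1 - q * b)) (h * b) e aq AC1 k1.
have [ACU kU] := kin_tilt m0 (h * (1 + q * b)) (h * - b) e qc AC2 k2.
rewrite -Lf in ACL kL; rewrite -Uf in ACU kU.
have pL : (pot Fp L a q <= pot Fp gamma a q + ((h * D + w * `|h|) *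
    ((1 - q * b) * (q - a) + b * ((q ^+ 2 - a ^+ 2) / 2)))%:E)%E.
  apply: (pot_tilt aq AC1 p1) => y ay; have /andP[y0 y1] := hat1 y ay.
  have [|o1 o2 o3] := hv y (h * (1 - q * b + y * b)) _ (small _ (hat1 y ay)).
    by move: ay => /andP[-> yq]; rewrite (le_trans yq) // ltW.
  by split.
have pU : (pot Fp U q c <= pot Fp gamma q c + ((h * D + w * `|h|) *
    ((1 + q * b) * (c - q) + - b * ((c ^+ 2 - q ^+ 2) / 2)))%:E)%E.
  apply: (pot_tilt qc AC2 p2) => y qy; have /andP[y0 y1] := hat2 y qy.
  have [|o1 o2 o3] := hv y (h * (1 + q * b + y * - b)) _ (small _ (hat2 y qy)).
    by move: qy => /andP[qy ->]; rewrite (le_trans (ltW aq)).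
  by split.
have ACV : abs_continuous m a c V.
  by apply: (abs_continuous_cat m0 (ltW aq) (ltW qc));
    [exact: eq_abs_continuous LV ACL|exact: eq_abs_continuous UV ACU].
have Va : V a = gamma a.
  rewrite -LV ?lexx ?ltW // /L.
  have -> : 1 - q * b + a * b = 0 by rewrite /a mulrBl eb; ring.
  by rewrite mulr0 scale0r addr0.
have Vc : V c = gamma c.
  rewrite -UV ?lexx ?andbT ?(ltW qc) // /U.
  have -> : 1 + q * b + c * - b = 0 by rewrite /c mulrN mulrDl eb; ring.
  by rewrite mulr0 scale0r addr0.
have := minimizer_between qe ac ACV Va Vc.
rewrite (act_cat m0 hF l0 (ltW aq) (ltW qc) (minimizer_AC a0 (ltW ac))).
rewrite (act_cat m0 hF l0 (ltW aq) (ltW qc) ACV).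
rewrite -(act_eq m0 hF l0 LV (ltW aq) ACL) -(act_eq m0 hF l0 UV (ltW qc) ACU).
rewrite (actE m0 hF (ltW l0) (ltW aq) AC1) (actE m0 hF (ltW l0) (ltW qc) AC2).
rewrite (actE m0 hF (ltW l0) (ltW aq) ACL) (actE m0 hF (ltW l0) (ltW qc) ACU).
rewrite kL kU; move: k1 p1 k2 p2 pL pU.
have := kin_ge0 m gamma a q; have := pot_ge0 hF gamma a q.
have := kin_ge0 m gamma q c; have := pot_ge0 hF gamma q c.
have := pot_ge0 hF L a q; have := pot_ge0 hF U q c.
case: (kin m gamma a q) => [K1| |] //; case: (kin m gamma q c) => [K2| |] //.
case: (pot Fp gamma a q) => [P1| |] //; case: (pot Fp gamma q c) => [P2| |] //.
case: (pot Fp L a q) => [PL| |] //; case: (pot Fp U q c) => [PU| |] //.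
rewrite -!EFinD !lee_fin => _ _ _ _ _ _ _ _ _ _.
rewrite !wdot_delta !mxE !eqxx /=.
set X := gamma q i k; set Y := gamma a i k; set Z := gamma c i k.
have -> : q - a = ep by rewrite /a; ring.
have -> : c - q = ep by rewrite /c; ring.
(* Each half of the hat has area [ep / 2]. *)
have -> : (1 - q * b) * ep + b * ((q ^+ 2 - a ^+ 2) / 2) = ep / 2.
  by rewrite /a /b; field; rewrite gt_eqF.
have -> : (1 + q * b) * ep + - b * ((c ^+ 2 - q ^+ 2) / 2) = ep / 2.
  by rewrite /c /b; field; rewrite gt_eqF.
move=> hL hU H.
have -> : h * m i / ep * (2 * X - Y - Z) + h ^+ 2 * m i / ep + ep * (h * D + w * `|h|) =
  (h * b * (m i * (X - Y)) + 2^-1 * (h * b) ^+ 2 * (m i * 1) * ep) +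
  (h * - b * (m i * (Z - X)) + 2^-1 * (h * - b) ^+ 2 * (m i * 1) * ep) +
  ((h * D + w * `|h|) * (ep / 2) + (h * D + w * `|h|) * (ep / 2)).
  by rewrite /b; field; rewrite gt_eqF.
by move: H hL hU; lra.
Qed.

(** The inequality for hats is divided by the height [h], and its quadratic term vanishes as [h]
    tends to 0: positive heights give the upper bound, negative ones the lower. *)
Lemma second_difference (hC : C2_potential Fp) i k q w : 0 < q -> Omega (gamma q) -> 0 < w ->
  exists2 r : R, 0 < r & forall ep, 0 < ep -> ep < r ->
   `|(gamma (q + ep) i k + gamma (q - ep) i k - 2 * gamma q i k) / ep ^+ 2 -
     grad_potential m Fp (gamma q) i k| <= w.
Proof.
move=> q0 oq w0; pose e : 'M[R]_(N, d) := delta_mx i k.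
have e1 : `|e| <= 1.
  apply: norm_le_entries => // i' k'; rewrite mxE.
  by case: (_ && _); rewrite ?normr1 ?normr0.
(* The gradient carries the factor [(m i)^-1], so increments of the pair sum may be off by
   [w * m i]. *)
have wm : 0 < w * m i by rewrite mulr_gt0.
have [r r0 hr] := pair_sum_increment hF hC e1 oq wm.
have [r1 r10 hr1] := minimizer_continuous q0 r0.
exists (Num.min q r1); first by rewrite lt_min q0.
move=> ep e0; rewrite lt_min => /andP[epq epr].
rewrite (grad_potentialE hF hC) //; set D := pair_sum_derive Fp _ _.
pose X := gamma (q + ep) i k + gamma (q - ep) i k - 2 * gamma q i k.
have var h : `|h| < r -> 0 <= - (h * m i / ep * X) + h ^+ 2 * m i / ep + ep * (h * D + w * m i * `|h|).
  move=> hhr; have qe : 0 < q - ep by rewrite subr_gt0.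
  have -> : - (h * m i / ep * X) =
      h * m i / ep * (2 * gamma q i k - gamma (q - ep) i k - gamma (q + ep) i k).
    by rewrite /X; ring.
  apply: (hat_variation e0 qe (ltW wm) hhr) => s h' /andP[s1 s2] hh'.
  apply: hr => //; apply: hr1; rewrite ltr_norml; apply/andP; split; lra.
have mi := m0 i; have me : 0 < m i / ep by rewrite divr_gt0.
have small z : 0 < z -> exists h, [/\ 0 < h, h < r & h * (m i / ep) <= z].
  move=> z0; exists (Num.min (r / 2) (z / (m i / ep))); split.
  - by rewrite lt_min !divr_gt0.
  - by rewrite gt_min; apply/orP; left; lra.
  - by rewrite -ler_pdivlMr // ge_min lexx orbT.
have up : m i / ep * X <= ep * D + ep * (w * m i).
  apply/ler_addgt0Pr => z z0; have [h [h0 hr' hz]] := small z z0.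
  have := var h; rewrite gtr0_norm // => /(_ hr').
  have -> : - (h * m i / ep * X) + h ^+ 2 * m i / ep + ep * (h * D + w * m i * h) =
     h * (- (m i / ep * X) + h * (m i / ep) + (ep * D + ep * (w * m i))) by ring.
  by rewrite pmulr_rge0 //; lra.
have lo : ep * D - ep * (w * m i) <= m i / ep * X.
  rewrite -lerN2; apply/ler_addgt0Pr => z z0; have [h [h0 hr' hz]] := small z z0.
  have := var (- h); rewrite normrN gtr0_norm // => /(_ hr').
  have -> : - (- h * m i / ep * X) + (- h) ^+ 2 * m i / ep + ep * (- h * D + w * m i * h) =
     h * (m i / ep * X + h * (m i / ep) - (ep * D - ep * (w * m i))) by ring.
  by rewrite pmulr_rge0 //; lra.
have P : 0 < m i * ep by rewrite mulr_gt0.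
rewrite -(ler_pM2r P) -[X in _ * X <= _](gtr0_norm P) -normrM.
have -> : (X / ep ^+ 2 - (m i)^-1 * D) * (m i * ep) = m i / ep * X - ep * D.
  by field; rewrite !gt_eqF.
by rewrite ler_norml; apply/andP; split; lra.
Qed.

End first_variation.

(** * Second symmetric differences *)

Section second_differences.
Variable R : realType.
Implicit Types (f g : R -> R).

Lemma is_derive_continuous f (x l : R) : is_derive x 1 f l -> {for x, continuous f}.
Proof. by move=> [df _]; apply: differentiable_continuous; apply/derivable1_diffP. Qed.

Lemma parabola_continuous (k a b : R) : continuous (fun s : R => k * ((s - a) * (s - b))).
Proof.
move=> s; apply: (@cvgM _ _ _ _ (cst k) (fun s => (s - a) * (s - b))); first exact: cvg_cst.
apply: (@cvgM _ _ _ _ (fun s => s - a) (fun s => s - b)); apply: cvgB;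
  by [exact: cvg_id|exact: cvg_cst].
Qed.

(** Schwarz's second symmetric derivative of [f] at [q] exists and equals [l]. *)
Definition second_difference_limit f (q l : R) := forall w : R, 0 < w ->
  exists2 r : R, 0 < r & forall ep, 0 < ep -> ep < r ->
    `|(f (q + ep) + f (q - ep) - 2 * f q) / ep ^+ 2 - l| <= w.

Lemma second_difference_limitB f g q l l' : second_difference_limit f q l ->
  second_difference_limit g q l' -> second_difference_limit (fun x => f x - g x) q (l - l').
Proof.
move=> hf hg w w0; have w20 : 0 < w / 2 by rewrite divr_gt0.
have [r r0 hr] := hf _ w20; have [r' r'0 hr'] := hg _ w20.
exists (Num.min r r'); first by rewrite lt_min r0.
move=> ep e0; rewrite lt_min => /andP[er er'].
have := hr ep e0 er; have := hr' ep e0 er'.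
set A := _ / _ - l'; set B := _ / _ - l => hA hB.
have -> : (f (q + ep) - g (q + ep) + (f (q - ep) - g (q - ep)) - 2 * (f q - g q)) / ep ^+ 2 - (l - l') = B - A.
  by rewrite /A /B; ring.
by apply: le_trans (ler_normB _ _) _; lra.
Qed.

(* Maximum principle: adding [k (s - a) (s - b)] with a small [k > 0] would create an
   interior maximum with positive second difference limit. *)
Lemma schwarz_max f (a b : R) : a < b -> {within `[a, b], continuous f} -> f a <= 0 -> f b <= 0 ->
  (forall q, a < q < b -> second_difference_limit f q 0) ->
  forall x, a <= x <= b -> f x <= 0.
Proof.
move=> ab cf fa fb hf c /andP[ac cb]; rewrite leNgt; apply/negP => fc.
have ac' : a < c by rewrite lt_neqAle ac andbT; apply/eqP => e; move: fc; rewrite -e; lra.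
have cb' : c < b by rewrite lt_neqAle cb andbT; apply/eqP => e; move: fc; rewrite e; lra.
pose P := (c - a) * (b - c); have P0 : 0 < P by rewrite mulr_gt0 // subr_gt0.
(* Half of [f c] survives the perturbation, so the perturbed function is positive at [c] while it is
   nonpositive at both ends. *)
pose k := f c / (2 * P); have k0 : 0 < k by rewrite divr_gt0 // mulr_gt0.
have kP : k * P = f c / 2 by rewrite /k; field; rewrite gt_eqF.
pose psi s := f s + k * ((s - a) * (s - b)).
have cpsi : {within `[a, b], continuous psi}.
  have cp : {within `[a, b], continuous (fun s => k * ((s - a) * (s - b)))}.
    by apply: continuous_subspaceT; exact: parabola_continuous.
  by move=> s; apply: cvgD; [exact: cf|exact: cp].
have [q] := EVT_max (ltW ab) cpsi; rewrite in_itv /= => /andP[aq qb] hq.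
have psic : 0 < psi c.
  have -> : psi c = f c - k * P by rewrite /psi /P; ring.
  by rewrite kP; lra.
have psiq : 0 < psi q by apply: lt_le_trans psic _; apply: hq; rewrite in_itv /= ac cb.
have aq' : a < q.
  rewrite lt_neqAle aq andbT; apply/eqP => e.
  by move: psiq; rewrite /psi -e subrr mul0r mulr0 addr0; lra.
have qb' : q < b.
  rewrite lt_neqAle qb andbT; apply/eqP => e.
  by move: psiq; rewrite /psi e subrr mulr0 mulr0 addr0; lra.
have aqb : a < q < b by rewrite aq' qb'.
have [r r0 hr] := hf q aqb k k0.
pose ep := Num.min (r / 2) (Num.min (q - a) (b - q)).
have e0 : 0 < ep by rewrite !lt_min divr_gt0 // !subr_gt0 aq'.
have er : ep < r by rewrite gt_min; apply/orP; left; lra.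
have ea : ep <= q - a by rewrite /ep !ge_min lexx orbT.
have eb : ep <= b - q by rewrite /ep !ge_min lexx !orbT.
have h1 : psi (q + ep) <= psi q by apply: hq; rewrite in_itv /=; apply/andP; split; lra.
have h2 : psi (q - ep) <= psi q by apply: hq; rewrite in_itv /=; apply/andP; split; lra.
(* The parabola has second difference [2 k ep^2], so at the maximum that of [f] is at most
   [- 2 k ep^2], against the bound [k ep^2] in absolute value. *)
have := hr ep e0 er; rewrite subr0 ler_norml => /andP[h3 _].
have e2 : 0 < ep ^+ 2 by rewrite exprn_gt0.
move: h3; rewrite ler_pdivlMr // => h3.
have ke : 0 < k * ep ^+ 2 by rewrite mulr_gt0.
by move: h1 h2; rewrite /psi; nra.
Qed.

(** The maximum principle is applied to the difference from the chord [l] with both signs. *)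
Lemma schwarz_affine f (a b : R) : a < b -> {within `[a, b], continuous f} ->
  (forall q, a < q < b -> second_difference_limit f q 0) ->
  forall x, a <= x <= b -> f x = f a + (x - a) * ((f b - f a) / (b - a)).
Proof.
move=> ab cf hf x xab; pose s := (f b - f a) / (b - a).
have sE : s * (b - a) = f b - f a by rewrite divfK // gt_eqF // subr_gt0.
pose l y := (f a - a * s) + y * s.
have cl : continuous l.
  by move=> y; exact: is_derive_continuous (is_derive_affine _ _ _).
have hl q : second_difference_limit l q 0.
  move=> w w0; exists 1 => // ep _ _.
  have -> : l (q + ep) + l (q - ep) - 2 * l q = 0 by rewrite /l; ring.
  by rewrite mul0r subr0 normr0 ltW.
have la : l a = f a by rewrite /l; ring.
have lb : l b = f b by rewrite /l; lra.
have cl' : {within `[a, b], continuous l} by exact: continuous_subspaceT.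
have -> : f a + (x - a) * s = l x by rewrite /l; ring.
apply/eqP; rewrite eq_le; apply/andP; split.
  rewrite -subr_le0; apply: (@schwarz_max (fun y => f y - l y) a b) => //.
  - by move=> y; apply: cvgB; [exact: cf|exact: cl'].
  - by rewrite la subrr.
  - by rewrite lb subrr.
  by move=> q qab; rewrite -(subr0 0); apply: second_difference_limitB; [exact: hf|exact: hl].
rewrite -subr_le0; apply: (@schwarz_max (fun y => l y - f y) a b) => //.
- by move=> y; apply: cvgB; [exact: cl'|exact: cf].
- by rewrite la subrr.
- by rewrite lb subrr.
by move=> q qab; rewrite -(subr0 0); apply: second_difference_limitB; [exact: hl|exact: hf].
Qed.

(** Mean value theorem for [F (q + s) + F (q - s) - l s^2]: its derivative is the increment of [f]
    over [[q - s, q + s]] minus [2 l s], which the straddling quotient controls. *)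
Lemma second_difference_derive (F f : R -> R) (q l rho : R) : 0 < rho ->
  (forall y, `|y - q| < rho -> is_derive y 1 F (f y)) -> is_derive q 1 f l ->
  second_difference_limit F q l.
Proof.
move=> rho0 dF df w w0; have w20 : 0 < w / 2 by rewrite divr_gt0.
have [r r0 hr] := straddle_quotient df w20.
exists (Num.min rho (r / 2)); first by rewrite lt_min rho0 divr_gt0.
move=> ep e0; rewrite lt_min => /andP[erho er].
pose u s := F (q + s * 1) + F (q + s * -1) - (2 * l) * (s ^+ 2 / 2).
pose du s := f (q + s * 1) * 1 + f (q + s * -1) * -1 - (0 + s * (2 * l)).
have dcomp (b s : R) : `|s * b| < rho -> is_derive s 1 (fun s => F (q + s * b)) (f (q + s * b) * b).
  move=> hs; have d1 := is_derive_affine q b s.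
  have d2 : is_derive (q + s * b) 1 F (f (q + s * b)) by apply: dF; rewrite addrAC subrr add0r.
  exact: (@is_derive1_comp _ F (fun s => q + s * b) s _ _ d2 d1).
have d_u (s : R) : `|s| < rho -> is_derive s 1 u (du s).
  move=> hs; apply: is_deriveB; last first.
    have -> : (fun s : R => 2 * l * (s ^+ 2 / 2)) = (fun s : R => 0 * s + 2 * l * (s ^+ 2 / 2)).
      by apply/funext => y; rewrite mul0r add0r.
    exact: is_derive_quadratic.
  apply: is_deriveD; first by apply: dcomp; rewrite mulr1.
  by apply: dcomp; rewrite mulrN1 normrN.
have d_u' (s : R) : s \in `]0, ep[ -> is_derive s 1 u (du s).
  by rewrite in_itv /= => /andP[s0 se]; apply: d_u; rewrite gtr0_norm // (lt_trans se).
have cu : {within `[0, ep], continuous u}.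
  apply: derivable_within_continuous => s; rewrite in_itv /= => /andP[s0 se].
  by have [] := d_u s; rewrite ?ger0_norm // (le_lt_trans se).
have [c] := MVT e0 d_u' cu; rewrite in_itv /= => /andP[c0 ce].
rewrite subr0 => E.
have h : `|(f (q + c) - f (q - c)) / (2 * c) - l| <= w / 2.
  have E2 : q + c - (q - c) = 2 * c by ring.
  by rewrite -E2; apply: hr; rewrite ?E2; lra.
have h1 : `|f (q + c) - f (q - c) - l * (2 * c)| <= w * c.
  have c20 : 0 < 2 * c by rewrite mulr_gt0.
  have -> : f (q + c) - f (q - c) - l * (2 * c) = ((f (q + c) - f (q - c)) / (2 * c) - l) * (2 * c).
    by rewrite mulrBl divfK // gt_eqF.
  rewrite normrM (gtr0_norm c20).
  by have := ler_wpM2r (ltW c20) h; lra.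
have uE : u ep - u 0 = F (q + ep) + F (q - ep) - 2 * F q - l * ep ^+ 2.
  by rewrite /u !mulr1 !mulrN1 oppr0 !addr0; field.
have duE : du c = f (q + c) - f (q - c) - l * (2 * c) by rewrite /du !mulr1 !mulrN1; ring.
have e2 : 0 < ep ^+ 2 by rewrite exprn_gt0.
rewrite -(ler_pM2r e2) -[X in _ * X <= _](gtr0_norm e2) -normrM.
rewrite mulrBl divfK ?gt_eqF // -uE E duE normrM (gtr0_norm e0).
apply: le_trans (ler_wpM2r (ltW e0) h1) _; rewrite expr2 mulrA ler_pM2r // ler_pM2l //.
exact: ltW.
Qed.

Lemma primitive g (a : R) : continuous g -> exists G : R -> R, forall x, a < x -> is_derive x 1 G (g x).
Proof.
move=> cg; exists (fun y => \int[@lebesgue_measure R]_(t in `[a, y]) g t) => x ax.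
have ig : (@lebesgue_measure R).-integrable `[a, x + 1] (EFin \o g).
  apply: (@continuous_compact_integrable R g); first exact: segment_compact.
  exact: continuous_subspaceT.
have xx1 : x < x + 1 by rewrite ltrDl.
have [dG <-] := @continuous_FTC1_closed R g a x _ xx1 ig ax (cg x).
by apply: DeriveDef; [exact: dG|rewrite derive1E].
Qed.

Lemma clip_continuous (a b : R) f : a <= b -> (forall x, a <= x <= b -> {for x, continuous f}) ->
  continuous (f \o clip a b).
Proof.
move=> ab cf x; apply: continuous_comp; last exact: cf (clip_itv x ab).
apply/cvgrPdist_lt => e e0; near=> y; apply: le_lt_trans (clip_dist x y ab) _.
by near: y; exact: cvgr_dist_lt.
Unshelve. all: by end_near. Qed.

(** With [H] a second primitive of [g], the difference [f - H] has vanishing second difference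
    limits, hence is affine, and [f] inherits two derivatives from [H]. *)
Lemma second_difference_twice_derivable f g (a b : R) : a < b ->
  (forall x, a <= x <= b -> {for x, continuous f}) ->
  (forall x, a <= x <= b -> {for x, continuous g}) ->
  (forall q, a < q < b -> second_difference_limit f q (g q)) ->
  forall x, a < x < b -> derivable f x 1 /\ is_derive x 1 (derive1 f) (g x).
Proof.
move=> ab cf cg fg.
(* The primitives start to the left of [a] so that [G] and [H] are derivable at [a] too. *)
have [G dG] := primitive (a - 2) (clip_continuous (ltW ab) cg).
have a1b : a - 1 <= b by lra.
have cG x : a - 1 <= x <= b -> {for x, continuous G}.
  move=> /andP[ax _]; by apply: (is_derive_continuous (dG x _)); lra.
have [H dH] := primitive (a - 2) (clip_continuous a1b cG).
have dH' x : a - 1 <= x <= b -> is_derive x 1 H (G x).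
  by move=> /andP[ax xb]; have := dH x; rewrite /= clip_id ?ax //; apply; lra.
have dG' x : a <= x <= b -> is_derive x 1 G (g x).
  by move=> /andP[ax xb]; have := dG x; rewrite /= clip_id ?ax //; apply; lra.
have Hlim q : a < q < b -> second_difference_limit H q (g q).
  move=> /andP[aq qb]; apply: (@second_difference_derive H G q (g q) (Num.min 1 (b - q))).
  - by rewrite lt_min ltr01 subr_gt0.
  - move=> y; rewrite lt_min !ltr_norml => /andP[/andP[y1 y2] /andP[y3 y4]].
    by apply: dH'; apply/andP; split; lra.
  by apply: dG'; rewrite !ltW.
have cu : {within `[a, b], continuous (fun y => f y - H y)}.
  apply: continuous_in_subspaceT => y; rewrite inE /= in_itv /= => yab.
  apply: cvgB; first exact: cf.
  by apply: (is_derive_continuous (dH' y _)); move: yab => /andP[ay ->]; rewrite andbT; lra.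
have ulim q : a < q < b -> second_difference_limit (fun y => f y - H y) q 0.
  by move=> qab; rewrite -(subrr (g q)); apply: second_difference_limitB; [exact: fg|exact: Hlim].
have aff := schwarz_affine ab cu ulim.
set k := (_ / _) in aff; set u0 := (_ - _) in aff.
pose F y := H y + ((u0 - a * k) + y * k).
have fF y : a <= y <= b -> f y = F y.
  by move=> yab; have := aff y yab; rewrite /F; lra.
have near_itv x : a < x < b -> \forall y \near x, a < y < b.
  move=> xab; near=> y; have : y \in `]a, b[ by near: y; apply: near_in_itvoo; rewrite in_itv.
  by rewrite in_itv.
have nearF x : a < x < b -> \forall y \near x, F y = f y.
  move=> /near_itv; apply: filterS => y /andP[ay yb]; rewrite fF //.
  by rewrite !ltW.
have dF x : a < x < b -> is_derive x 1 F (G x + k).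
  move=> /andP[ax xb]; apply: is_deriveD; last exact: is_derive_affine.
  by apply: dH'; apply/andP; split; lra.
have df x : a < x < b -> derivable f x 1 /\ derive1 f x = G x + k.
  move=> xab; have [d1 d2] := dF x xab; split; first exact: near_eq_derivable (nearF x xab) d1.
  by rewrite derive1E -(near_eq_derive _ (nearF x xab)).
move=> x xab; split; first by have [] := df x xab.
have nd : \forall y \near x, G y + (k + y * 0) = derive1 f y.
  by move: (near_itv x xab); apply: filterS => y /df [_ ->]; rewrite mulr0 addr0.
have dG1 : is_derive x 1 (fun y => G y + (k + y * 0)) (g x + 0).
  apply: is_deriveD; last exact: is_derive_affine.
  by apply: dG'; move: xab => /andP[/ltW -> /ltW ->].
have [d1 d2] := dG1; apply: DeriveDef; first exact: near_eq_derivable nd d1.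
by rewrite -(near_eq_derive _ nd) d2 addr0.
Unshelve. all: by end_near. Qed.

End second_differences.

(** * The equation of motion of the ray *)

Section newton.
Variables (R : realType) (N d : nat) (m : 'I_N -> R) (Fp : pair_potentials R N d).
Hypotheses (m0 : forall i, 0 < m i) (hF : condF Fp).
Variables (lambda : R) (gamma : R -> 'M[R]_(N, d)).
Hypotheses (l0 : 0 < lambda)
  (gmin : forall T, 0 < T -> near_minimizer m Fp lambda 0 T gamma).

Lemma minimizer_continuous_at q : 0 < q -> {for q, continuous gamma}.
Proof.
move=> q0; apply/cvgrPdist_lt => e e0.
have [r r0 hr] := minimizer_continuous m0 gmin q0 e0.
by exists r => // s /= qs; rewrite distrC; apply: hr; rewrite distrC.
Qed.

(** At [t0], possibly 0, only the right limit is available; it is read off from the clipped curve,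
    equal to [gamma] just after [t0]. *)
Lemma minimizer_continuous_within t0 : 0 <= t0 -> {within `[t0, +oo[, continuous gamma}.
Proof.
move=> t0_ge0; have AC1 : abs_continuous m 0 (t0 + 1) gamma.
  by apply: (minimizer_AC gmin) => //; rewrite addr_ge0.
have c01 : continuous (gamma \o clip 0 (t0 + 1)).
  by apply: (abs_continuous_clip m0) AC1; rewrite addr_ge0.
apply/continuous_within_itvcyP; split.
  move=> q; rewrite in_itv /= andbT => tq.
  by apply: minimizer_continuous_at; exact: le_lt_trans tq.
have c := c01 t0; rewrite /= /continuous_at /= clip_id ?t0_ge0 ?lerDl ?ler01 // in c.
apply: cvg_trans (cvg_at_right_filter c); apply: near_eq_cvg.
near=> y; rewrite /= clip_id //; apply/andP; split.
  by apply: le_trans t0_ge0 _; apply: ltW; near: y; exact: nbhs_right_gt.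
by near: y; apply: nbhs_right_le; rewrite ltrDl.
Unshelve. all: by end_near. Qed.

Lemma minimizer_newton (hC : C2_potential Fp) t : 0 < t -> Omega (gamma t) ->
  [/\ derivable gamma t 1, derivable (derive1 gamma) t 1 &
      derive1n 2 gamma t = grad_potential m Fp (gamma t)].
Proof.
move=> t0 ot.
have /nbhs_ballP[e e0 he] : nbhs (gamma t) (@Omega R N d).
  by apply: open_nbhs_nbhs; split; [exact: (Omega_open hF)|exact: ot].
have [r r0 hr] := minimizer_continuous m0 gmin t0 e0.
(* The window around [t] stays collision-free and within positive times. *)
pose rho := Num.min (r / 2) (t / 2).
have rho0 : 0 < rho by rewrite lt_min !divr_gt0.
have rr : rho < r by rewrite gt_min; apply/orP; left; lra.
have rt : rho < t by rewrite gt_min; apply/orP; right; lra.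
pose a := t - rho; pose b := t + rho.
have ab : a < b by rewrite /a /b; lra.
have a0 : 0 < a by rewrite /a; lra.
have oab s : a <= s <= b -> Omega (gamma s).
  rewrite /a /b => /andP[h1 h2]; apply: he; rewrite -ball_normE /= distrC; apply: hr.
  by rewrite ltr_norml; apply/andP; split; lra.
pose g i k s := (m i)^-1 * pair_sum_derive Fp (delta_mx i k) (gamma s).
have D i k := @second_difference_twice_derivable R (fun s => gamma s i k) (g i k) a b ab.
have {}D i k s : a < s < b -> derivable (fun s => gamma s i k) s 1 /\
    is_derive s 1 (derive1 (fun s => gamma s i k)) (g i k s).
  apply: D.
  - move=> q /andP[aq _]; have cq := minimizer_continuous_at (lt_le_trans a0 aq).
    exact: (cvg_comp _ _ cq (@coord_continuous _ N d i k (gamma q))).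
  - move=> q qab; have /andP[aq _] := qab; have cq := minimizer_continuous_at (lt_le_trans a0 aq).
    apply: (@cvgM _ _ _ _ (cst (m i)^-1) (fun s => pair_sum_derive Fp (delta_mx i k) (gamma s))).
      exact: cvg_cst.
    exact: (cvg_comp _ _ cq (@pair_sum_derive_continuous R N d Fp hC (delta_mx i k) (gamma q) (oab q qab))).
  move=> q /andP[aq qb] w w0.
  have oq : Omega (gamma q) by apply: oab; rewrite !ltW.
  have := second_difference m0 hF l0 gmin hC i k (lt_trans a0 aq) oq w0.
  by rewrite (grad_potentialE hF hC).
have near_itv : \forall y \near t, a < y < b.
  near=> y; have : y \in `]a, b[.
    by near: y; apply: near_in_itvoo; rewrite in_itv /= /a /b; apply/andP; split; lra.
  by rewrite in_itv.
have tab : a < t < b by rewrite /a /b; apply/andP; split; lra.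
have dg s : a < s < b -> derivable gamma s 1.
  by move=> sab; apply/derivable_mxP => i k; have [] := D i k s sab.
have E i k : \forall y \near t, derive1 (fun s => gamma s i k) y = derive1 gamma y i k.
  by apply: filterS near_itv => y yab; rewrite !derive1E derive_mx ?mxE //; exact: dg.
have dd : derivable (derive1 gamma) t 1.
  apply/derivable_mxP => i k; have [_ [d1 _]] := D i k t tab.
  exact: near_eq_derivable (E i k) d1.
split; [exact: dg|exact: dd|].
rewrite derive1nS derive1n1 derive1E derive_mx //.
apply/matrixP => i k; rewrite mxE (grad_potentialE hF hC) //.
have [_ [_ d2]] := D i k t tab.
by rewrite -(near_eq_derive _ (E i k)) d2.
Unshelve. all: by end_near. Qed.

Lemma minimizer_newton_solution (hC : C2_potential Fp) t0 : 0 <= t0 ->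
  (forall t, t0 < t -> Omega (gamma t)) -> newton_solution m Fp t0 gamma.
Proof.
move=> t00 ho; split; first exact: minimizer_continuous_within.
move=> t t0t; have [h1 h2 h3] := minimizer_newton hC (le_lt_trans t00 t0t) (ho t t0t).
by split => //; exact: ho.
Qed.

End newton.

Theorem theorem1p4 (R : realType) (d N : nat) (m : 'I_N -> R)
    (Fp : pair_potentials R N d) (lambda : R) (x a : 'M[R]_(N, d)) :
  (2 <= d)%N -> (2 <= N)%N -> (forall i, 0 < m i) ->
  condF Fp -> condG Fp ->
  0 < lambda -> tOmega m Fp x -> Omega a -> mnorm m a = 1 ->
  exists gamma : R -> 'M[R]_(N, d),
    (hyperbolic_hamiltonian m Fp lambda (Num.sqrt (2 * lambda) *: a) gamma /\
     gamma 0 = x) /\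
    exists t0 : R,
      [/\ 0 <= t0,
          forall t : R, t0 <= t -> Omega (gamma t),
          C2_potential Fp ->
            hyperbolic_newton m Fp t0 (Num.sqrt (2 * lambda) *: a) gamma &
          C2_potential Fp -> (forall t : R, 0 < t < t0 -> Omega (gamma t)) ->
            hyperbolic_newton m Fp 0 (Num.sqrt (2 * lambda) *: a) gamma /\
            gamma 0 = x].
Proof.
move=> d2 _ m0 hF hG l0 tx oa na; set b := Num.sqrt (2 * lambda) *: a.
have v0 : 0 < Num.sqrt (2 * lambda) by rewrite sqrtr_gt0 mulr_gt0.
have ob : Omega b by apply: OmegaZ => //; rewrite gt_eqF.
have bb : wdot m b b = 2 * lambda.
  rewrite -(mnorm_sqr m0) mnormZ na mulr1 gtr0_norm // sqr_sqrtr //.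
  by rewrite mulr_ge0 // ltW.
have [f [B [f0 cf hf hB]]] := condG_growth hG.
have [gamma [g0 gmin gas]] := minimizing_ray m0 hF l0 f0 cf hf hB d2 tx ob bb.
have asym : asymptotic_to b gamma.
  apply/cvgrPdist_le => e e0; have [cn cn0 hcn] := @norm_le_mnorm R N d m m0.
  have [T [T0 hT]] := gas (e / cn) (divr_gt0 e0 cn0).
  exists T; split=> [|t /ltW Tt]; first exact: num_real.
  have t0 := lt_le_trans T0 Tt.
  rewrite sub0r normrN normrZ gtr0_norm ?invr_gt0 // ler_pdivrMl //.
  apply: le_trans (hcn _) _; rewrite -ler_pdivlMl // mulrC -mulrA.
  by have [] := hT t Tt.
have tO t : 0 <= t -> tOmega m Fp (gamma t).
  rewrite le_eqVlt => /predU1P[<-|t0]; first by rewrite g0.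
  have [_ fin _] := gmin t t0; rewrite g0 in fin.
  exact: tOmega_mane fin.
exists gamma; split.
  split=> //; split=> //.
  split; [exact: (minimizer_continuous_within m0 gmin)|exact: tO|].
  move=> sigma s0; have [hAC fin le] := gmin sigma s0.
  split.
    by split; [exact: hAC|move=> s /andP[s1 _]; exact: tO|by []|by []].
  apply/eqP; rewrite eq_le; apply/andP; split.
    by move: le; rewrite adde0.
  exact: (mane_le_act m0 hF l0 s0 hAC).
(* [t0] is the time given by the rate [e = 1], after which no collision occurs. *)
have [T [T0 hT]] := gas 1 ltr01.
exists T; split; [exact: ltW|by move=> t /hT []| |].
  move=> hC; split=> //; apply: (minimizer_newton_solution m0 hF l0 gmin hC (ltW T0)).
  by move=> t /ltW /hT [].
move=> hC ho; split=> //; split=> //.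
apply: (minimizer_newton_solution m0 hF l0 gmin hC (lexx 0)) => t t0.
by have [/hT []|tT] := leP T t; last by apply: ho; rewrite t0.
Qed.
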